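(* As $w\to\infty$ we have the asymptotic expansion $$\delta(w)=\frac12+\frac1w-\frac{2\log w}{w^2}+\frac{2\gamma_0}{w^2}+\sum_{j=2}^{4}\frac{P_j(\log w)}{w^{j+1}}+O\left(\frac{(\log w)^5}{w^6}\right).$$ Here the implied constant in the error term does not depend on $w$, $\gamma_0\approx0.5772156649$ is the Euler--Mascheroni constant, and each $P_j$ ($j=2,3,4$) is a polynomial of degree $j$ whose coefficients can be computed explicitly in terms of the Stieltjes constants.
   Context: For $w>2$, $\Gamma_w\subset\mathrm{PSL}_2(\mathbb{R})$ is the (discrete) group generated by the Möbius transformations $S\colon z\mapsto -1/z$ and $T_w\colon z\mapsto z+w$ of the upper half-plane $\mathbb{H}^2$. Its limit set is the set of accumulation points (in the Riemann sphere) of all orbits of $\Gamma_w$ on $\mathbb{H}^2$, and $\delta(w)$ is the Hausdorff dimension of this limit set. The Stieltjes constants $\gamma_n$ are defined by the Laurent expansion of the Riemann zeta function at $1$: $\zeta(1+x)=\frac1x+\sum_{n=0}^\infty\frac{(-1)^n\gamma_n}{n!}x^n$. *)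

(* Defs.v *)
From HB Require Import structures.
From mathcomp Require Import all_boot all_order all_algebra.
From mathcomp Require Import complex.
From mathcomp Require Import ring.
From mathcomp Require Import all_classical all_reals all_analysis.

Set Implicit Arguments.
Unset Strict Implicit.
Unset Printing Implicit Defensive.

Import Order.TTheory GRing.Theory Num.Theory.
Import numFieldNormedType.Exports.

Local Open Scope classical_set_scope.
Local Open Scope ring_scope.
Local Open Scope complex_scope.

(* The Riemann sphere, with None as the point at infinity, carrying the
   chordal metric 2 |z - w| / sqrt ((1 + |z|^2) (1 + |w|^2)). *)

Definition riemann_sphere (R : realType) : Type := option R[i].

HB.instance Definition _ (R : realType) := Choice.on (riemann_sphere R).

Section chordal_metric.
Variable R : realType.
Implicit Types (z w : R[i]) (x y : riemann_sphere R).

Let N : R[i] -> R := @ComplexField.Normc.normc R.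

Definition chordal_dist x y : R :=
  match x, y with
  | Some z, Some w =>
      2 * ComplexField.Normc.normc (z - w)
        / (Num.sqrt (1 + ComplexField.Normc.normc z ^+ 2)
           * Num.sqrt (1 + ComplexField.Normc.normc w ^+ 2))
  | Some z, None | None, Some z =>
      2 / Num.sqrt (1 + ComplexField.Normc.normc z ^+ 2)
  | None, None => 0
  end.

(* Homogeneous coordinates [hnum : hden], in which the formulas become one. *)
Let hnum x : R[i] := if x is Some z then z else 1.
Let hden x : R[i] := if x is Some _ then 1 else 0.
Let hnorm x : R := Num.sqrt (N (hden x) ^+ 2 + N (hnum x) ^+ 2).
Let hdet x y : R[i] := hnum x * hden y - hnum y * hden x.
Let hprod x y : R[i] := hnum x * conjc (hnum y) + hden x * conjc (hden y).

Let N1 : N 1 = 1. Proof. exact: ComplexField.Normc.normc1. Qed.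
Let N0 : N 0 = 0. Proof. exact: ComplexField.Normc.normc0. Qed.
Let NM z w : N (z * w) = N z * N w.
Proof. exact: ComplexField.Normc.normcM. Qed.
Let N_ge0 z : 0 <= N z. Proof. by case: z => a b; exact: sqrtr_ge0. Qed.
Let NN z : N (- z) = N z. Proof. exact: normcN. Qed.
Let N2 (a b : R) : N (a +i* b) ^+ 2 = a ^+ 2 + b ^+ 2.
Proof. by rewrite /N /= sqr_sqrtr // addr_ge0 ?sqr_ge0. Qed.

Let hnormS z : hnorm (Some z) = Num.sqrt (1 + N z ^+ 2).
Proof.
have -> : hnorm (Some z) = Num.sqrt (N 1 ^+ 2 + N z ^+ 2) by [].
by rewrite N1 expr1n.
Qed.

Let hnorm_oo : hnorm None = 1.
Proof.
have -> : hnorm None = Num.sqrt (N 0 ^+ 2 + N 1 ^+ 2) by [].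
by rewrite N0 N1 expr0n expr1n add0r sqrtr1.
Qed.

Let hnorm_gt0 x : 0 < hnorm x.
Proof.
case: x => [z|]; rewrite ?hnormS ?hnorm_oo //.
by rewrite sqrtr_gt0 ltr_wpDr // exprn_ge0.
Qed.

Let chordalE x y : chordal_dist x y = 2 * N (hdet x y) / (hnorm x * hnorm y).
Proof.
case: x y => [z|] [w|]; rewrite ?hnormS ?hnorm_oo.
- have -> : hdet (Some z) (Some w) = z * 1 - w * 1 by [].
  by rewrite !mulr1.
- have -> : hdet (Some z) None = z * 0 - 1 * 1 by [].
  by rewrite mulr0 sub0r NN !mulr1 N1 mulr1.
- have -> : hdet None (Some w) = 1 * 1 - w * 0 by [].
  by rewrite mulr0 subr0 mulr1 N1 mulr1 mul1r.
- by rewrite /hdet subrr N0 mulr0 mul0r.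
Qed.

Let hprod_le x y : N (hprod x y) <= hnorm x * hnorm y.
Proof.
have sqN_ge0 z w : 0 <= N z ^+ 2 + N w ^+ 2 by rewrite addr_ge0 ?exprn_ge0.
rewrite -(@ler_pXn2r _ 2) ?nnegrE ?N_ge0 ?mulr_ge0 ?sqrtr_ge0 //.
rewrite exprMn !sqr_sqrtr // /hprod.
move: (hnum x) (hden x) (hnum y) (hden y) => [a1 a2] [b1 b2] [c1 c2] [d1 d2].
rewrite -subr_ge0 !N2.
set t := (X in 0 <= X).
have -> : t = (a1 * d1 - a2 * d2 - (b1 * c1 - b2 * c2)) ^+ 2 +
              (a1 * d2 + a2 * d1 - (b1 * c2 + b2 * c1)) ^+ 2 by rewrite /t; ring.
by rewrite addr_ge0 ?sqr_ge0.
Qed.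

Let hprodxx x : N (hprod x x) = hnorm x * hnorm x.
Proof.
have sqN_ge0 z w : 0 <= N z ^+ 2 + N w ^+ 2 by rewrite addr_ge0 ?exprn_ge0.
apply: (@pexpIrn _ 2); rewrite ?nnegrE ?N_ge0 ?mulr_ge0 ?sqrtr_ge0 //.
rewrite exprMn !sqr_sqrtr // /hprod.
move: (hnum x) (hden x) => [a b] [c d].
by rewrite !N2; ring.
Qed.

Let hdet_hprod x y (z : riemann_sphere R) :
  hdet x z * hprod y y = hdet x y * hprod z y + hdet y z * hprod x y.
Proof. by rewrite /hdet /hprod; ring. Qed.

Let chordal_xx x : chordal_dist x x = 0.
Proof. by rewrite chordalE /hdet subrr N0 mulr0 mul0r. Qed.

Let chordal_sym x y : chordal_dist x y = chordal_dist y x.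
Proof. by rewrite !chordalE [hnorm x * _]mulrC /hdet -NN opprB. Qed.

Let chordal_pos x y : chordal_dist x y = 0 -> x = y.
Proof.
have nz u : hnorm u != 0 by rewrite gt_eqF.
rewrite chordalE => /eqP; rewrite !mulf_eq0 invr_eq0 mulf_eq0 pnatr_eq0.
rewrite (negPf (nz x)) (negPf (nz y)) !orbF /= => /eqP.
move=> /ComplexField.Normc.eq0_normc /eqP; rewrite subr_eq0.
case: x y => [z|] [w|] //=; rewrite ?mulr1 ?mulr0.
- by move=> /eqP ->.
- by rewrite eq_sym oner_eq0.
- by rewrite oner_eq0.
Qed.

Let chordal_triangle y x (z : riemann_sphere R) :
  chordal_dist x z <= chordal_dist x y + chordal_dist y z.
Proof.
have [[x0 y0] z0] := (hnorm_gt0 x, hnorm_gt0 y, hnorm_gt0 z).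
have H : N (hdet x z) * hnorm y <=
    N (hdet x y) * hnorm z + N (hdet y z) * hnorm x.
  rewrite -(ler_pM2r y0) -mulrA -hprodxx -NM hdet_hprod.
  apply: (le_trans (le_normcD _ _)); rewrite -!/N !NM mulrDl -!mulrA.
  by rewrite lerD // ler_wpM2l.
rewrite !chordalE.
have -> : 2 * N (hdet x z) / (hnorm x * hnorm z) =
    2 / (hnorm x * hnorm z * hnorm y) * (N (hdet x z) * hnorm y).
  by field; rewrite !gt_eqF.
have -> : 2 * N (hdet x y) / (hnorm x * hnorm y) +
    2 * N (hdet y z) / (hnorm y * hnorm z) =
    2 / (hnorm x * hnorm z * hnorm y) *
    (N (hdet x y) * hnorm z + N (hdet y z) * hnorm x).
  by field; rewrite !gt_eqF.
by rewrite ler_pM2l // divr_gt0 // !mulr_gt0.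
Qed.

HB.instance Definition _ := isMetric.Build R (riemann_sphere R)
  chordal_xx chordal_pos chordal_sym chordal_triangle.

End chordal_metric.

Section hausdorff_dimension.
Context {R : realType} {T : metricType R}.
Implicit Types (A : set T) (s : R).

Definition diam A : \bar R :=
  maxe 0%E (ereal_sup [set (mdist p.1 p.2)%:E | p in A `*` A]).

Definition hausdorff_premeasure (e s : R) A : \bar R :=
  ereal_inf [set (\sum_(0 <= k <oo) diam (U k) `^ s)%E |
    U in [set U : nat -> set T |
      A `<=` \bigcup_k U k /\ forall k, (diam (U k) <= e%:E)%E]].

Definition hausdorff_measure s A : \bar R :=
  ereal_sup [set hausdorff_premeasure e s A | e in [set e : R | 0 < e]].

(* Only s > 0 is used, which does not change the infimum and avoids the
   convention needed for diam U `^ 0 at U = set0. *)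
Definition hausdorff_dim A : \bar R :=
  ereal_inf [set s%:E | s in [set s : R | 0 < s /\ hausdorff_measure s A = 0%E]].

End hausdorff_dimension.

Section hecke_group.
Variable R : realType.

Definition mx2 (a b c d : R) : 'M[R]_2 :=
  \matrix_(i, j) if i == 0 then (if j == 0 then a else b)
                 else (if j == 0 then c else d).

(* The preimage in SL_2(R) of the subgroup of PSL_2(R) generated by
   z |-> -1/z and z |-> z + w; it contains -1, as the square of the first
   generator, and both A and -A act on the upper half-plane as mobius A. *)
Inductive hecke_group (w : R) : 'M[R]_2 -> Prop :=
| hecke_S : hecke_group w (mx2 0 (-1) 1 0)
| hecke_T : hecke_group w (mx2 1 w 0 1)
| hecke_1 : hecke_group w 1%:M
| hecke_mul A B : hecke_group w A -> hecke_group w B -> hecke_group w (A *m B)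
| hecke_inv A : hecke_group w A -> hecke_group w (invmx A).

Definition mobius (A : 'M[R]_2) (z : R[i]) : R[i] :=
  ((A 0 0)%:C * z + (A 0 1)%:C) / ((A 1 0)%:C * z + (A 1 1)%:C).

Definition upper_half_plane : set R[i] := [set z | 0 < complex.Im z].

Definition hecke_orbit (w : R) (z : R[i]) : set (riemann_sphere R) :=
  [set Some (mobius A z) | A in hecke_group w].

Definition limit_set (w : R) : set (riemann_sphere R) :=
  \bigcup_(z in upper_half_plane) limit_point (hecke_orbit w z).

(* The dimension is at most 2, the sphere being bounded of dimension 2, so fine
   loses nothing. *)
Definition delta (w : R) : R := fine (hausdorff_dim (limit_set w)).

End hecke_group.

Section stieltjes.
Variable R : realType.

(* The Riemann zeta function at real s > 1. *)
Definition zeta (s : R) : R := limn (series (fun n => n.+1%:R `^ (- s))).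

(* The Laurent expansion of zeta at 1, required only on a right neighbourhood
   of the pole on the real axis: this already determines the coefficients. *)
Definition zeta_laurent (g : nat -> R) : Prop :=
  \forall x \near 0^'+,
    series (fun n => (-1) ^+ n * g n / n`!%:R * x ^+ n) @ \oo
      --> zeta (1 + x) - x^-1.

Definition stieltjes : nat -> R := get zeta_laurent.

(* The ring Q[gamma_0, gamma_1, ...]. *)
Inductive rat_stieltjes : R -> Prop :=
| rat_stieltjes_rat (q : rat) : rat_stieltjes (ratr q)
| rat_stieltjes_gamma n : rat_stieltjes (stieltjes n)
| rat_stieltjesD x y :
    rat_stieltjes x -> rat_stieltjes y -> rat_stieltjes (x + y)
| rat_stieltjesM x y :
    rat_stieltjes x -> rat_stieltjes y -> rat_stieltjes (x * y).

End stieltjes.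

(* Main.v *)
Require Import Defs.
From HB Require Import structures.
From mathcomp Require Import all_boot all_order all_algebra.
From mathcomp Require Import complex.
From mathcomp Require Import ring lra zify.
From mathcomp Require Import all_classical all_reals all_analysis.

(** Let [delta] denote the dimension of the limit set. Words in the generators can be
reduced as in a free product, so apart from countably many points the limit set is
the union of the translates by [w * m] of the real points with an infinite
expansion by the maps [x |-> - 1 / (w * a + x)], [a] a nonzero integer.

In thermodynamic terms [delta] is the [s] at which the operator sending [f] to the
sum over [a] of [`|w * a + x| ^ (- 2 s) * f (- 1 / (w * a + x))] has spectral
radius 1. For large [w] the constant function 1 is nearly an eigenfunction: the
letters [a] and [- a] cancel to first order, and on the interval of radius [2 / w],
which contains the invariant set, the sum over the letters is
[2 w^(-2s) zeta (2s) + O(w^-5)]. This gives two tests without any spectral theory: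
- if [2 w^(-2s) zeta (2s) > 1], finitely many letters already have a sum at least 1
  everywhere ([letter_sum_lower]). Normalizing the terms yields probability weights
  on words which are bounded by powers of derivatives, and a mass distribution
  argument gives [delta >= s] ([cover_weight], [hausdorff_measure_gt0]);
- if [2 w^(-2s) zeta (2s) + 96 w^-5 < 1], the sum over the words of length [n] of the
  powers of the diameters of their images decays geometrically, so these images
  cover the limit set economically ([limit_set_words], [hausdorff_measure_eq0]) and
  [delta <= s].
Moebius maps satisfy an exact mean value formula ([branches_diff]), which keeps both
arguments short.

Now put [2 s = 1 + e]. The equation [2 w^(-2s) zeta (2s) = 1] reads
[e = (2 / w) * h e * exp (- e * ln w)] with [h e = e * zeta (1 + e)], whose Taylor
coefficients are given by the Stieltjes constants. Lagrange inversion solves it in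
powers of [1 / w] with coefficients that are polynomials in [ln w]. These are listed
in [inv_coef]; that they solve the equation up to the required order is checked
directly ([inversion_residual]). Since the left-hand side of the test has a
derivative of order [w] in [s], the error [O(w^-5)] of the upper test moves [delta]
by [O(w^-6)] only; so the approximate solution shifted by a large multiple of
[(ln w)^5 / w^6] to either side passes the tests ([inversion_approx],
[delta_expansion]).

The Stieltjes constants are the coefficients of the Laurent expansion of zeta. Its
existence, the radius of convergence and the value of the constant term come from
comparing each term [k^(-1-x)] with its integral ([cvg_zeta_laurent]). *)

Set Implicit Arguments.
Unset Strict Implicit.
Unset Printing Implicit Defensive.

Import Order.TTheory GRing.Theory Num.Theory.
Import numFieldNormedType.Exports.

Local Open Scope classical_set_scope.
Local Open Scope ring_scope.

(** * Interchange of limits in double series *)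

Lemma norm_lim_le (R : realType) (u : nat -> R) (l c : R) :
  (\forall n \near \oo, `|u n| <= c) -> u @ \oo --> l -> `|l| <= c.
Proof.
move=> uc ul; have ul' : (fun n => `|u n|) @ \oo --> `|l| by exact: cvg_norm.
rewrite -(cvg_lim _ ul')//; apply: limr_le => //.
by apply/cvg_ex; exists `|l|.
Qed.

(** The tail over [n] of the double series is at most [q ^+ M / (1 - q)] times the
sum of [b], uniformly in the number of terms taken over [k]; letting [k] run to
infinity first and [M] second exchanges the two sums. *)
Lemma geometric_double_series (R : realType) (t : nat -> nat -> R)
    (b f : nat -> R) (q : R) :
  0 <= q -> q < 1 -> (forall k n, `|t k n| <= q ^+ n * b k) ->
  cvgn (series b) -> (forall k, series (t k) @ \oo --> f k) ->
  (forall n, cvgn (series (fun k => t k n))) /\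
  cvgn (series f) /\
  series (fun n => limn (series (fun k => t k n))) @ \oo --> limn (series f).
Proof.
move=> q0 q1 tb cb tf.
have b0 k : 0 <= b k.
  by apply: (le_trans (normr_ge0 (t k 0%N))); have := tb k 0%N; rewrite expr0 mul1r.
have bB K : series b K <= limn (series b).
  apply: nondecreasing_cvgn_le => //.
  by apply: nondecreasing_series => k _ _; exact: b0.
have ct n : cvgn (series (fun k => t k n)).
  apply: normed_cvg; apply: (@series_le_cvg R _ (q ^+ n *: b)) => [k|k|k|] /=.
  - exact: normr_ge0.
  - by apply: mulr_ge0; rewrite ?exprn_ge0.
  - exact: tb.
  - exact: is_cvg_seriesZ.
have tail k M : `|f k - series (t k) M| <= q ^+ M / (1 - q) * b k.
  have : (fun N => series (t k) N - series (t k) M) @ \oo -->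
      f k - series (t k) M by apply: cvgB => //; exact: cvg_cst.
  apply: norm_lim_le; exists M => // N /= MN.
  rewrite sub_series_geq//.
  apply: (le_trans (ler_norm_sum _ _ _)).
  apply: (@le_trans _ _ (\sum_(M <= n < N) q ^+ n * b k)).
    by apply: ler_sum => n _; exact: tb.
  rewrite -mulr_suml ler_wpM2r//.
  rewrite -{1}[M]add0n big_addn.
  under eq_bigr do rewrite exprD mulrC.
  rewrite -mulr_sumr ler_wpM2l ?exprn_ge0//.
  have := @geometric_seriesE R 1 q; rewrite lt_eqF// => /(_ isT).
  move=> /(congr1 (@^~ (N - M)%N)).
  rewrite /series/= (eq_bigr (fun i => q ^+ i)); last by move=> i _; rewrite /= mul1r.
  move=> ->; rewrite mul1r -[leRHS]mul1r ler_wpM2r ?invr_ge0 ?subr_ge0 ?(ltW q1)//.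
  by rewrite gerBl exprn_ge0.
have f1 k : `|f k| <= 1 / (1 - q) * b k.
  by have := tail k 0%N; rewrite /series/= big_geq// subr0 expr0.
have cf : cvgn (series f).
  apply: normed_cvg.
  apply: (@series_le_cvg R _ ((1 / (1 - q)) *: b)) => [k|k|k|] /=.
  - exact: normr_ge0.
  - by apply: mulr_ge0; rewrite ?divr_ge0 ?subr_ge0 ?(ltW q1).
  - exact: f1.
  - exact: is_cvg_seriesZ.
split=> //; split=> //.
set T := fun n => limn (series (fun k => t k n)).
have main M : `|limn (series f) - series T M| <= q ^+ M / (1 - q) * limn (series b).
  have H : (fun K => series f K - \sum_(0 <= n < M) series (fun k => t k n) K) @ \oo
      --> limn (series f) - series T M.
    apply: cvgB => //; rewrite /series/=.
    by apply: cvg_big => [|n _]; [exact: add_continuous|exact: ct].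
  apply: norm_lim_le H; near=> K.
  rewrite /series/= exchange_big/= -sumrB.
  apply: (le_trans (ler_norm_sum _ _ _)).
  apply: (@le_trans _ _ (\sum_(0 <= k < K) q ^+ M / (1 - q) * b k)).
    by apply: ler_sum => n _; exact: tail.
  rewrite -mulr_sumr ler_wpM2l//; last exact: bB.
  by rewrite divr_ge0 ?exprn_ge0 ?subr_ge0 ?(ltW q1).
rewrite -(subr0 (limn (series f))).
have -> : series T = (fun M => limn (series f) - (limn (series f) - series T M)).
  by apply/funext => M; rewrite subKr.
apply: cvgB; first exact: cvg_cst.
apply: norm_cvg0.
apply: (@squeeze_cvgr _ _ _ _ (fun=> 0) (fun M => q ^+ M * ((1 - q)^-1 * limn (series b)))).
- by near=> M; rewrite normr_ge0/= mulrA main.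
- exact: cvg_cst.
- rewrite -(mul0r ((1 - q)^-1 * limn (series b))); apply: cvgMl.
  by apply: cvg_expr; rewrite ger0_norm.
Unshelve. all: by end_near. Qed.

Lemma geometric_small (R : realType) (q c e : R) : 0 <= q -> q < 1 -> 0 < e ->
  exists N, forall n, (N <= n)%N -> c * q ^+ n < e.
Proof.
move=> q0 q1 e0; have c1 : 0 < `|c| + 1 by rewrite ltr_wpDl.
have qn : `|q| < 1 by rewrite ger0_norm.
have /cvgrPdist_lt/(_ _ (divr_gt0 e0 c1))[N _ HN] := cvg_expr qn.
exists N => n /HN /=; rewrite sub0r normrN ger0_norm ?exprn_ge0// ltr_pdivlMr// => h.
apply: le_lt_trans h; rewrite mulrC ler_wpM2l ?exprn_ge0//.
by apply: (le_trans (ler_norm c)); rewrite lerDl.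
Qed.

(** * The Stieltjes constants as series *)

(** Difference between a term of the sum of [ln ^ n / id] and its integral over the
unit interval to the right, with [k] counted from 0. The sum over [k] is the
[n]-th Stieltjes constant. *)
Definition stieltjes_term (R : realType) (k n : nat) : R :=
  ln k.+1%:R ^+ n / k.+1%:R
  - (ln k.+2%:R ^+ n.+1 - ln k.+1%:R ^+ n.+1) / n.+1%:R.

Section stieltjes_term.
Variable R : realType.
Implicit Types (k n : nat) (x y a b : R).

Lemma exp_coeff_le_expR y n : 0 <= y -> y ^+ n / n`!%:R <= expR y.
Proof.
move=> y0; case: n => [|n].
  by rewrite expr0 fact0 divr1 -expR0 ler_expR.
by apply: le_trans (expR_ge1Dxn n y0); rewrite lerDr.
Qed.

Lemma ln_succ_diff k :
  (k.+2%:R : R)^-1 <= ln (k.+2%:R : R) - ln (k.+1%:R : R) <= (k.+1%:R : R)^-1.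
Proof.
have k1 : 0 < k.+1%:R :> R by rewrite ltr0n.
have k2 : 0 < k.+2%:R :> R by rewrite ltr0n.
rewrite -ln_div ?posrE//; apply/andP; split.
  have -> : k.+2%:R / k.+1%:R = (k.+1%:R / k.+2%:R)^-1 :> R by rewrite invf_div.
  rewrite lnV ?posrE ?divr_gt0// lerNr.
  have -> : k.+1%:R / k.+2%:R = 1 + - k.+2%:R^-1 :> R.
    by rewrite -[in k.+1%:R](addrK 1 k.+1%:R) natr1 mulrBl divff ?gt_eqF// mul1r.
  by rewrite le_ln1Dx// ltrN2 invf_lt1// ltr1n.
have -> : k.+2%:R / k.+1%:R = 1 + k.+1%:R^-1 :> R.
  by rewrite -[k.+2%:R]natr1 mulrDl divff ?gt_eqF// mul1r.
by rewrite le_ln1Dx// (lt_trans (ltrN10 _)) ?invr_gt0.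
Qed.

(** The mean value theorem for a power, proved by factoring the difference. *)
Lemma subrXX_bounds a b n : 0 <= a -> a <= b ->
  (b - a) * a ^+ n <= (b ^+ n.+1 - a ^+ n.+1) / n.+1%:R <= (b - a) * b ^+ n.
Proof.
move=> a0 ab; have b0 := le_trans a0 ab.
rewrite ler_pdivlMr ?ltr0n// ler_pdivrMr ?ltr0n// subrXX -!mulrA.
have H (u : R) : u ^+ n * n.+1%:R = \sum_(i < n.+1) u ^+ (n - i) * u ^+ i.
  under eq_bigr do rewrite -exprD subnK ?leq_ord//.
  by rewrite sumr_const card_ord mulr_natr.
rewrite !ler_wpM2l ?subr_ge0// !H; apply: ler_sum => i _.
  by rewrite ler_wpM2l ?exprn_ge0// lerXn2r ?nnegrE.
by rewrite ler_wpM2r ?exprn_ge0// lerXn2r ?nnegrE.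
Qed.

(** Both the sum and the integral in the term lie between the products of [1 / k] or
of the logarithm of the quotient with powers of the two logarithms, so that the
term is of second order in [1 / k]. *)
Lemma stieltjes_term_le k n :
  `|stieltjes_term R k n| <=
  (ln k.+2%:R ^+ n + n%:R * ln k.+2%:R ^+ n.-1) / k.+1%:R ^+ 2.
Proof.
rewrite /stieltjes_term.
set a := ln k.+1%:R; set b := ln k.+2%:R.
have /andP[d1 d2] := ln_succ_diff k; rewrite -/a -/b in d1 d2.
have a0 : 0 <= a by rewrite ln_ge0// ler1n.
have ab : a <= b by rewrite -subr_ge0 (le_trans _ d1)// invr_ge0.
have b0 := le_trans a0 ab.
have /andP[e1 e2] := subrXX_bounds n a0 ab.
have k0 : 0 < k.+1%:R :> R by rewrite ltr0n.
set p := k.+1%:R in d2 k0 *.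
have d1' : (p + 1)^-1 <= b - a by rewrite /p natr1.
have pp : p^-1 - (p + 1)^-1 <= (p ^+ 2)^-1.
  rewrite -subr_ge0.
  have -> : (p ^+ 2)^-1 - (p^-1 - (p + 1)^-1) = (p ^+ 2)^-1 / (p + 1).
    by field; rewrite !gt_eqF// addr_gt0.
  by rewrite divr_ge0 ?invr_ge0 ?exprn_ge0 ?addr_ge0// ltW.
have abn : a ^+ n <= b ^+ n by rewrite lerXn2r ?nnegrE.
have bna : b ^+ n - a ^+ n <= (b - a) * (n%:R * b ^+ n.-1).
  case: (n) => [|m]; first by rewrite !expr0 subrr mul0r mulr0.
  have /andP[_] := subrXX_bounds m a0 ab.
  by rewrite ler_pdivrMr ?ltr0n// -mulrA [b ^+ m * _]mulrC.
have bn0 : 0 <= b ^+ n by rewrite exprn_ge0.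
have an0 : 0 <= a ^+ n by rewrite exprn_ge0.
have nb0 : 0 <= n%:R * b ^+ n.-1 by rewrite mulr_ge0 ?exprn_ge0.
move: (_ / n.+1%:R) e1 e2 => X e1 e2.
have dd0 : 0 <= b - a by rewrite subr_ge0.
have dd : (b - a) * (b - a) <= (p ^+ 2)^-1.
  by rewrite expr2 invfM; apply: ler_pM.
rewrite mulrDl ler_norml; apply/andP; split.
  have h1 : X <= (b - a) * a ^+ n + (b - a) * (b - a) * (n%:R * b ^+ n.-1).
    apply: (le_trans e2); rewrite -mulrA -mulrDr ler_wpM2l//.
    by rewrite -lerBlDl.
  have h2 : (b - a) * a ^+ n <= a ^+ n / p by rewrite mulrC ler_wpM2l.
  have h3 : (b - a) * (b - a) * (n%:R * b ^+ n.-1) <= n%:R * b ^+ n.-1 / p ^+ 2.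
    by rewrite mulrC ler_wpM2l.
  have h4 : 0 <= b ^+ n / p ^+ 2 by rewrite divr_ge0// exprn_ge0// ltW.
  move: h1 h2 h3 h4; move: (_ / p) (_ / p ^+ 2) (_ / p ^+ 2) ((b - a) * a ^+ n) (_ * (_ * _)) => *.
  lra.
have h1 : a ^+ n / p - (b - a) * a ^+ n <= b ^+ n / p ^+ 2.
  rewrite mulrC -mulrBl mulrC.
  apply: ler_pM => //.
    by rewrite subr_ge0.
  by apply: le_trans pp; rewrite lerD2l lerN2.
have h4 : 0 <= n%:R * b ^+ n.-1 / p ^+ 2 by rewrite divr_ge0// exprn_ge0// ltW.
by rewrite (le_trans _ (_ : b ^+ n / p ^+ 2 <= _)) ?lerDl// (le_trans _ h1)// lerD2l lerN2.
Qed.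

Definition stieltjes_majorant k : R :=
  2 * (Num.sqrt k.+2%:R / k.+1%:R ^+ 2).

(** Since [y ^+ n / n!] is at most [expR y], the choice of [y] as four times [x] times
the logarithm gains a factor [4 ^- n]; the price is a power [4 * x <= 1 / 2] of
[k], which the decay of order two in [k] can afford. *)
Lemma stieltjes_term_geometric x k n : 0 <= x -> x <= 1 / 8 ->
  `|(-1) ^+ n * stieltjes_term R k n / n`!%:R * x ^+ n|
  <= (1 / 4) ^+ n * stieltjes_majorant k.
Proof.
move=> x0 x8.
have k1 : 1 <= k.+2%:R :> R by rewrite ler1n.
have b0 : 0 <= ln k.+2%:R :> R by rewrite ln_ge0.
set b := ln k.+2%:R in b0 *.
have hb : b ^+ n * x ^+ n / n`!%:R <= (1 / 4) ^+ n * expR (b / 2).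
  have -> : b ^+ n * x ^+ n = (1 / 4) ^+ n * (4 * x * b) ^+ n.
    by rewrite -!exprMn; congr (_ ^+ n); field.
  rewrite -[leLHS]mulrA ler_wpM2l ?exprn_ge0//.
  have xb : 0 <= 4 * x * b by rewrite !mulr_ge0.
  apply: le_trans (exp_coeff_le_expR n xb) _.
  by rewrite ler_expR mulrC ler_wpM2l//; lra.
have hb' : n%:R * b ^+ n.-1 * x ^+ n / n`!%:R <= (1 / 4) ^+ n * expR (b / 2).
  case: (n) => [|m]; first by rewrite !mul0r mulr_ge0 ?expR_ge0.
  have m0 : m`!%:R != 0 :> R by rewrite pnatr_eq0 -lt0n fact_gt0.
  have m1 : m.+1%:R != 0 :> R by rewrite pnatr_eq0.
  have -> : m.+1%:R * b ^+ m.+1.-1 * x ^+ m.+1 / m.+1`!%:R =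
      (1 / 4) ^+ m * x * ((4 * x * b) ^+ m / m`!%:R).
    rewrite factS natrM /=.
    have -> : x ^+ m.+1 = x * x ^+ m by rewrite exprS.
    rewrite [in RHS]mulrA.
    have -> : (1 / 4) ^+ m * x * (4 * x * b) ^+ m = x * (b ^+ m * x ^+ m).
      by rewrite mulrAC -exprMn -exprMn mulrC; congr (_ * _ ^+ _); field.
    by field; rewrite m0 addrC natr1 m1.
  have xb : 0 <= 4 * x * b by rewrite !mulr_ge0.
  have h := exp_coeff_le_expR m xb.
  have h2 : expR (4 * x * b) <= expR (b / 2).
    by rewrite ler_expR mulrC ler_wpM2l//; lra.
  apply: (@le_trans _ _ ((1 / 4) ^+ m * x * expR (b / 2))).
    by rewrite ler_wpM2l ?mulr_ge0 ?exprn_ge0// (le_trans h).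
  rewrite exprS ler_wpM2r ?expR_ge0// mulrC ler_wpM2r ?exprn_ge0//; lra.
have sq : expR (b / 2) = Num.sqrt k.+2%:R.
  rewrite -powR12_sqrt; last by rewrite ler0n.
  by rewrite /powR ifF ?pnatr_eq0// mulrC.
rewrite sq in hb hb'.
have -> : `|(-1) ^+ n * stieltjes_term R k n / n`!%:R * x ^+ n| =
    `|stieltjes_term R k n| / n`!%:R * x ^+ n.
  rewrite !normrM normrX normrN1 expr1n mul1r normfV normr_nat.
  by rewrite (ger0_norm (exprn_ge0 _ x0)).
apply: (@le_trans _ _ ((b ^+ n + n%:R * b ^+ n.-1) / k.+1%:R ^+ 2 / n`!%:R * x ^+ n)).
  rewrite ler_wpM2r ?exprn_ge0// ler_wpM2r ?invr_ge0 ?ler0n//.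
  exact: stieltjes_term_le.
rewrite /stieltjes_majorant.
have k2 : 0 <= (k.+1%:R ^+ 2)^-1 :> R by rewrite invr_ge0 exprn_ge0.
set s := (k.+1%:R ^+ 2)^-1 in k2 *.
have -> : (b ^+ n + n%:R * b ^+ n.-1) * s / n`!%:R * x ^+ n =
  (b ^+ n * x ^+ n / n`!%:R + n%:R * b ^+ n.-1 * x ^+ n / n`!%:R) * s by ring.
have -> : (1 / 4) ^+ n * (2 * (Num.sqrt k.+2%:R * s)) =
  ((1 / 4) ^+ n * Num.sqrt k.+2%:R + (1 / 4) ^+ n * Num.sqrt k.+2%:R) * s by ring.
by rewrite ler_wpM2r// lerD.
Qed.

(** The majorant is of order [k] to the power [- 3 / 2], and is compared with the
telescoping differences of the inverse square roots. *)
Lemma cvg_stieltjes_majorant : cvgn (series stieltjes_majorant).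
Proof.
pose s k : R := Num.sqrt k.+1%:R.
have s0 k : 0 < s k by rewrite sqrtr_gt0 ltr0n.
have s2 k : s k ^+ 2 = k.+1%:R by rewrite sqr_sqrtr.
have term k : stieltjes_majorant k <= 16 * ((s k)^-1 - (s k.+1)^-1).
  rewrite /stieltjes_majorant -/(s k.+1) -(s2 k).
  have a1 : 1 <= s k by rewrite -sqrtr1 ler_sqrt ?ler1n// ltr0n.
  have ca : s k.+1 ^+ 2 = s k ^+ 2 + 1 by rewrite !s2 natr1.
  have ac : s k < s k.+1 by rewrite ltr_sqrt ?ltr0n// ltr_nat.
  have c0 := s0 k.+1.
  set a := s k in a1 ca ac *; set c := s k.+1 in ca ac c0 *.
  have a0 : 0 < a by lra.
  have c2a : c <= 2 * a by nra.
  rewrite -subr_ge0.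
  have -> : 16 * (a^-1 - c^-1) - 2 * (c / (a ^+ 2) ^+ 2) =
    2 * (8 * a ^+ 3 * (c - a) - c ^+ 2) / (a ^+ 4 * c).
    by field; rewrite !gt_eqF.
  rewrite divr_ge0 ?mulr_ge0 ?exprn_ge0 ?(ltW a0) ?(ltW c0)//.
  have cma : (c - a) * (c + a) = 1 by nra.
  have cm : 1 <= (c - a) * (3 * a) by rewrite -cma ler_wpM2l; nra.
  have a2 : 1 <= a ^+ 2 by nra.
  have h3 : 3 * c ^+ 2 <= 8 * a ^+ 2 by nra.
  have h4 : 3 * (a ^+ 3 * (c - a)) >= a ^+ 2.
    have -> : 3 * (a ^+ 3 * (c - a)) = a ^+ 2 * ((c - a) * (3 * a)) by ring.
    by rewrite ler_peMr// sqr_ge0.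
  nra.
apply: nondecreasing_is_cvgn.
  by apply: nondecreasing_series => k _ _; rewrite mulr_ge0// divr_ge0 ?sqrtr_ge0 ?exprn_ge0.
exists 16 => _ [K _ <-]; rewrite /series/=.
apply: (@le_trans _ _ (\sum_(0 <= k < K) 16 * ((s k)^-1 - (s k.+1)^-1))).
  by apply: ler_sum => k _; exact: term.
rewrite -mulr_sumr -[leRHS]mulr1 ler_wpM2l//.
rewrite (eq_bigr (fun k => - (s k.+1)^-1 - - (s k)^-1)); last by move=> k _; ring.
rewrite telescope_sumr// opprK addrC /s sqrtr1 invr1 gerBl invr_ge0.
exact: ltW.
Qed.

End stieltjes_term.

(** * The Laurent expansion of the zeta function at 1 *)

Section laurent.
Variable R : realType.
Implicit Types (k n : nat) (x y : R).

(** For fixed [k] the generating function of the terms is a combination of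
exponential series; it equals [k ^ (- 1 - x)] minus its integral. *)
Lemma series_stieltjes_term x k : 0 < x ->
  series (fun n => (-1) ^+ n * stieltjes_term R k n / n`!%:R * x ^+ n) @ \oo -->
  expR (- x * ln k.+1%:R) / k.+1%:R
  + (expR (- x * ln k.+2%:R) - expR (- x * ln k.+1%:R)) / x.
Proof.
move=> x0.
set a := ln k.+1%:R; set b := ln k.+2%:R.
have xn0 : x != 0 by rewrite gt_eqF.
have -> : series (fun n => (-1) ^+ n * stieltjes_term R k n / n`!%:R * x ^+ n) =
   (fun N => series (exp_coeff (- x * a)) N / k.+1%:R +
    (series (exp_coeff (- x * b)) N.+1 - series (exp_coeff (- x * a)) N.+1) / x).
  apply/funext => N; elim: N => [|N IH].
    by rewrite !seriesSr /series/= !big_geq// /exp_coeff/= !expr0 subrr !mul0r addr0.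
  rewrite seriesSr IH (seriesSr (exp_coeff (- x * b)) N.+1).
  rewrite (seriesSr (exp_coeff (- x * a)) N.+1) (seriesSr (exp_coeff (- x * a)) N).
  rewrite /stieltjes_term -/a -/b /exp_coeff/=.
  have n0 : N`!%:R != 0 :> R by rewrite pnatr_eq0 -lt0n fact_gt0.
  have k0 : k.+1%:R != 0 :> R by rewrite pnatr_eq0.
  have m0 : N.+1%:R != 0 :> R by rewrite pnatr_eq0.
  rewrite factS natrM !exprMn !exprS -[- x]mulN1r !exprMn.
  move: (series _ _) (series _ _) => s1 s2.
  move: N.+1%:R k.+1%:R N`!%:R n0 k0 m0 => u v f n0 k0 m0.
  by field; rewrite xn0 n0 k0 m0.
have E y : series (exp_coeff y) @ \oo --> expR y by exact: is_cvg_series_exp_coeff.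
have ES y : series (exp_coeff y) n.+1 @[n --> \oo] --> expR y.
  by rewrite cvg_shiftS.
apply: cvgD; first by apply: cvgMl.
by apply: cvgMl; apply: cvgB.
Qed.

Lemma cvg_powR_opp x : 0 < x -> (fun n => n.+1%:R `^ (- x)) @ \oo --> (0 : R).
Proof.
move=> x0; apply/cvgrPdist_lt => e e0.
have c0 : 0 < e `^ (x^-1) by rewrite powR_gt0.
have hn : \forall n \near \oo, `|0 - harmonic n| < e `^ (x^-1).
  by have := @cvg_harmonic R => /cvgrPdist_lt /(_ _ c0).
near=> n.
rewrite sub0r normrN ger0_norm ?powR_ge0//.
have -> : n.+1%:R `^ (- x) = harmonic n `^ x.
  by rewrite /harmonic/= -powR_inv1 ?ler0n// -powRrM mulN1r.
have -> : e = (e `^ (x^-1)) `^ x.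
  by rewrite -powRrM mulVf ?gt_eqF// powRr1// ltW.
rewrite gt0_ltr_powR// ?nnegrE ?harmonic_ge0 ?powR_ge0//.
have : `|0 - harmonic n| < e `^ (x^-1) by near: n.
by rewrite sub0r normrN ger0_norm// harmonic_ge0.
Unshelve. all: by end_near. Qed.

Lemma powR_opp1D x k :
  k.+1%:R `^ (- (1 + x)) = expR (- x * ln k.+1%:R) / k.+1%:R.
Proof.
have k0 : 0 < k.+1%:R :> R by rewrite ltr0n.
rewrite opprD powRD; last by apply/implyP => _; rewrite gt_eqF.
by rewrite powR_inv1 ?ltW// mulrC /powR ifF ?gt_eqF.
Qed.

(** The integrals subtracted from the terms [k ^ (- 1 - x)] telescope to [1 / x], so
the sum over [k] of the generating functions is [zeta (1 + x) - 1 / x]; the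
double series lemma turns it into a power series in [x]. *)
Lemma cvg_zeta_laurent x : 0 < x -> x <= 1 / 8 ->
  cvgn (series (fun n => n.+1%:R `^ (- (1 + x)))) /\
  series (fun n => (-1) ^+ n * limn (series (fun k => stieltjes_term R k n))
     / n`!%:R * x ^+ n) @ \oo --> zeta (1 + x) - x^-1.
Proof.
move=> x0 x8; have x0' := ltW x0; have xn0 : x != 0 by rewrite gt_eqF.
have q0 : 0 <= 1 / 4 :> R by lra.
have q1 : 1 / 4 < 1 :> R by lra.
have [ct [cf cl]] := geometric_double_series q0 q1
  (fun k n => stieltjes_term_geometric k n x0' x8)
  (@cvg_stieltjes_majorant R) (fun k => @series_stieltjes_term x k x0).
set f := (fun k => _ + _) in cf cl.
have sf K : series f K =
    series (fun n => n.+1%:R `^ (- (1 + x))) K - (1 - K.+1%:R `^ (- x)) / x.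
  elim: K => [|K IH].
    by rewrite /series/= !big_geq// powR1 subrr mul0r subr0.
  rewrite !seriesSr IH /f powR_opp1D.
  have pE k : k.+1%:R `^ (- x) = expR (- x * ln k.+1%:R).
    by rewrite /powR pnatr_eq0.
  rewrite !pE; field. by rewrite xn0 addrC natr1 pnatr_eq0.
have cK : (fun K => (1 - K.+1%:R `^ (- x)) / x) @ \oo --> x^-1.
  rewrite -[X in _ --> X](_ : (1 - 0) / x = _); last by rewrite subr0 mul1r.
  by apply: cvgMl; apply: cvgB; [exact: cvg_cst|exact: cvg_powR_opp].
have cz : series (fun n => n.+1%:R `^ (- (1 + x))) @ \oo --> limn (series f) + x^-1.
  rewrite (_ : series _ = fun K => series f K + (1 - K.+1%:R `^ (- x)) / x).
    by apply: cvgD.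
  by apply/funext => K; rewrite sf subrK.
split; first by apply/cvg_ex; exists (limn (series f) + x^-1).
have -> : zeta (1 + x) - x^-1 = limn (series f).
  by rewrite /zeta (cvg_lim _ cz)// addrK.
rewrite (_ : (fun n => _) = (fun n => limn (series (fun k =>
   (-1) ^+ n * stieltjes_term R k n / n`!%:R * x ^+ n))))//.
apply/funext => n; apply/esym/cvg_lim => //.
have cst : cvgn (series (fun k => stieltjes_term R k n)).
  have -> : (fun k => stieltjes_term R k n) =
      ((-1) ^+ n / x ^+ n * n`!%:R) *: (fun k => (-1) ^+ n * stieltjes_term R k n / n`!%:R * x ^+ n).
    apply/funext => k /=.
    have n0 : n`!%:R != 0 :> R by rewrite pnatr_eq0 -lt0n fact_gt0.
    have s1 : (-1) ^+ n * (-1) ^+ n = 1 :> R by rewrite -expr2 sqrr_sign.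
    rewrite -[RHS]/((-1) ^+ n / x ^+ n * n`!%:R * ((-1) ^+ n * stieltjes_term R k n / n`!%:R * x ^+ n)).
    transitivity (((-1) ^+ n * (-1) ^+ n) * stieltjes_term R k n); first by rewrite s1 mul1r.
    have : x ^+ n != 0 by rewrite expf_neq0.
    move: n0; move: ((-1) ^+ n) (x ^+ n) (n`!%:R) => u v f' f0 v0.
    by field; rewrite f0 v0.
  exact: is_cvg_seriesZ.
rewrite (_ : series _ = fun K => (-1) ^+ n * series (fun k => stieltjes_term R k n) K / n`!%:R * x ^+ n).
  by apply: cvgMl; apply: cvgMl; apply: cvgMr.
by apply/funext => K; rewrite /series/= mulr_sumr mulr_suml mulr_suml.
Qed.

Lemma zeta_laurent_stieltjes : zeta_laurent (@stieltjes R).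
Proof.
apply: (@getPex _ (@zeta_laurent R)); exists (fun n => limn (series (fun k => stieltjes_term R k n))).
near=> x.
have x0 : 0 < x by near: x; exact: nbhs_right_gt.
have x8 : x <= 1 / 8 by near: x; apply: nbhs_right_le; lra.
exact: (cvg_zeta_laurent x0 x8).2.
Unshelve. all: by end_near. Qed.

(** Convergence at one positive point bounds the coefficients geometrically, which is
enough on half of the interval. Only convergence is assumed, so that the lemma
applies to the coefficients chosen by [get]. *)
Lemma pseries_remainder (a : nat -> R) (F : R -> R) N :
  (\forall x \near 0^'+, series (fun n => a n * x ^+ n) @ \oo --> F x) ->
  exists C, 0 <= C /\ \forall x \near 0^'+,
    `|F x - \sum_(n < N) a n * x ^+ n| <= C * x ^+ N.
Proof.
move=> [r /= r0 H].
have [y y0 yr] : exists2 y, 0 < y & y < r by exists (r / 2); [rewrite divr_gt0|lra].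
have cy : series (fun n => a n * y ^+ n) @ \oo --> F y.
  by apply: H => //=; rewrite sub0r normrN gtr0_norm.
have [M M0 My] : exists2 M, 0 <= M & forall n, `|a n * y ^+ n| <= M.
  have /cvg_series_cvg_0 c0 : cvgn (series (fun n => a n * y ^+ n)).
    by apply/cvg_ex; exists (F y).
  have /cvg_has_ub[M HM] : cvgn (fun n => a n * y ^+ n) by apply/cvg_ex; exists 0.
  exists M => [|n]; last by apply: HM; exists n.
  by apply: le_trans (HM _ _); last by exists 0%N.
exists (2 * M / y ^+ N); split.
  by rewrite divr_ge0 ?mulr_ge0 ?exprn_ge0// ltW.
exists (y / 2); first by rewrite /= divr_gt0.
move=> x /=; rewrite sub0r normrN => xy x0.
rewrite gtr0_norm// in xy.
have cx : series (fun n => a n * x ^+ n) @ \oo --> F x.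
  by apply: H => //=; rewrite sub0r normrN gtr0_norm//; lra.
have : (fun K => series (fun n => a n * x ^+ n) K - \sum_(n < N) a n * x ^+ n) @ \oo
   --> F x - \sum_(n < N) a n * x ^+ n by apply: cvgB => //; exact: cvg_cst.
apply: norm_lim_le; exists N => // K /= NK.
rewrite -(big_mkord xpredT (fun n => a n * x ^+ n)).
rewrite -[X in _ - X]/(series (fun n => a n * x ^+ n) N) sub_series_geq//.
apply: (le_trans (ler_norm_sum _ _ _)).
have xy0 : 0 <= x / y by rewrite divr_ge0 ?ltW.
have xy1 : x / y <= 1 / 2 by rewrite ler_pdivrMr//; lra.
apply: (@le_trans _ _ (\sum_(N <= n < K) M * (x / y) ^+ n)).
  apply: ler_sum => n _.
  have -> : a n * x ^+ n = (a n * y ^+ n) * (x / y) ^+ n.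
    have yn0 : y ^+ n != 0 by rewrite expf_neq0// gt_eqF.
    rewrite expr_div_n; move: yn0; move: (x ^+ n) (y ^+ n) => u v v0.
    by field.
  rewrite normrM [X in _ * X]ger0_norm ?exprn_ge0//.
  by rewrite ler_wpM2r ?exprn_ge0.
rewrite -mulr_sumr -{1}[N]add0n big_addn.
under eq_bigr do rewrite exprD mulrC.
rewrite -mulr_sumr.
have -> : 2 * M / y ^+ N * x ^+ N = M * ((x / y) ^+ N * 2).
  by rewrite expr_div_n; ring.
rewrite !ler_wpM2l ?exprn_ge0//.
apply: (@le_trans _ _ (\sum_(0 <= i < K - N) 1 * (1 / 2) ^+ i)).
  by apply: ler_sum => i _; rewrite mul1r lerXn2r ?nnegrE//; lra.
have q1 : 1 / 2 != 1 :> R by rewrite lt_eqF//; lra.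
have := geometric_seriesE 1 q1 => /(congr1 (@^~ (K - N)%N)); rewrite /series/= => ->.
have h : 0 <= (1 / 2 : R) ^+ (K - N) by rewrite exprn_ge0//; lra.
have -> : 1 - 1 / 2 = 2^-1 :> R by field.
by rewrite invrK mul1r ler_piMl//; lra.
Qed.

Lemma zeta_expansion N : exists C, 0 <= C /\ \forall x \near 0^'+,
  `|zeta (1 + x) - x^-1 - \sum_(n < N) (-1) ^+ n * stieltjes R n / n`!%:R * x ^+ n|
  <= C * x ^+ N.
Proof. exact: (pseries_remainder N zeta_laurent_stieltjes). Qed.

(** Any two Laurent expansions share their constant term, the limit at the pole. For
the coefficients built above this term is a telescoping sum. *)
Lemma cvg_harmonic_sub_ln :
  (fun n => series (@harmonic R) n - ln n%:R) @ \oo --> stieltjes R 0.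
Proof.
pose g n := limn (series (fun k => stieltjes_term R k n)).
have gl : zeta_laurent g.
  near=> x.
  have x0 : 0 < x by near: x; exact: nbhs_right_gt.
  have x8 : x <= 1 / 8 by near: x; apply: nbhs_right_le; lra.
  exact: (cvg_zeta_laurent x0 x8).2.
have e0 : stieltjes R 0 = g 0%N.
  have [C [C0 HC]] := zeta_expansion 1.
  have [D [D0 HD]] := pseries_remainder 1 gl.
  apply/eqP; rewrite -subr_eq0 -normr_le0; apply/ler_addgt0Pr => e e0.
  have : \forall x \near (0 : R)^'+, `|stieltjes R 0 - g 0%N| <= (C + D) * x.
    near=> x.
    have : `|zeta (1 + x) - x^-1 - \sum_(n < 1) (-1) ^+ n * stieltjes R n / n`!%:R * x ^+ n|
      <= C * x ^+ 1 by near: x.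
    have : `|zeta (1 + x) - x^-1 - \sum_(n < 1) (-1) ^+ n * g n / n`!%:R * x ^+ n|
      <= D * x ^+ 1 by near: x.
    rewrite !big_ord1/= !expr0 fact0 !divr1 !mul1r !mulr1 expr1 => h1 h2.
    have -> : stieltjes R 0 - g 0%N = (zeta (1 + x) - x^-1 - g 0%N) - (zeta (1 + x) - x^-1 - stieltjes R 0) by ring.
    by rewrite (le_trans (ler_normB _ _))// mulrDl addrC lerD.
  move=> h; have : \forall x \near (0 : R)^'+, `|stieltjes R 0 - g 0%N| <= e.
    near=> x; apply: (@le_trans _ _ ((C + D) * x)); first by near: x.
    have cd : 0 < C + D + 1 by lra.
    apply: (@le_trans _ _ ((C + D + 1) * x)).
      have x0 : 0 <= x by near: x; exact: nbhs_right_ge.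
      by rewrite ler_wpM2r// lerDl.
    rewrite mulrC -ler_pdivlMr//; near: x; apply: nbhs_right_le.
    by rewrite divr_gt0//; lra.
  move=> /filter_ex[x]; rewrite add0r; exact.
rewrite e0 /g.
have c0 : cvgn (series (fun k => stieltjes_term R k 0)).
  have [ct _] := geometric_double_series (q := 1 / 4) (f := fun k => expR (- (1/8) * ln k.+1%:R) / k.+1%:R
  + (expR (- (1/8) * ln k.+2%:R) - expR (- (1/8) * ln k.+1%:R)) / (1/8)) ltac:(lra) ltac:(lra)
   (fun k n => @stieltjes_term_geometric R (1/8) k n ltac:(lra) ltac:(lra))
   (@cvg_stieltjes_majorant R) (fun k => @series_stieltjes_term (1/8) k ltac:(lra)).
  rewrite (_ : (fun k => _) = (fun k => (-1) ^+ 0 * stieltjes_term R k 0 / 0`!%:R * (1 / 8) ^+ 0)).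
    exact: ct.
  by apply/funext => k; rewrite !expr0 fact0 mul1r divr1 mulr1.
have E n : series (@harmonic R) n - ln n%:R =
    series (fun k => stieltjes_term R k 0) n + (ln n.+1%:R - ln n%:R).
  suff -> : series (fun k => stieltjes_term R k 0) n =
      series (@harmonic R) n - ln n.+1%:R by ring.
  elim: n => [|n IH]; first by rewrite /series/= !big_geq// ln1 subr0.
  by rewrite !seriesSr IH /stieltjes_term /harmonic/= !expr0 !expr1 mul1r divr1; ring.
rewrite (eq_cvg _ _ E).
rewrite -[limn _]addr0; apply: cvgD => //.
apply: (@squeeze_cvgr _ _ _ _ (fun=> 0) (fun n => n%:R^-1)).
- near=> n.
  have n0 : (0 < n)%N by near: n; exists 1%N.
  rewrite -(prednK n0); have /andP[h1 h2] := ln_succ_diff R n.-1.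
  by rewrite h2 andbT (le_trans _ h1)// invr_ge0.
- exact: cvg_cst.
- rewrite -cvg_shiftS; exact: cvg_harmonic.
Unshelve. all: by end_near. Qed.
End laurent.

(** * The branches of the inverse map and their compositions *)

Section words.
Variables (F : fieldType) (w : F).
Implicit Types (a : int) (u v : seq int) (x y : F).

(** The map [S T^a] of the group, that is, [z |-> - 1 / (z + w a)]. The field is kept
abstract because branches act both on the real limit set and on the orbits in
the upper half-plane. *)
Definition branch a x : F := - (w * a%:~R + x)^-1.

(** The first letter is the outermost map. *)
Definition branches v x : F := foldr branch x v.

Definition letters v := all (fun a : int => a != 0) v.

Lemma branches_rcons v a x : branches (rcons v a) x = branches v (branch a x).
Proof. by rewrite /branches foldr_rcons. Qed.

Lemma branches_cat u v x : branches (u ++ v) x = branches u (branches v x).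
Proof. by rewrite /branches foldr_cat. Qed.

Lemma branch_diff a x y : w * a%:~R + x != 0 -> w * a%:~R + y != 0 ->
  branch a x - branch a y = (x - y) / ((w * a%:~R + x) * (w * a%:~R + y)).
Proof. by move=> hx hy; rewrite /branch; field; rewrite hx hy. Qed.

Section absolute_value.
Variables (R : realType) (nu : F -> R).
Hypotheses (nu_ge0 : forall x, 0 <= nu x) (nu0 : nu 0 = 0).
Hypotheses (nuN : forall x, nu (- x) = nu x) (nuV : forall x, nu x^-1 = (nu x)^-1).
Hypothesis nuM : forall x y, nu (x * y) = nu x * nu y.
Hypothesis nuD : forall x y, nu (x + y) <= nu x + nu y.
Hypothesis nu_letter : forall a, a != 0 -> 4 <= nu (w * a%:~R).

Lemma denom_ge3 a x : a != 0 -> nu x <= 1 -> 3 <= nu (w * a%:~R + x).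
Proof.
move=> a0 x1; have := nu_letter a0; have := nuD (w * a%:~R + x) (- x).
rewrite addrK nuN; lra.
Qed.

Lemma denom_neq0 a x : a != 0 -> nu x <= 1 -> w * a%:~R + x != 0.
Proof.
move=> a0 x1; apply/negP => /eqP h; have := denom_ge3 a0 x1.
by rewrite h nu0; lra.
Qed.

Lemma norm_branch_le1 a x : a != 0 -> nu x <= 1 -> nu (branch a x) <= 1.
Proof.
move=> a0 x1; have h := denom_ge3 a0 x1.
by rewrite nuN nuV invf_le1; lra.
Qed.

Lemma norm_branches_le1 v x : letters v -> nu x <= 1 -> nu (branches v x) <= 1.
Proof.
by move=> + x1; elim: v => //= a v IH /andP[a0 /IH]; exact: norm_branch_le1.
Qed.

Lemma branches_contract v x y : letters v -> nu x <= 1 -> nu y <= 1 ->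
  nu (branches v x - branches v y) <= (1 / 2) ^+ size v * nu (x - y).
Proof.
move=> + x1 y1; elim: v => [_|a v IH] /=; first by rewrite expr0 mul1r.
move=> /andP[a0 va].
have bx := norm_branches_le1 va x1; have b_y := norm_branches_le1 va y1.
rewrite branch_diff ?denom_neq0// nuM nuV nuM.
have h1 := denom_ge3 a0 bx; have h2 := denom_ge3 a0 b_y.
have h3 : 2 <= nu (w * a%:~R + branches v x) * nu (w * a%:~R + branches v y) by nra.
rewrite exprS ler_pdivrMr ?(lt_le_trans _ h3)//.
apply: (le_trans (IH va)).
have h4 : 0 <= (1 / 2 : R) ^+ size v * nu (x - y).
  by rewrite mulr_ge0 ?exprn_ge0//; lra.
nra.
Qed.

End absolute_value.

End words.

Lemma norm_letter_ge1 (R : realType) (a : int) : a != 0 -> 1 <= `|a%:~R| :> R.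
Proof.
move=> a0; rewrite -intr_norm -[1]/(1%:~R) ler_int.
by move: a0; lia.
Qed.

Lemma norm_letter_ge4 (R : realType) (w : R) (a : int) :
  4 <= w -> a != 0 -> 4 <= `|w * a%:~R|.
Proof.
move=> w4 a0; have w0 : 0 <= w by apply: le_trans w4; lra.
rewrite normrM (ger0_norm w0); apply: (le_trans w4).
by rewrite ler_peMr// norm_letter_ge1.
Qed.

Section real_words.
Variables (R : realType) (w : R).
Hypothesis w4 : 4 <= w.
Implicit Types (a : int) (u v : seq int) (x y : R).

Let letter4 a := @norm_letter_ge4 R w a w4.

Definition real_denom_neq0 :=
  denom_neq0 (@normr0 R R) (@normrN R R) (@ler_normD R R) letter4.

Definition real_branch_le1 :=
  norm_branch_le1 (@normrN R R) (@normfV R) (@ler_normD R R) letter4.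

Definition real_branches_le1 :=
  norm_branches_le1 (@normrN R R) (@normfV R) (@ler_normD R R) letter4.

Definition real_branches_contract := branches_contract (@normr_ge0 R R)
  (@normr0 R R) (@normrN R R) (@normfV R) (@normrM R) (@ler_normD R R) letter4.

(** The inverse square root of the derivative of the composition, up to sign: the
product of the denominators met along the way. *)
Fixpoint denom v x : R :=
  if v is a :: u then (w * a%:~R + branches w u x) * denom u x else 1.

Lemma denom_rcons v a x :
  denom (rcons v a) x = denom v (branch w a x) * (w * a%:~R + x).
Proof.
elim: v => [|b v IH] /=; first by rewrite mulr1 mul1r.
by rewrite IH branches_rcons mulrA.
Qed.

(** A composition of branches is a Moebius map, hence its denominator is affine.
Appending the letter [a] replaces the pair [(c, d)] by [(d, d * w * a - c)], which
keeps [c] at most half of [d] and at least doubles [d]. The first fact bounds the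
distortion by a constant, the second one makes the images small. *)
Lemma denom_affine v : letters v -> exists c d : R,
  [/\ 2 ^+ size v <= `|d|, `|c| <= `|d| / 2 &
      forall x, `|x| <= 1 -> denom v x = c * x + d].
Proof.
elim/last_ind: v => [_|v a IH].
  exists 0, 1; rewrite normr1 normr0 expr0; split => //.
  by move=> x _; rewrite mul0r add0r.
rewrite /letters all_rcons => /andP[a0 /IH [c [d [d1 cd E]]]].
exists d, (d * (w * a%:~R) - c).
have wa := letter4 a0.
have d0 : 0 < `|d| by apply: lt_le_trans d1; rewrite exprn_gt0.
have dd : 2 * `|d| <= `|d * (w * a%:~R) - c|.
  have := lerB_dist (d * (w * a%:~R)) c; rewrite normrM => h.
  apply: le_trans h; nra.
split.
- by rewrite size_rcons exprS; apply: le_trans dd; rewrite ler_wpM2l.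
- by rewrite ler_pdivlMr// mulrC.
- move=> x x1; rewrite denom_rcons E ?real_branch_le1// /branch.
  by have wx := real_denom_neq0 a0 x1; field.
Qed.

(** The exact form of the mean value theorem for Moebius maps. It replaces the
usual bounded distortion arguments. *)
Lemma branches_diff v x y : letters v -> `|x| <= 1 -> `|y| <= 1 ->
  (branches w v x - branches w v y) * (denom v x * denom v y) = x - y.
Proof.
move=> + x1 y1; elim: v => [_|a v IH] /=; first by rewrite !mulr1.
move=> /andP[a0 va]; rewrite -[RHS]IH//.
have hx := real_denom_neq0 a0 (real_branches_le1 va x1).
have hy := real_denom_neq0 a0 (real_branches_le1 va y1).
by rewrite branch_diff//; field; rewrite hx hy.
Qed.

Lemma denom_bounds (c d x : R) : `|c| <= `|d| / 2 -> `|x| <= 1 ->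
  `|d| / 2 <= `|c * x + d| <= 2 * `|d|.
Proof.
move=> cd x1; have cx : `|c * x| <= `|d| / 2.
  by rewrite normrM; apply: le_trans cd; rewrite ler_piMr.
apply/andP; split; last first.
  apply: (le_trans (ler_normD _ _)).
  have := normr_ge0 d; lra.
rewrite addrC; apply: le_trans (lerB_normD _ _); lra.
Qed.

End real_words.

Section word_sums.
Variables (R : realType) (A : seq int).
Implicit Types (n : nat) (G H : seq int -> R).

(** The sum over all words of length [n], as an iterated sum over the letters: it
can be split at either end, which a sum over an enumeration would hide. *)
Fixpoint word_sum n G : R :=
  if n is m.+1 then \sum_(a <- A) word_sum m (fun u => G (a :: u)) else G [::].

Definition over (v : seq int) := all (mem A) v.

Lemma ler_word_sum n G H :
  (forall u, size u = n -> over u -> G u <= H u) -> word_sum n G <= word_sum n H.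
Proof.
elim: n G H => [|n IH] G H GH /=; first exact: GH.
rewrite !big_seq; apply: ler_sum => a aA; apply: IH => u un uA.
by apply: GH => /=; [rewrite un|rewrite aA].
Qed.

Lemma eq_word_sum n G H :
  (forall u, size u = n -> over u -> G u = H u) -> word_sum n G = word_sum n H.
Proof. by move=> GH; apply/eqP; rewrite eq_le !ler_word_sum// => u un /(GH _ un)->. Qed.

Lemma word_sumZ n (c : R) G : word_sum n (fun u => c * G u) = c * word_sum n G.
Proof.
by elim: n G => //= n IH G; rewrite mulr_sumr; apply: eq_bigr => a _; rewrite IH.
Qed.

Lemma word_sum0 n : word_sum n (fun=> 0) = 0.
Proof. by elim: n => //= n IH; rewrite big1. Qed.

Lemma word_sumD n G H :
  word_sum n (fun u => G u + H u) = word_sum n G + word_sum n H.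
Proof.
by elim: n G H => //= n IH G H; rewrite -big_split; apply: eq_bigr => a _; rewrite IH.
Qed.

Lemma word_sum_sum I (r : seq I) n (G : I -> seq int -> R) :
  word_sum n (fun u => \sum_(i <- r) G i u) = \sum_(i <- r) word_sum n (G i).
Proof.
elim: r => [|i r IH].
  by rewrite big_nil -[RHS](word_sum0 n); apply: eq_word_sum => u _ _; rewrite big_nil.
rewrite big_cons -IH -word_sumD; apply: eq_word_sum => u _ _; by rewrite big_cons.
Qed.

Lemma word_sum_rcons n G :
  word_sum n.+1 G = \sum_(a <- A) word_sum n (fun u => G (rcons u a)).
Proof.
elim: n G => [//|n IH] G; rewrite [LHS]/=.
rewrite (eq_bigr (fun a => \sum_(b <- A) word_sum n (fun u => G (a :: rcons u b)))).
  by rewrite exchange_big.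
by move=> a _; rewrite -(IH (fun u => G (a :: u))).
Qed.

(** Words with the prefix [v] are parametrized by what follows [v]. *)
Lemma word_sum_prefix v n G : uniq A -> (forall u, 0 <= G u) ->
  word_sum (size v + n) (fun u => (prefix v u)%:R * G u)
  <= word_sum n (fun u => G (v ++ u)).
Proof.
move=> uA; elim: v G => [|b v IH] G G0 /=.
  by rewrite add0n ler_word_sum// => u _ _; rewrite prefix0s mul1r.
have ge0 : 0 <= word_sum n (fun u => G (b :: v ++ u)).
  by rewrite -(word_sum0 n); apply: ler_word_sum.
have E a : word_sum (size v + n) (fun u => (prefix (b :: v) (a :: u))%:R * G (a :: u))
    = (b == a)%:R * word_sum (size v + n) (fun u => (prefix v u)%:R * G (a :: u)).
  by rewrite -word_sumZ; apply: eq_word_sum => u _ _; rewrite /= mulrA -natrM mulnb.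
rewrite (eq_bigr _ (fun a _ => E a)).
case: (boolP (b \in A)) => [bA|bA].
  rewrite (bigD1_seq b)//= eqxx mul1r big1 ?addr0.
    by apply: IH => u; exact: G0.
  by move=> a; rewrite eq_sym => /negPf->; rewrite mul0r.
rewrite big_seq big1 ?ge0// => a aA; rewrite (_ : b == a = false) ?mul0r//.
by apply/negP => /eqP ba; rewrite ba aA in bA.
Qed.

End word_sums.

(** Koenig's lemma. A word is kept if it has extensions of every length in the tree;
among finitely many letters at least one keeps this property. *)
Lemma konig (A : seq int) (T : seq int -> Prop) :
  (forall v a, T (rcons v a) -> T v) ->
  (forall n, exists u, [/\ size u = n, over A u & T u]) ->
  exists al : nat -> int, (forall n, al n \in A) /\ forall n, T (mkseq al n).
Proof.
move=> Tcl Tbig.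
have Tpre u v : T (v ++ u) -> T v.
  elim/last_ind: u => [|u a IH]; first by rewrite cats0.
  by rewrite -rcons_cat => /Tcl.
pose big v := forall n, exists u, [/\ size u = n, over A u & T (v ++ u)].
have step v : big v -> exists a, a \in A /\ big (rcons v a).
  move=> bv; apply: contrapT => /forallNP H.
  have {}H a : exists n, a \in A -> forall u, size u = n -> over A u -> ~ T (rcons v a ++ u).
    case: (boolP (a \in A)) => aA; last by exists 0%N.
    have /not_andP[//|/existsNP[n /forallNP Hn]] := H a.
    by exists n => _ u un uA Tu; apply: (Hn u).
  have [nn Hnn] := choice H.
  have [u [un uA Tu]] := bv (\max_(a <- A) nn a).+1.
  case: u un uA Tu => [//|a u] /= [un] /andP[aA uA] Tu.
  have le_na : (nn a <= size u)%N by rewrite un; exact: leq_bigmax_seq.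
  apply: (Hnn a aA (take (nn a) u)).
  - by rewrite size_takel.
  - by apply/allP => b /mem_take bu; exact: (allP uA).
  - apply: (Tpre (drop (nn a) u)).
    by rewrite -catA cat_take_drop cat_rcons.
have b0 : big [::] by move=> n; have [u Hu] := Tbig n; exists u.
have step' v : exists a, big v -> a \in A /\ big (rcons v a).
  by have [/step[a Ha]|nb] := pselect (big v); [exists a|exists 0].
have [f Hf] := choice step'.
pose w n := iter n (fun v => rcons v (f v)) [::].
have bw n : big (w n) by elim: n => //= n /Hf[].
have sw n : size (w n) = n by elim: n => //= n IH; rewrite size_rcons IH.
pose al n := f (w n).
have mkw n : mkseq al n = w n.
  by elim: n => //= n IH; rewrite mkseqS IH.
exists al; split=> n; first by have [] := Hf _ (bw n).
by rewrite mkw; have [u [/size0nil-> _]] := bw n 0%N; rewrite cats0.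
Qed.

Lemma le_powR2r (R : realType) (s x y : R) :
  0 <= s -> 0 <= x -> x <= y -> x `^ s <= y `^ s.
Proof.
move=> s0 x0 xy; have y0 := le_trans x0 xy.
by apply: (@ge0_ler_powR _ s) => //; rewrite nnegrE.
Qed.

(** * Infinite words and a conformal family of weights *)

Section infinite_words.
Variables (R : realType) (w : R) (A : seq int).
Hypotheses (w4 : 4 <= w) (A0 : letters A).
Implicit Types (al be : nat -> int) (u v : seq int) (x y : R).

Definition infinite_word al := forall n, al n \in A.

(** The point with the given infinite expansion. *)
Definition word_point al : R := limn (fun n => branches w (mkseq al n) 0).

Definition shift n al : nat -> int := fun k => al (n + k)%N.

Lemma over_letters v : over A v -> letters v.
Proof. by move=> /allP vA; apply/allP => a /vA /(allP A0). Qed.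

Lemma over_mkseq al n : infinite_word al -> over A (mkseq al n).
Proof. by move=> Aal; apply/allP => a /mapP[k _ ->]; exact: Aal. Qed.

Lemma infinite_word_shift al n : infinite_word al -> infinite_word (shift n al).
Proof. by move=> Aal k; exact: Aal. Qed.

Lemma cvg_word_point al : infinite_word al ->
  (fun n => branches w (mkseq al n) 0) @ \oo --> word_point al.
Proof.
move=> Aal; set f := (fun n => _).
suff : cvgn f by [].
suff : cvgn (series (telescope f)).
  move=> ct; have -> : f = cst (f 0%N) \+ series (telescope f).
    by apply/funext => n; rewrite [LHS](eq_sum_telescope f n).
  exact: (is_cvgD (is_cvg_cst _) ct).
apply: normed_cvg; apply: (@series_le_cvg R _ (geometric 1 (1 / 2))).
- by move=> n; exact: normr_ge0.
- by move=> n; rewrite geometric_ge0//; lra.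
- move=> n; rewrite -[leRHS]/(1 * (1 / 2) ^+ n) mul1r.
  rewrite -[leLHS]/(`|branches w (mkseq al n.+1) 0 - branches w (mkseq al n) 0|).
  rewrite mkseqS branches_rcons.
  have a0 := allP A0 _ (Aal n).
  have n0 : `|0 : R| <= 1 by rewrite normr0.
  have va := over_letters (over_mkseq n Aal).
  have := real_branches_contract w4 va (real_branch_le1 w4 a0 n0) n0.
  rewrite size_mkseq subr0 => h; apply: (le_trans h).
  by rewrite ler_piMr ?exprn_ge0 ?real_branch_le1//; lra.
- by apply: is_cvg_geometric_series; rewrite ger0_norm; lra.
Qed.

Lemma norm_word_point al : infinite_word al -> `|word_point al| <= 1.
Proof.
move=> Aal; apply: norm_lim_le (cvg_word_point Aal).
near=> n; apply: (real_branches_le1 w4); last by rewrite normr0.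
exact/over_letters/over_mkseq.
Unshelve. all: by end_near. Qed.

Lemma mkseq_shift al n : mkseq al n.+1 = al 0%N :: mkseq (shift 1 al) n.
Proof. by rewrite /mkseq /= -[1%N]addn0 iotaDl -map_comp. Qed.

Lemma word_point_shift1 al : infinite_word al ->
  word_point al = branch w (al 0%N) (word_point (shift 1 al)).
Proof.
move=> Aal; have As := infinite_word_shift 1 Aal.
have h := cvg_word_point Aal; rewrite -cvg_shiftS in h.
have h1 := cvg_word_point As.
have a0 := allP A0 _ (Aal 0%N).
apply: (cvg_unique _ h) => //.
rewrite (_ : (fun n => _) = fun n => branch w (al 0%N) (branches w (mkseq (shift 1 al) n) 0)).
  apply: cvgN; apply: cvgV; first exact/real_denom_neq0/norm_word_point.
  by apply: cvgD => //; exact: cvg_cst.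
by apply/funext => n; rewrite mkseq_shift.
Qed.

Lemma word_pointE al n : infinite_word al ->
  word_point al = branches w (mkseq al n) (word_point (shift n al)).
Proof.
elim: n al => [//|n IH] al Aal; rewrite word_point_shift1// mkseq_shift /=.
by rewrite [in LHS]IH//; exact: infinite_word_shift.
Qed.

End infinite_words.

Section weights.
Variables (R : realType) (w s : R) (A : seq int).
Hypotheses (w4 : 4 <= w) (s0 : 0 < s) (A0 : letters A) (uA : uniq A).
Implicit Types (al be : nat -> int) (u v : seq int) (x y : R).

Definition letter_sum x : R := \sum_(a <- A) `|w * a%:~R + x| `^ (- (2 * s)).

Hypothesis letter_sum_ge1 : forall x, `|x| <= 1 -> 1 <= letter_sum x.

(** Dividing by the sum over the letters makes the weights a probability at every
point. As the sum is at least 1, the division preserves upper bounds by powers of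
the derivatives. *)
Definition weight a x : R := `|w * a%:~R + x| `^ (- (2 * s)) / letter_sum x.

Fixpoint word_weight v x : R :=
  if v is a :: u then weight a (branches w u x) * word_weight u x else 1.

Lemma word_weight_rcons v a x :
  word_weight (rcons v a) x = word_weight v (branch w a x) * weight a x.
Proof.
elim: v => [|b v IH] /=; first by rewrite mulr1 mul1r.
by rewrite IH branches_rcons mulrA.
Qed.

Lemma word_weight_cat u v x :
  word_weight (u ++ v) x = word_weight u (branches w v x) * word_weight v x.
Proof.
elim: u => [|b u IH] /=; first by rewrite mul1r.
by rewrite IH branches_cat mulrA.
Qed.

Lemma weight_ge0 a x : 0 <= weight a x.
Proof. by rewrite divr_ge0 ?powR_ge0// sumr_ge0// => b _; exact: powR_ge0. Qed.

Lemma word_weight_ge0 v x : 0 <= word_weight v x.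
Proof. by elim: v x => //= a v IH x; rewrite mulr_ge0 ?weight_ge0. Qed.

(** The weights of the words of length [n] sum to 1, since those of the innermost
letter do when the outer ones have been summed. *)
Lemma word_sum_weight n x : `|x| <= 1 -> word_sum A n (word_weight ^~ x) = 1.
Proof.
elim: n x => [//|n IH] x x1; rewrite word_sum_rcons.
rewrite (eq_big_seq (fun a => weight a x)); last first.
  move=> a aA; have a0 := allP A0 _ aA.
  rewrite -[RHS]mulr1 -[X in _ * X](IH (branch w a x)) ?real_branch_le1//.
  by rewrite -word_sumZ; apply: eq_word_sum => u _ _; rewrite word_weight_rcons mulrC.
rewrite -mulr_suml divff// gt_eqF// (lt_le_trans _ (letter_sum_ge1 x1))//.
Qed.

Lemma word_weight_denom v x : over A v -> `|x| <= 1 ->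
  word_weight v x <= `|denom w v x| `^ (- (2 * s)).
Proof.
move=> + x1; elim: v => [_|a v IH] /=; first by rewrite normr1 powR1.
move=> /andP[aA vA]; have va := over_letters A0 vA.
rewrite normrM powRM//; apply: ler_pM => //.
- exact: weight_ge0.
- exact: word_weight_ge0.
- have h := letter_sum_ge1 (real_branches_le1 w4 va x1).
  rewrite /weight ler_pdivrMr ?(lt_le_trans _ h)//.
  by rewrite ler_peMr// powR_ge0.
- exact: IH.
Qed.

(** The total weight of the words which extend [v] is an average of the weight of
[v] over points of the unit interval. *)
Lemma word_weight_prefix v n b x : over A v -> (size v <= n)%N -> `|x| <= 1 -> 0 <= b ->
  (forall y, `|y| <= 1 -> word_weight v y <= b) ->
  word_sum A n (fun u => (prefix v u)%:R * word_weight u x) <= b.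
Proof.
move=> vA vn x1 b0 H; rewrite -(subnKC vn).
apply: (le_trans (word_sum_prefix _ _ uA (word_weight_ge0 ^~ x))).
rewrite -[leRHS]mulr1 -(word_sum_weight (n - size v) x1) -word_sumZ.
apply: ler_word_sum => u _ uu; rewrite word_weight_cat ler_wpM2r ?word_weight_ge0//.
by apply: H; apply: (real_branches_le1 w4) => //; exact: (over_letters A0).
Qed.

(** The mass distribution principle without a measure. By Koenig's lemma there is [n]
such that every word of length [n] already extends one of the first [n] words of
the family; summing the weights at this level gives 1 on the left and at most the
sum of the bounds on the right. *)
Lemma cover_weight (V : nat -> seq int) (b : nat -> R) :
  (forall k, over A (V k)) -> (forall k, 0 <= b k) ->
  (forall k y, `|y| <= 1 -> word_weight (V k) y <= b k) ->
  (forall al, infinite_word A al -> exists k, mkseq al (size (V k)) = V k) ->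
  exists N, 1 <= \sum_(k < N) b k.
Proof.
move=> VA b0 Vb cov.
pose T u := ~ exists2 k, (k < size u)%N & prefix (V k) u.
have [n Hn] : exists n, forall u, size u = n -> over A u -> ~ T u.
  apply: contrapT => /forallNP H.
  have [|n|al [Aal Tal]] := @konig A T.
  - move=> v a Tva [k kv pv]; apply: Tva; exists k.
      by rewrite size_rcons ltnS ltnW.
    by apply: (prefix_trans pv); rewrite prefix_rcons.
  - have /existsNP[u /not_implyP[un /not_implyP[uo /contrapT Tu]]] := H n.
    by exists u.
  have [k Hk] := cov al Aal.
  apply: (Tal (maxn k.+1 (size (V k)))); exists k.
    by rewrite size_mkseq leq_max ltnSn.
  rewrite prefixE; apply/eqP; rewrite -[RHS]Hk /mkseq -map_take take_iota.
  by rewrite (minn_idPl _) ?leq_maxr.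
exists n.
have x0 : `|0 : R| <= 1 by rewrite normr0.
rewrite -(word_sum_weight n x0).
apply: (@le_trans _ _ (word_sum A n (fun u => \sum_(k < n) (prefix (V k) u)%:R * word_weight u 0))).
  apply: ler_word_sum => u un uo.
  have /contrapT[k ku pk] := Hn u un uo.
  rewrite un in ku.
  rewrite (bigD1 (Ordinal ku))//= pk mul1r lerDl sumr_ge0// => i _.
  by rewrite mulr_ge0 ?word_weight_ge0.
rewrite word_sum_sum; apply: ler_sum => k _.
have [kn|kn] := leqP (size (V k)) n; first by apply: word_weight_prefix => // y; exact: Vb.
apply: (@le_trans _ _ (word_sum A n (fun=> 0))); last by rewrite word_sum0.
apply: ler_word_sum => u un _; rewrite (_ : prefix _ _ = false) ?mul0r//.
by apply/negP => /size_prefix; rewrite un leqNgt kn.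
Qed.

End weights.

(** * Choosing a cylinder for each set of a cover *)

Section cylinders.
Variables (R : realType) (w s : R) (A : seq int).
Hypotheses (w4 : 4 <= w) (s0 : 0 < s) (A0 : letters A) (uA : uniq A).
Hypothesis letter_sum_ge1 : forall x, `|x| <= 1 -> 1 <= letter_sum w s A x.
Implicit Types (al be : nat -> int) (u v : seq int) (x y : R).

Let w0 : 0 <= w. Proof. by apply: le_trans w4; lra. Qed.

(** Finitely many letters only: the images of the unit interval under two of them
are separated. *)
Lemma branch_gap : exists2 g, 0 < g & forall a b x y,
  a \in A -> b \in A -> a != b -> `|x| <= 1 -> `|y| <= 1 ->
  g <= `|branch w a x - branch w b y|.
Proof.
pose M : R := \sum_(a <- A) `|a%:~R|.
have MA a : a \in A -> `|a%:~R| <= M.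
  move=> aA; rewrite /M (bigD1_seq a)//= lerDl sumr_ge0//.
have M0 : 0 <= M by rewrite sumr_ge0.
have D0 : 0 < w * M + 1 by rewrite ltr_wpDl// mulr_ge0.
exists (2 / (w * M + 1) ^+ 2); first by rewrite divr_gt0// exprn_gt0.
move=> a b x y aA bA ab x1 y1.
have a0 := allP A0 _ aA; have b0 := allP A0 _ bA.
have ax := real_denom_neq0 w4 a0 x1; have b_y := real_denom_neq0 w4 b0 y1.
have -> : branch w a x - branch w b y =
   (w * (a - b)%:~R + (x - y)) / ((w * a%:~R + x) * (w * b%:~R + y)).
  by rewrite /branch intrB; field; rewrite ax b_y.
rewrite normrM normfV normrM.
have num : 2 <= `|w * (a - b)%:~R + (x - y)|.
  have ab0 : a - b != 0 by rewrite subr_eq0.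
  have h1 := norm_letter_ge1 R ab0.
  have h := lerB_normD (w * (a - b)%:~R) (x - y).
  rewrite normrM (ger0_norm w0) in h.
  have : w <= w * `|(a - b)%:~R| by rewrite ler_peMr.
  have := ler_normB x y.
  by move: h x1 y1 w4; lra.
have den c z : c \in A -> `|z| <= 1 -> `|w * c%:~R + z| <= w * M + 1.
  move=> cA z1; apply: (le_trans (ler_normD _ _)); apply: lerD => //.
  by rewrite normrM (ger0_norm w0) ler_wpM2l// MA.
have ax0 : 0 < `|w * a%:~R + x| by rewrite normr_gt0.
have by0 : 0 < `|w * b%:~R + y| by rewrite normr_gt0.
apply: ler_pM => //; first by rewrite invr_ge0 exprn_ge0// ltW.
rewrite lef_pV2 ?posrE ?mulr_gt0 ?exprn_gt0// expr2.
by apply: ler_pM; rewrite ?normr_ge0 ?den.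
Qed.

Lemma powR_opp2 x : 0 < x -> x `^ (- (2 * s)) = ((x ^+ 2)^-1) `^ s.
Proof.
move=> x0; rewrite -mulrN powRrM powR_mulrn ?ltW//.
by rewrite -[in RHS]powR_inv1 ?exprn_ge0 ?ltW// -powRrM mulN1r.
Qed.

Lemma word_weight_le v : over A v -> exists d : R,
  [/\ 0 < d, 2 ^+ size v <= d,
    forall x, `|x| <= 1 -> `|denom w v x| <= 2 * d &
    forall x, `|x| <= 1 -> word_weight w s A v x <= (4 / d ^+ 2) `^ s].
Proof.
move=> vA; have [c [d [d1 cd E]]] := denom_affine w4 (over_letters A0 vA).
have d0 : 0 < `|d| by apply: lt_le_trans d1; rewrite exprn_gt0.
exists `|d|; split => // [x x1|x x1].
  by rewrite E//; have /andP[] := denom_bounds cd x1.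
apply: (le_trans (word_weight_denom w4 A0 letter_sum_ge1 vA x1)).
rewrite E//; have /andP[h _] := denom_bounds cd x1.
have h0 : 0 < `|c * x + d| by apply: lt_le_trans h; rewrite divr_gt0.
have d4 : (`|d| / 2) ^+ 2 <= `|c * x + d| ^+ 2.
  by apply: lerXn2r => //; rewrite nnegrE ?divr_ge0.
rewrite powR_opp2//; apply: le_powR2r; first exact: ltW.
  by rewrite invr_ge0 exprn_ge0.
have -> : 4 / `|d| ^+ 2 = ((`|d| / 2) ^+ 2)^-1 by field; rewrite gt_eqF.
by rewrite lef_pV2 ?posrE ?exprn_gt0 ?divr_gt0.
Qed.

(** A set [Q] of infinite words lies in the cylinder of its longest common prefix [v].
If [Q] has two elements, they separate right after [v], so their distance is at
least a constant times the size of the cylinder, and the weight of [v] is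
controlled by the diameter [D]. If [Q] has at most one element, the prefix can be
taken so long that its weight is below [e]. *)
Lemma cylinder_selection : exists2 K, 0 < K &
  forall (Q : (nat -> int) -> Prop) (D e : R), 0 < e ->
  (forall al, Q al -> infinite_word A al) ->
  (forall al be, Q al -> Q be -> `|word_point w al - word_point w be| <= D) ->
  exists v b, [/\ over A v, 0 <= b, b <= K * D `^ s + e,
    forall x, `|x| <= 1 -> word_weight w s A v x <= b &
    forall al, Q al -> mkseq al (size v) = v].
Proof.
have [g g0 gap] := branch_gap.
exists ((16 / g) `^ s); first by rewrite powR_gt0// divr_gt0.
move=> Q D e e0 QA QD.
have [[n0 [al0 [be0 [Q1 Q2 ne]]]]|H] :=
    pselect (exists n al be, [/\ Q al, Q be & al n != be n]).
  pose P n := `[< exists al be, [/\ Q al, Q be & al n != be n] >].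
  have exP : exists n, P n by exists n0; apply/asboolP; exists al0, be0.
  case: (ex_minnP exP) => n /asboolP[al [be [Qal Qbe ab]]] nmin.
  have agree ga : Q ga -> mkseq ga n = mkseq al n.
    move=> Qga; apply/eq_in_map => k; rewrite mem_iota add0n => /andP[_ kn].
    apply/eqP; apply: contraT => neq; have : P k by apply/asboolP; exists ga, al.
    by move=> /nmin; rewrite leqNgt kn.
  have Aal := QA _ Qal; have Abe := QA _ Qbe.
  have vA := over_mkseq n Aal.
  have [d [d0 d1 dd wd]] := word_weight_le vA.
  have va := over_letters A0 vA.
  have sal := infinite_word_shift n Aal; have sbe := infinite_word_shift n Abe.
  have pa := norm_word_point w4 A0 sal.
  have pb := norm_word_point w4 A0 sbe.
  have gd : g <= D * (4 * d ^+ 2).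
    have D0 : 0 <= D by apply: le_trans (QD _ _ Qal Qbe).
    have := branches_diff w4 va pa pb; rewrite -(word_pointE w4 A0 n Aal).
    rewrite -(agree _ Qbe) -(word_pointE w4 A0 n Abe) (agree _ Qbe).
    move=> /(congr1 Num.norm); rewrite normrM => E.
    have : g <= `|word_point w (shift n al) - word_point w (shift n be)|.
      rewrite (word_point_shift1 w4 A0 sal) (word_point_shift1 w4 A0 sbe).
      have pas := norm_word_point w4 A0 (infinite_word_shift 1 sal).
      have pbs := norm_word_point w4 A0 (infinite_word_shift 1 sbe).
      by apply: gap => //; rewrite /shift addn0.
    rewrite -E => h; apply: (le_trans h); apply: ler_pM => //; first exact: QD.
    rewrite normrM (_ : 4 * d ^+ 2 = (2 * d) * (2 * d)); last by ring.
    by apply: ler_pM => //; exact: dd.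
  have D0 : 0 < D.
    have : 0 < D * (4 * d ^+ 2) by apply: lt_le_trans gd.
    by rewrite pmulr_lgt0// mulr_gt0// exprn_gt0.
  exists (mkseq al n), ((16 / g) `^ s * D `^ s); split => //.
  - by rewrite mulr_ge0 ?powR_ge0.
  - by rewrite lerDl ltW.
  - move=> x x1; apply: (le_trans (wd _ x1)).
    have g16 : 0 <= 16 / g by rewrite divr_ge0// ltW.
    rewrite -powRM ?(ltW D0)//; apply: le_powR2r; first exact: ltW.
    + by rewrite divr_ge0// exprn_ge0// ltW.
    + rewrite ler_pdivrMr ?exprn_gt0// [X in _ <= X](_ : _ = 4 / g * (D * (4 * d ^+ 2))); last by ring.
      by rewrite mulrAC ler_pdivlMr// ler_wpM2l.
  - by move=> ga Qga; rewrite size_mkseq agree.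
have [a aA] : exists a, a \in A.
  have := letter_sum_ge1 (x := 0); rewrite normr0 /letter_sum => /(_ ler01).
  by case: (A) => [|a B]; [rewrite big_nil ler10|exists a; rewrite mem_head].
have [al [Aal Hal]] : exists al, infinite_word A al /\ forall be, Q be -> be =1 al.
  have [[al Qal]|nQ] := pselect (exists al, Q al).
    exists al; split; first exact: QA.
    move=> be Qbe n; apply/eqP; apply: contrapT => /negP ne; apply: H.
    by exists n, be, al.
  by exists (fun=> a); split=> // be Qbe; case: nQ; exists be.
have [n /(_ n (leqnn n))/ltW Hn] :=
  @geometric_small R (1 / 4) 4 (e `^ s^-1) ltac:(lra) ltac:(lra) (powR_gt0 _ e0).
have vA := over_mkseq n Aal.
have [d [d0 d1 dd wd]] := word_weight_le vA.
exists (mkseq al n), e; split => //.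
- exact: ltW.
- by rewrite lerDr mulr_ge0 ?powR_ge0.
- move=> x x1; apply: (le_trans (wd _ x1)).
  have -> : e = (e `^ s^-1) `^ s by rewrite -powRrM mulVf ?gt_eqF// powRr1// ltW.
  apply: le_powR2r; first exact: ltW.
    by rewrite divr_ge0// exprn_ge0// ltW.
  apply: le_trans Hn; rewrite ler_wpM2l//.
  have n2 : 0 < 2 ^+ n :> R by rewrite exprn_gt0.
  have -> : (1 / 4) ^+ n = ((2 ^+ n) ^+ 2)^-1 :> R.
    by rewrite exprAC -exprVn; congr (_ ^+ n); field.
  rewrite lef_pV2 ?posrE ?exprn_gt0//; rewrite size_mkseq in d1.
  by apply: lerXn2r => //; rewrite nnegrE ltW.
- move=> be Qbe; rewrite size_mkseq; apply: eq_map => k; exact: Hal.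
Qed.

End cylinders.

(** * The Riemann sphere and the orbits of the Hecke group *)

Local Open Scope complex_scope.
Local Notation modulus := ComplexField.Normc.normc.

Section modulus.
Variable R : realType.
Implicit Types (z u : R[i]) (x : R).

Lemma modulus_ge0 z : 0 <= modulus z.
Proof. by case: z => a b; exact: sqrtr_ge0. Qed.

Lemma modulusD z u : modulus (z + u) <= modulus z + modulus u.
Proof. exact: le_normcD. Qed.

Lemma modulusN z : modulus (- z) = modulus z.
Proof. exact: normcN. Qed.

Lemma modulusB z u : modulus (z - u) <= modulus z + modulus u.
Proof. by rewrite -[modulus u]modulusN; exact: modulusD. Qed.

Lemma modulus_sym z u : modulus (z - u) = modulus (u - z).
Proof. by rewrite -modulusN opprB. Qed.

Lemma modulus_triangle u z z' : modulus (z - z') <= modulus (z - u) + modulus (u - z').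
Proof. by rewrite -[z - z'](subrKA u); exact: modulusD. Qed.

Lemma modulusM z u : modulus (z * u) = modulus z * modulus u.
Proof. exact: ComplexField.Normc.normcM. Qed.

Lemma modulusV z : modulus (z^-1) = (modulus z)^-1.
Proof. exact: ComplexField.Normc.normcV. Qed.

Lemma modulus_real x : modulus (x%:C) = `|x|.
Proof. by rewrite /= expr0n addr0 sqrtr_sqr. Qed.

Lemma modulus_eq0 z : (modulus z == 0) = (z == 0).
Proof.
apply/eqP/eqP => [/ComplexField.Normc.eq0_normc//|->].
exact: ComplexField.Normc.normc0.
Qed.

Lemma modulus_gt0 z : (0 < modulus z) = (z != 0).
Proof. by rewrite lt_neqAle modulus_ge0 andbT eq_sym modulus_eq0. Qed.

Lemma Im_le_modulus z : `|complex.Im z| <= modulus z.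
Proof.
case: z => a b; rewrite /= -sqrtr_sqr; apply: ler_wsqrtr.
by rewrite lerDr sqr_ge0.
Qed.

(** The map [S] is an involution. *)
Lemma opp_invK z : - (- z^-1)^-1 = z.
Proof. by rewrite invrN opprK invrK. Qed.

End modulus.

Section sphere.
Variable R : realType.
Implicit Types (z u xi : R[i]) (E : set (riemann_sphere R)).

Let rho z : R := Num.sqrt (1 + modulus z ^+ 2).

Let rho_ge1 z : 1 <= rho z.
Proof. by rewrite -[leLHS]sqrtr1 ler_wsqrtr// lerDl sqr_ge0. Qed.

Let rho_gt0 z : 0 < rho z. Proof. exact: lt_le_trans ltr01 (rho_ge1 z). Qed.

Lemma mdistE (x y : riemann_sphere R) : mdist x y = chordal_dist x y.
Proof. by []. Qed.

Let chordalE z u : chordal_dist (Some z) (Some u) = 2 * modulus (z - u) / (rho z * rho u).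
Proof. by []. Qed.

Lemma chordal_le z u : chordal_dist (Some z) (Some u) <= 2 * modulus (z - u).
Proof.
rewrite chordalE ler_pdivrMr ?mulr_gt0// ler_peMr ?mulr_ge0 ?modulus_ge0//.
by rewrite -[1]mulr1; apply: ler_pM.
Qed.

Lemma chordal_ge z u : modulus z <= 1 -> modulus u <= 1 ->
  modulus (z - u) <= chordal_dist (Some z) (Some u).
Proof.
move=> z1 u1; rewrite chordalE ler_pdivlMr ?mulr_gt0// mulrC.
rewrite ler_wpM2r ?modulus_ge0//.
have rho2 t : modulus t <= 1 -> rho t <= Num.sqrt 2.
  move=> t1; apply: ler_wsqrtr; rewrite -lerBrDl (_ : 2 - 1 = 1); last by ring.
  by rewrite -[leRHS](expr1n _ 2); apply: lerXn2r; rewrite ?nnegrE ?modulus_ge0.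
rewrite -[leRHS]sqr_sqrtr// expr2.
by apply: ler_pM; rewrite ?rho2// ltW.
Qed.

(** Limit points of orbits are studied in the plane, where translations are isometries
and inversion has a simple effect on distances. *)
Definition clusters E xi := forall e : R, 0 < e ->
  exists z, [/\ E (Some z), z != xi & modulus (z - xi) < e].

(** Near a finite point the chordal distance is comparable with the Euclidean one.
The constant depends on [xi], through the factor [rho]. *)
Lemma limit_point_finite E xi : limit_point E (Some xi) <-> clusters E xi.
Proof.
split=> H.
  move=> e e0; set r := rho xi.
  have r1 : 1 <= r := rho_ge1 xi.
  pose d := Num.min r^-1 (e / r ^+ 2).
  have d0 : 0 < d.
    rewrite lt_min invr_gt0 divr_gt0 ?exprn_gt0 ?rho_gt0 ?andbT//; exact: rho_gt0.
  have [y [yxi Ey]] := H _ (nbhsx_ballx (Some xi : riemann_sphere R) d d0).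
  rewrite ballEmdist /= mdistE.
  case: y yxi Ey => [y|] yxi Ey.
    rewrite chordalE => Hd; exists y; split=> //.
    rewrite modulus_sym; set m := modulus (xi - y) in Hd *.
    have m0 : 0 <= m := modulus_ge0 _.
    have ry : rho y <= r + m.
      have my : modulus y <= modulus xi + m.
        rewrite -[y](subrK xi) addrC; apply: (le_trans (modulusD _ _)).
        by rewrite /m modulus_sym lerD2l.
      have xr : modulus xi <= r.
        rewrite -[leLHS]ger0_norm ?modulus_ge0// -sqrtr_sqr.
        by apply: ler_wsqrtr; rewrite lerDr.
      rewrite -[leRHS]ger0_norm ?addr_ge0 ?(ltW (rho_gt0 _))// -sqrtr_sqr.
      apply: ler_wsqrtr.
      have -> : (r + m) ^+ 2 = r ^+ 2 + 2 * r * m + m ^+ 2 by ring.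
      rewrite /r sqr_sqrtr ?addr_ge0 ?sqr_ge0// -/r.
      have : modulus y ^+ 2 <= (modulus xi + m) ^+ 2.
        by apply: lerXn2r; rewrite ?nnegrE ?addr_ge0 ?modulus_ge0.
      have : modulus xi * m <= r * m by rewrite ler_wpM2r.
      have := modulus_ge0 xi.
      by move: (modulus y) (modulus xi) => p q; nra.
    rewrite ltr_pdivrMr ?mulr_gt0 ?rho_gt0// -/r in Hd.
    have d1 : d * r <= 1.
      rewrite -(mulVf (lt0r_neq0 (rho_gt0 xi))) -/r ler_wpM2r ?ge_min ?lexx//.
      exact/ltW/rho_gt0.
    have d2 : d * r ^+ 2 <= e.
      rewrite -ler_pdivlMr ?exprn_gt0 ?rho_gt0//.
      by rewrite ge_min lexx orbT.
    have : d * (r * rho y) <= d * (r * (r + m)).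
      by rewrite !ler_wpM2l// ltW// rho_gt0.
    have : d * r * m <= m by rewrite ler_piMl.
    by move: Hd d2; rewrite expr2; nra.
  move=> Hd; exfalso; move: Hd; apply/negP; rewrite -leNgt.
  rewrite /chordal_dist -/(rho xi) -/r.
  rewrite ge_min; apply/orP; left.
  by rewrite ler_peMl ?invr_ge0 ?(le_trans ler01 r1)// ler1n.
move=> U /nbhs_ballP[e /= e0 eU].
have [z [Ez zxi ze]] := H (e / 2) (divr_gt0 e0 (ltr0n _ 2)).
exists (Some z); split => //.
apply: eU; rewrite ballEmdist /= mdistE.
by apply: le_lt_trans (chordal_le _ _) _; rewrite modulus_sym mulrC -ltr_pdivlMr.
Qed.

End sphere.

Section hecke_orbits.
Variables (R : realType) (w : R).
Implicit Types (z y : R[i]) (A B : 'M[R]_2).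

Lemma det_mx2E A : \det A = A 0 0 * A 1 1 - A 0 1 * A 1 0.
Proof.
rewrite (expand_det_row _ 0) !big_ord_recl big_ord0 addr0 /cofactor !det_mx11 !mxE /=.
rewrite !addn0 expr0 mul1r expr1.
have -> : lift ord0 ord0 = 1 :> 'I_2 by exact/val_inj.
have -> : lift 1 ord0 = 0 :> 'I_2 by exact/val_inj.
by rewrite mulN1r mulrN.
Qed.

Lemma hecke_group_det A : hecke_group w A -> \det A = 1.
Proof.
elim=> [|||B C _ IB _ IC|B _ IB].
- by rewrite det_mx2E !mxE /=; ring.
- by rewrite det_mx2E !mxE /=; ring.
- by rewrite det1.
- by rewrite det_mulmx IB IC mulr1.
- by rewrite det_inv IB invr1.
Qed.

Lemma mobius_denom_neq0 A z : \det A = 1 -> 0 < complex.Im z ->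
  (A 1 0)%:C * z + (A 1 1)%:C != 0.
Proof.
rewrite det_mx2E; case: z => a b /= dA b0.
apply/negP; rewrite eq_complex /= => /andP[/eqP h1 /eqP h2].
have c0 : A 1 0 = 0.
  have : A 1 0 * b = 0 by move: h2; rewrite mul0r !addr0.
  by move=> /eqP; rewrite mulf_eq0 (gt_eqF b0) orbF => /eqP.
move: h1; rewrite c0 !mul0r subr0 add0r => d0.
by move: dA; rewrite c0 d0 !mulr0 subr0 => /eqP; rewrite eq_sym oner_eq0.
Qed.

Lemma Im_mobius_gt0 A z : \det A = 1 -> 0 < complex.Im z ->
  0 < complex.Im (mobius A z).
Proof.
move=> dA z0; have := mobius_denom_neq0 dA z0; rewrite /mobius.
rewrite -modulus_gt0 => h.
have -> : complex.Im (((A 0 0)%:C * z + (A 0 1)%:C) / ((A 1 0)%:C * z + (A 1 1)%:C)) =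
   (\det A * complex.Im z) / modulus ((A 1 0)%:C * z + (A 1 1)%:C) ^+ 2.
  rewrite det_mx2E; case: z z0 h => a b /= b0 h.
  rewrite sqr_sqrtr ?addr_ge0 ?sqr_ge0//; ring.
by rewrite dA mul1r divr_gt0// exprn_gt0.
Qed.

Lemma mobiusM A B z : \det A = 1 -> \det B = 1 -> 0 < complex.Im z ->
  mobius (A *m B) z = mobius A (mobius B z).
Proof.
move=> dA dB z0.
have h1 := mobius_denom_neq0 dB z0.
have h2 := mobius_denom_neq0 dA (Im_mobius_gt0 dB z0).
have dAB : \det (A *m B) = 1 by rewrite det_mulmx dA dB mulr1.
have h3 := mobius_denom_neq0 dAB z0.
move: h2 h3; rewrite /mobius !mxE !big_ord_recl !big_ord0 !addr0.
rewrite (_ : lift ord0 ord0 = 1); last exact/val_inj.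
rewrite !rmorphD !rmorphM /=.
move=> _ h3; field; apply/andP; split=> //.
by apply: contra h3 => /eqP h; apply/eqP; rewrite -[RHS]h /=; ring.
Qed.

Lemma mobius1 z : mobius 1%:M z = z.
Proof. by rewrite /mobius !mxE /= mul1r addr0 mul0r add0r divr1. Qed.

Lemma mobius_S z : mobius (mx2 0 (-1) 1 0) z = - z^-1.
Proof.
rewrite /mobius !mxE /= rmorphN rmorph0 rmorph1.
by rewrite mul0r mul1r add0r addr0 mulN1r.
Qed.

Lemma mobius_T x z : mobius (mx2 1 x 0 1) z = z + x%:C.
Proof.
rewrite /mobius !mxE /= rmorph0 rmorph1.
by rewrite mul0r mul1r add0r divr1.
Qed.

Lemma hecke_group_T (m : int) : hecke_group w (mx2 1 (w * m%:~R) 0 1).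
Proof.
have addT (p q : R) : mx2 1 p 0 1 *m mx2 1 q 0 1 = mx2 1 (p + q) 0 1.
  apply/matrixP => i j; rewrite !mxE big_ord_recl big_ord1 !mxE /=.
  by case: i => -[|[|//]] /= hi; case: j => -[|[|//]] /= hj; ring.
have T0 : mx2 1 0 0 1 = 1%:M :> 'M[R]_2.
  apply/matrixP => i j; rewrite !mxE.
  by case: i => -[|[|//]] /= hi; case: j => -[|[|//]] /= hj.
have pos (n : nat) : hecke_group w (mx2 1 (w * n%:R) 0 1).
  elim: n => [|n IH]; first by rewrite mulr0 T0; exact: hecke_1.
  by rewrite -natr1 mulrDr mulr1 -addT; apply: hecke_mul IH (hecke_T _).
case: m => n; first exact: pos.
rewrite NegzE rmorphN mulrN /=.
have -> : mx2 1 (- (w * n.+1%:R)) 0 1 = invmx (mx2 1 (w * n.+1%:R) 0 1) :> 'M[R]_2.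
  have uT : mx2 1 (w * n.+1%:R) 0 1 \in unitmx.
    by rewrite unitmxE (hecke_group_det (pos _)) unitr1.
  by rewrite -[LHS]mulmx1 -(mulmxV uT) mulmxA addT addNr T0 mul1mx.
by apply: hecke_inv; exact: pos.
Qed.

Section orbit.
Variable z : R[i].
Hypothesis z0 : 0 < complex.Im z.

Lemma orbit_Im y : hecke_orbit w z (Some y) -> 0 < complex.Im y.
Proof. by move=> [A hA [<-]]; apply: Im_mobius_gt0 => //; exact: hecke_group_det. Qed.

Lemma orbit_refl : hecke_orbit w z (Some z).
Proof. by exists 1%:M; [exact: hecke_1|rewrite mobius1]. Qed.

Lemma orbit_mobius A y : hecke_group w A -> hecke_orbit w z (Some y) ->
  hecke_orbit w z (Some (mobius A y)).
Proof.
move=> hA [B hB [<-]]; exists (A *m B); first exact: hecke_mul.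
by rewrite mobiusM ?(hecke_group_det hA) ?(hecke_group_det hB).
Qed.

Lemma orbit_S y : hecke_orbit w z (Some y) -> hecke_orbit w z (Some (- y^-1)).
Proof. by move=> h; rewrite -mobius_S; apply: orbit_mobius h; exact: hecke_S. Qed.

Lemma orbit_T (m : int) y : hecke_orbit w z (Some y) ->
  hecke_orbit w z (Some (y + (w * m%:~R)%:C)).
Proof. by move=> h; rewrite -mobius_T; apply: orbit_mobius h; exact: hecke_group_T. Qed.

Lemma orbit_trans y y' : hecke_orbit w z (Some y) -> hecke_orbit w z (Some y') ->
  hecke_orbit w y (Some y').
Proof.
move=> [A hA [<-]] [B hB [<-]].
have dA := hecke_group_det hA; have dB := hecke_group_det hB.
have uA : A \in unitmx by rewrite unitmxE dA unitr1.
exists (B *m invmx A); first by apply: hecke_mul => //; exact: hecke_inv.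
have dV : \det (invmx A) = 1 by rewrite det_inv dA invr1.
rewrite -mobiusM//; first by rewrite -mulmxA mulVmx// mulmx1.
by rewrite det_mulmx dB dV mulr1.
Qed.

(** A property invariant under the two generators is invariant under the whole group.
It has to be an equivalence in order to pass to inverses. *)
Lemma orbit_ind (X : R[i] -> Prop) :
  (forall y, 0 < complex.Im y -> X y <-> X (- y^-1)) ->
  (forall y, 0 < complex.Im y -> X y <-> X (y + w%:C)) ->
  X z -> forall y, hecke_orbit w z (Some y) -> X y.
Proof.
move=> XS XT Xz y [A hA [<-]].
suff : forall u, 0 < complex.Im u -> X u <-> X (mobius A u).
  by move=> /(_ _ z0) [+ _]; exact.
elim: hA => {A y} [|||A B hA IA hB IB|A hA IA] u u0.
- by rewrite mobius_S; exact: XS.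
- by rewrite mobius_T; exact: XT.
- by rewrite mobius1.
- rewrite mobiusM ?(hecke_group_det hA) ?(hecke_group_det hB)//.
  have dB := hecke_group_det hB.
  by rewrite (IB u u0); apply: IA; exact: Im_mobius_gt0.
- have dA := hecke_group_det hA.
  have dV : \det (invmx A) = 1 by rewrite det_inv dA invr1.
  have uA : A \in unitmx by rewrite unitmxE dA unitr1.
  rewrite (IA _ (Im_mobius_gt0 dV u0)) -mobiusM// mulmxV// mobius1.
  by [].
Qed.

End orbit.

End hecke_orbits.

(** * The lower bound for the dimension *)

Section complex_words.
Variables (R : realType) (w : R).
Hypothesis w4 : 4 <= w.
Implicit Types (a : int) (v : seq int).

Lemma modulus_letter a : modulus (w%:C * a%:~R) = `|w * a%:~R|.
Proof. by rewrite -(rmorph_int (@real_complex R)) -rmorphM modulus_real. Qed.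

Lemma modulus_letter_ge4 a : a != 0 -> 4 <= modulus (w%:C * a%:~R).
Proof. by move=> a0; rewrite modulus_letter; exact: norm_letter_ge4. Qed.

Definition complex_branches_contract := branches_contract (@modulus_ge0 R)
  (@ComplexField.Normc.normc0 R) (@modulusN R) (@modulusV R) (@modulusM R)
  (@modulusD R) modulus_letter_ge4.

Lemma branches_real v (x : R) : branches w%:C v x%:C = (branches w v x)%:C.
Proof.
elim: v => //= a v ->; rewrite /branch -(rmorph_int (@real_complex R)).
by rewrite -rmorphM -rmorphD -fmorphV -rmorphN.
Qed.

Lemma orbit_branches z y v : 0 < complex.Im z ->
  hecke_orbit w z (Some y) -> hecke_orbit w z (Some (branches w%:C v y)).
Proof.
move=> z0 hy; elim: v => //= a v IH.
rewrite /branch addrC -(rmorph_int (@real_complex R)) -rmorphM.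
by apply: orbit_S => //; exact: orbit_T.
Qed.

(** The images of [i] under the prefixes of the infinite word lie in its orbit and
converge to the point, by contraction; they differ from it because it is real. *)
Lemma limit_set_word_point (A : seq int) al : letters A -> infinite_word A al ->
  limit_set w (Some (word_point w al)%:C).
Proof.
move=> A0 Aal; pose z : R[i] := Complex 0 1.
have z0 : 0 < complex.Im z by rewrite /= ltr01.
exists z => //; apply/limit_point_finite => e e0.
have [n /(_ n (leqnn n)) Hn] :=
  @geometric_small R (1 / 2) 2 e ltac:(lra) ltac:(lra) e0.
have oz := orbit_branches (mkseq al n) z0 (orbit_refl w z).
exists (branches w%:C (mkseq al n) z); split => //.
  have := orbit_Im z0 oz; apply: contraTN => /eqP -> /=.
  by rewrite ltxx.
have As := infinite_word_shift n Aal.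
have p1 := norm_word_point w4 A0 As.
have z1 : modulus z = 1 by rewrite /= expr0n expr1n add0r sqrtr1.
rewrite (word_pointE w4 A0 n Aal) -branches_real.
apply: (le_lt_trans (complex_branches_contract _ _ _)).
- exact/(over_letters A0)/over_mkseq.
- by rewrite z1.
- by rewrite modulus_real.
rewrite size_mkseq; apply: le_lt_trans Hn; rewrite [leRHS]mulrC ler_wpM2l ?exprn_ge0//.
by apply: (le_trans (modulusB _ _)); rewrite z1 modulus_real; lra.
Qed.

End complex_words.

Section diameters.
Variable R : realType.
Implicit Types (U : set (riemann_sphere R)).

Lemma diam_ge0 U : (0 <= diam U)%E.
Proof. by rewrite le_max lexx. Qed.

Lemma le_diam U x y : U x -> U y -> ((chordal_dist x y)%:E <= diam U)%E.
Proof.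
move=> Ux Uy; rewrite le_max; apply/orP; right.
by apply: ereal_sup_ubound; exists (x, y).
Qed.

Lemma diam_le U (d : R) : 0 <= d ->
  (forall x y, U x -> U y -> chordal_dist x y <= d) -> (diam U <= d%:E)%E.
Proof.
move=> d0 H; rewrite ge_max lee_fin d0 /=.
by apply: ge_ereal_sup => _ [[x y] [Ux Uy] <-]; rewrite lee_fin; exact: H.
Qed.

End diameters.

Section lower_bound.
Variables (R : realType) (w s : R) (A : seq int).
Hypotheses (w4 : 4 <= w) (s0 : 0 < s) (A0 : letters A) (uA : uniq A).
Hypothesis letter_sum_ge1 : forall x, `|x| <= 1 -> 1 <= letter_sum w s A x.

(** Each set of a cover is replaced by a cylinder whose weight is at most a constant
times the power [s] of its diameter, up to errors with sum at most [1 / 2]. The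
cylinders contain all infinite words, so their weights sum to at least 1. *)
Lemma hausdorff_measure_gt0 : hausdorff_measure s (limit_set w) <> 0%E.
Proof.
have [K K0 sel] := cylinder_selection w4 s0 A0 uA letter_sum_ge1.
pose c := 1 / (2 * K).
have c0 : 0 < c by rewrite divr_gt0// mulr_gt0.
suff Hc : (c%:E <= hausdorff_measure s (limit_set w))%E.
  by move=> H; move: Hc; rewrite H lee_fin leNgt c0.
apply: (@le_trans _ _ (hausdorff_premeasure 1 s (limit_set w))); last first.
  by apply: ereal_sup_ubound; exists 1 => //=.
apply: le_ereal_inf_tmp => _ [U [cov dU] <-].
pose D k := fine (diam (U k)).
have dE k : diam (U k) = (D k)%:E.
  rewrite /D fineK// ge0_fin_numE ?diam_ge0//.
  exact: le_lt_trans (dU k) (ltry _).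
have D0 k : 0 <= D k by rewrite -lee_fin -dE diam_ge0.
pose Q k al := infinite_word A al /\ U k (Some (word_point w al)%:C).
have QD k al be : Q k al -> Q k be -> `|word_point w al - word_point w be| <= D k.
  move=> [Aal Ual] [Abe Ube]; rewrite -modulus_real.
  rewrite (_ : (_ - _)%:C = (word_point w al)%:C - (word_point w be)%:C); last by rewrite rmorphB.
  apply: (@le_trans _ _ (chordal_dist (Some (word_point w al)%:C) (Some (word_point w be)%:C))).
    by apply: chordal_ge; rewrite modulus_real (norm_word_point w4 A0).
  by rewrite -lee_fin -dE; apply: le_diam.
(* The sum of these errors leaves half of the total weight to the diameters. *)
have e0 k : 0 < (1 / 2) ^+ k.+2 :> R by rewrite exprn_gt0//; lra.
have [V HV] := choice (fun k => sel (Q k) (D k) _ (e0 k) (fun al => @proj1 _ _) (QD k)).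
have [b Hb] := choice HV.
have [N HN] : exists N, 1 <= \sum_(k < N) b k.
  apply: (cover_weight w4 A0 uA letter_sum_ge1 (V := V)).
  - by move=> k; have [] := Hb k.
  - by move=> k; have [] := Hb k.
  - by move=> k; have [] := Hb k.
  - move=> al Aal; have [k _ Uk] := cov _ (limit_set_word_point w4 A0 Aal).
    by exists k; have [_ _ _ _] := Hb k; apply.
apply: (@le_trans _ _ (\sum_(0 <= k < N) diam (U k) `^ s)%E); last first.
  by apply: nneseries_lim_ge => *; exact: poweR_ge0.
rewrite (eq_bigr (fun k => (D k `^ s)%:E)); last by move=> k _; rewrite dE poweR_EFin.
rewrite sumEFin lee_fin big_mkord.
have geo : \sum_(k < N) (1 / 2 : R) ^+ k.+2 <= 1 / 2.
  have -> : \sum_(k < N) (1 / 2 : R) ^+ k.+2 = 1 / 2 - (1 / 2) ^+ N.+1.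
    elim: N {HN} => [|n IH]; first by rewrite big_ord0 expr1 subrr.
    by rewrite big_ord_recr /= IH !exprS; field.
  by rewrite gerBl exprn_ge0//; lra.
have : \sum_(k < N) b k <= K * \sum_(k < N) D k `^ s + \sum_(k < N) (1 / 2) ^+ k.+2.
  rewrite mulr_sumr -big_split /=; apply: ler_sum => k _.
  by have [] := Hb k.
rewrite /c ler_pdivrMr ?mulr_gt0//.
move: HN geo; move: (\sum_(k < N) b k) (\sum_(k < N) D k `^ s) => p q; nra.
Qed.

End lower_bound.

(** * Coding the limit set by words *)

Section limit_set_structure.
Variables (R : realType) (w : R).
Hypothesis w7 : 7 <= w.
Implicit Types (z y xi : R[i]) (a m : int) (v : seq int).

Let w4 : 4 <= w. Proof. by apply: le_trans w7; lra. Qed.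
Let w0 : 0 <= w. Proof. by apply: le_trans w7; lra. Qed.

Local Notation tr m := ((w * m%:~R)%:C).

Let trD m m' : tr (m + m') = tr m + tr m'.
Proof. by rewrite intrD mulrDr rmorphD. Qed.

Let trN m : tr (- m) = - tr m.
Proof. by rewrite intrN mulrN rmorphN. Qed.

Let tr0 : tr 0 = 0. Proof. by rewrite mulr0. Qed.

Let modulus_tr m : m != 0 -> 7 <= modulus (tr m).
Proof.
move=> m0; rewrite modulus_real normrM (ger0_norm w0); apply: (le_trans w7).
by rewrite ler_peMr// norm_letter_ge1.
Qed.

Lemma clusters_T z m xi : 0 < complex.Im z ->
  clusters (hecke_orbit w z) xi -> clusters (hecke_orbit w z) (xi + tr m).
Proof.
move=> z0 H e /H[y [ oy yxi ye]]; exists (y + tr m); split.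
- exact: orbit_T.
- by rewrite (inj_eq (addIr _)).
- by rewrite opprD addrACA subrr addr0.
Qed.

Lemma clusters_S z xi : 0 < complex.Im z -> xi != 0 ->
  clusters (hecke_orbit w z) xi -> clusters (hecke_orbit w z) (- xi^-1).
Proof.
move=> z0 xi0 H e e0; set r := modulus xi.
have r0 : 0 < r by rewrite /r modulus_gt0.
have d0 : 0 < Num.min (r / 2) (e * r ^+ 2 / 2).
  by rewrite lt_min !divr_gt0// mulr_gt0// exprn_gt0.
have [y [ oy yxi]] := H _ d0; rewrite lt_min => /andP[y1 y2].
have yr : r / 2 < modulus y.
  have := modulusD y (xi - y); rewrite subrKC modulus_sym -/r => h; lra.
have y0 : y != 0.
  by rewrite -modulus_gt0 (lt_trans _ yr)// divr_gt0.
exists (- y^-1); split.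
- exact: orbit_S.
- by rewrite (inj_eq oppr_inj) (inj_eq invr_inj).
- have -> : - y^-1 - - xi^-1 = (y - xi) / (y * xi) by field; rewrite xi0 y0.
  rewrite modulusM modulusV modulusM -/r ltr_pdivrMr ?mulr_gt0 ?modulus_gt0//.
  apply: (lt_le_trans y2).
  rewrite (_ : e * r ^+ 2 / 2 = e * (r / 2 * r)); last by field.
  by rewrite ler_wpM2l ?(ltW e0)// ler_wpM2r ?ltW.
Qed.

(** Points [S T^m1 ... S T^mk z] for a reduced word, with all exponents except the
last one nonzero. *)
Inductive reduced z : R[i] -> Prop :=
| reduced_start m : reduced z (- (z + tr m)^-1)
| reduced_step y a : a != 0 -> reduced z y -> reduced z (- (y + tr a)^-1).

(** Applying the last power of [T] gives all reduced words of the group. *)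
Definition normal_form z y :=
  (exists m, y = z + tr m) \/ exists m y', reduced z y' /\ y = y' + tr m.

Lemma normal_form_T z m y : normal_form z y -> normal_form z (y + tr m).
Proof.
case=> [[m' ->]|[m' [y' [ry ->]]]]; [left|right].
  by exists (m' + m); rewrite trD addrA.
by exists (m' + m), y'; rewrite trD addrA.
Qed.

Lemma normal_form_S z y : normal_form z y -> normal_form z (- y^-1).
Proof.
case=> [[m ->]|[m [y' [ry ->]]]].
  by right; exists 0, (- (z + tr m)^-1); rewrite tr0 addr0; split=> //; constructor.
have [->|m0] := eqVneq m 0; last first.
  right; exists 0, (- (y' + tr m)^-1); rewrite tr0 addr0; split=> //.
  by constructor.
rewrite tr0 addr0.
case: ry => [m'|y'' a a0 ry]; rewrite opp_invK; [left|right].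
  by exists m'.
by exists a, y''.
Qed.

Lemma orbit_normal_form z y : 0 < complex.Im z ->
  hecke_orbit w z (Some y) -> normal_form z y.
Proof.
move=> z0; move: y; apply: orbit_ind => //.
- move=> y _; split; first exact: normal_form_S.
  by move=> /normal_form_S; rewrite opp_invK.
- move=> y _; have -> : w%:C = tr 1 by rewrite mulr1.
  split; first exact: normal_form_T.
  by move=> /(normal_form_T (-1)); rewrite trN addrK.
- by left; exists 0; rewrite tr0 addr0.
Qed.

(** Ping-pong: if [z] and its translates stay away from 0, one application of [S]
leads to a bounded set, and a nonzero translation followed by [S] leads from there
into a small disc around 0, where all longer words remain. *)
Lemma reduced_modulus z y : (forall m, 3 / 8 <= modulus (z + tr m)) ->
  reduced z y -> (exists m, y = - (z + tr m)^-1) \/ modulus y <= 1 / 4.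
Proof.
move=> zm; have start m : modulus (- (z + tr m)^-1) <= 8 / 3.
  rewrite modulusN modulusV (_ : 8 / 3 = (3 / 8)^-1); last by field.
  have h := zm m; rewrite lef_pV2 ?posrE//; lra.
elim=> [m | y' a a0 ry IH]; first by left; exists m.
right; have y3 : modulus y' <= 8 / 3.
  by case: IH => [[m ->] // | h]; apply: (le_trans h); lra.
have h : 4 <= modulus (y' + tr a).
  have := modulusB (y' + tr a) y'; rewrite addrC addKr.
  have := modulus_tr a0; rewrite addrC; lra.
rewrite modulusN modulusV (_ : 1 / 4 = 4^-1); last by field.
by rewrite lef_pV2 ?posrE//; lra.
Qed.

(** Suppose that [xi] is far from all [w * m]. The orbit of a point [z1] close to [xi]
comes near [xi] only by words with at most one letter [S], because longer words end
close to some [w * m]; and these words are determined by [xi]. So there are at most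
two orbit points near [xi], whereas three are found at decreasing distances. *)
Lemma clusters_near_cusp z xi : 0 < complex.Im z ->
  clusters (hecke_orbit w z) xi -> exists m, modulus (xi - tr m) <= 1 / 2.
Proof.
move=> z0 H; apply: contrapT => /forallNP far.
have {}far m : 1 / 2 < modulus (xi - tr m) by rewrite ltNge; apply/negP/far.
(* Within [1 / 8] of [xi], points keep the distance [3 / 8] from every [w * m]. *)
have [z1 [ oz1 n1 d1]] := H (1 / 8) (ltac:(lra)).
have z1xi : 0 < modulus (z1 - xi) by rewrite modulus_gt0 subr_eq0.
have [z2 [ oz2 n2 d2]] := H _ z1xi.
have z2xi : 0 < modulus (z2 - xi) by rewrite modulus_gt0 subr_eq0.
have [z3 [ oz3 n3 d3]] := H _ z2xi.
have z10 := orbit_Im z0 oz1.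
have zm m : 3 / 8 <= modulus (z1 + tr m).
  have := modulus_triangle z1 xi (tr (- m)); rewrite [modulus (xi - z1)]modulus_sym trN opprK.
  have := far (- m); rewrite trN opprK; lra.
have key y : hecke_orbit w z (Some y) -> modulus (y - xi) < modulus (z1 - xi) ->
    exists m m', [/\ y = - (z1 + tr m')^-1 + tr m & modulus (z1 + tr m') <= 8 / 3].
  move=> oy dy.
  have := orbit_normal_form z10 (orbit_trans z0 oz1 oy).
  case=> [[m ym] | [m [y' [ry ym]]]].
    have [m0|m0] := eqVneq m 0.
      by move: dy; rewrite ym m0 tr0 addr0 ltxx.
    have := modulus_tr m0; have := modulus_triangle xi y z1.
    rewrite ym addrC addKr [modulus (xi - _)]modulus_sym -ym; lra.
  have h := far m.
  have hy : 3 / 8 <= modulus y'.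
    have -> : y' = y - tr m by rewrite ym addrK.
    have := modulus_triangle y xi (tr m); rewrite [modulus (xi - y)]modulus_sym; lra.
  have [[m' ym']|] := reduced_modulus zm ry; last lra.
  exists m, m'; split; first by rewrite ym ym'.
  move: hy; rewrite ym' modulusN modulusV.
  have p := zm m'; rewrite -[3 / 8]invrK lef_pV2 ?posrE; lra.
have [m2 [m2' [e2 b2]]] := key _ oz2 d2.
have [m3 [m3' [e3 b3]]] := key _ oz3 (lt_trans d3 d2).
have em' : m2' = m3'.
  apply/eqP; rewrite -subr_eq0; apply: contraT => /modulus_tr.
  have -> : tr (m2' - m3') = (z1 + tr m2') - (z1 + tr m3').
    by rewrite trD trN opprD addrACA subrr add0r.
  have := modulusB (z1 + tr m2') (z1 + tr m3'); lra.
have em : m2 = m3.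
  apply/eqP; rewrite -subr_eq0; apply: contraT => /modulus_tr.
  have -> : tr (m2 - m3) = z2 - z3.
    by rewrite e2 e3 em' trD trN opprD addrACA subrr add0r.
  have := modulus_triangle xi z2 z3; rewrite [modulus (xi - _)]modulus_sym; lra.
by move: d3; rewrite e3 -em -em' -e2 ltxx.
Qed.

Lemma clusters_step z xi : 0 < complex.Im z ->
  clusters (hecke_orbit w z) xi -> modulus xi <= 1 / 2 -> xi != 0 ->
  exists a xi1, [/\ a != 0, clusters (hecke_orbit w z) xi1,
    modulus xi1 <= 1 / 2 & xi = branch w%:C a xi1].
Proof.
move=> z0 H xi2 xi0.
have HS := clusters_S z0 xi0 H.
have [m hm] := clusters_near_cusp z0 HS.
exists m, (- xi^-1 - tr m); split => //.
- apply/eqP => m0; move: hm; rewrite m0 tr0 subr0 modulusN modulusV.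
  have h0 : 0 < modulus xi by rewrite modulus_gt0.
  rewrite -[1 / 2]invrK lef_pV2 ?posrE//; lra.
- by rewrite -trN; exact: clusters_T.
- rewrite /branch -(rmorph_int (@real_complex R)) -rmorphM addrC subrK.
  by rewrite opp_invK.
Qed.

(** The expansion of a limit point, which stops if it reaches the cusp 0, the image
of infinity. *)
Lemma clusters_words z xi n : 0 < complex.Im z ->
  clusters (hecke_orbit w z) xi -> modulus xi <= 1 / 2 ->
  exists v xi1, [/\ letters v, modulus xi1 <= 1 / 2,
    clusters (hecke_orbit w z) xi1, xi = branches w%:C v xi1 &
    size v = n \/ (size v < n)%N /\ xi1 = 0].
Proof.
move=> z0 H xi2; elim: n => [|n [v [xi1 [lv x1 H1 e sz]]]].
  by exists [::], xi; split => //; left.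
have [x10|x10] := eqVneq xi1 0.
  exists v, xi1; split => //; right; split=> //.
  by case: sz => [->|[/ltnW]].
case: sz => [sz|[_ x0]]; last by rewrite x0 eqxx in x10.
have [a [xi' [a0 H' x' e']]] := clusters_step z0 H1 x1 x10.
exists (rcons v a), xi'; split => //.
- by rewrite /letters all_rcons a0.
- by rewrite branches_rcons -e'.
- by left; rewrite size_rcons sz.
Qed.

(** Compositions of branches are real and contract, so they shrink imaginary parts to 0. *)
Lemma clusters_real z xi : 0 < complex.Im z ->
  clusters (hecke_orbit w z) xi -> modulus xi <= 1 / 2 -> complex.Im xi = 0.
Proof.
move=> z0 H xi2; apply/eqP; rewrite -normr_eq0; apply/negP => /negP im0.
have i0 : 0 < `|complex.Im xi| by rewrite lt_neqAle normr_ge0 eq_sym im0.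
have [n /(_ n (leqnn n))] :=
  @geometric_small R (1 / 2) 1 `|complex.Im xi| ltac:(lra) ltac:(lra) i0.
rewrite mul1r ltNge => /negP; apply.
have [v [xi1 [lv x1 H1 e sz]]] := clusters_words n z0 H xi2.
have m1 : modulus (complex.Re xi1)%:C <= 1 / 2.
  apply: le_trans x1; rewrite modulus_real.
  case: (xi1) => p q /=; rewrite -sqrtr_sqr; apply: ler_wsqrtr.
  by rewrite lerDl sqr_ge0.
have E : complex.Im xi = complex.Im (branches w%:C v xi1 - branches w%:C v (complex.Re xi1)%:C).
  by rewrite branches_real e; case: (branches w%:C v xi1) => p q /=; rewrite subr0.
case: sz => [sz|[_ x0]].
  rewrite E; apply: (le_trans (Im_le_modulus _)).
  apply: (le_trans (complex_branches_contract w4 lv _ _)); try lra.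
  rewrite sz ler_piMr ?exprn_ge0//.
  by apply: (le_trans (modulusB _ _)); lra.
by rewrite E x0 subrr normr0 exprn_ge0.
Qed.

Lemma clusters_radius z xi : 0 < complex.Im z ->
  clusters (hecke_orbit w z) xi -> modulus xi <= 1 / 2 -> modulus xi <= 2 / w.
Proof.
move=> z0 H xi2; have wp : 0 < w by apply: lt_le_trans w7; lra.
have [->|xi0] := eqVneq xi 0.
  by rewrite ComplexField.Normc.normc0 divr_ge0.
have [a [xi' [a0 H' x' ->]]] := clusters_step z0 H xi2 xi0.
rewrite modulusN modulusV.
have h : w / 2 <= modulus (w%:C * a%:~R + xi').
  have := modulusB (w%:C * a%:~R + xi') xi'; rewrite addrK modulus_letter.
  have : w <= `|w * a%:~R|.
    by rewrite normrM (ger0_norm w0) ler_peMr// norm_letter_ge1.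
  by move: w7; lra.
rewrite -[2 / w]invf_div lef_pV2 ?posrE ?divr_gt0//.
by apply: lt_le_trans h; rewrite divr_gt0.
Qed.

(** The depth of the expansion may depend on the translation [m], so that the
infinitely many translates can be covered with a summable total. Expansions which
stop earlier do so at 0. *)
Lemma limit_set_words (n : int -> nat) x : limit_set w x -> x <> None ->
  exists m v (y : R), [/\ letters v, `|y| <= 2 / w,
    x = Some (w * m%:~R + branches w v y)%:C &
    size v = n m \/ (size v < n m)%N /\ y = 0].
Proof.
move=> [z z0 Hx]; case: x Hx => // xi /limit_point_finite H _.
have [m hm] := clusters_near_cusp z0 H.
have H' : clusters (hecke_orbit w z) (xi - tr m).
  by rewrite -trN; exact: clusters_T.
have [v [xi1 [lv x1 H1 e sz]]] := clusters_words (n m) z0 H' hm.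
have r1 := clusters_radius z0 H1 x1.
have i1 := clusters_real z0 H1 x1.
have e1 : xi1 = (complex.Re xi1)%:C by case: (xi1) i1 => p q /= ->.
exists m, v, (complex.Re xi1); split => //.
- by rewrite -modulus_real -e1.
- by rewrite rmorphD /= -branches_real -e1 -e addrC subrK.
- by case: sz => [|[? x0]]; [left|right; rewrite x0].
Qed.

End limit_set_structure.

(** * The upper bound for the dimension *)

Definition alphabet (M : nat) : seq int :=
  [seq Posz k.+1 | k <- iota 0 M] ++ [seq Negz k | k <- iota 0 M].

Lemma mem_alphabet M a : (a \in alphabet M) = (a != 0) && (absz a <= M)%N.
Proof.
rewrite mem_cat; case: a => k.
  rewrite [X in _ || X](_ : _ = false) ?orbF; last by apply/mapP => -[].
  apply/mapP/andP => [[j]|[k0 kM]].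
    by rewrite mem_iota add0n => /andP[_ jM] [->].
  exists k.-1; last by congr Posz; case: k k0 kM.
  by rewrite mem_iota add0n; move: k0 kM; case: k.
rewrite [X in X || _](_ : _ = false) ?orFb; last by apply/mapP => -[].
by rewrite (mem_map _) ?mem_iota// => p q [].
Qed.

Lemma letters_alphabet M : letters (alphabet M).
Proof. by apply/allP => a; rewrite mem_alphabet => /andP[]. Qed.

Lemma uniq_alphabet M : uniq (alphabet M).
Proof.
rewrite cat_uniq !map_inj_uniq ?iota_uniq ?andbT /=.
- by apply/hasPn => _ /mapP[k _ ->]; apply/mapP => -[].
- by move=> p q [].
- by move=> p q [].
Qed.

Lemma big_alphabet (R : realType) M (f : int -> R) :
  \sum_(a <- alphabet M) f a = \sum_(k < M) (f k.+1%:Z + f (- k.+1%:Z)).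
Proof.
rewrite big_cat !big_map big_split /= -{1 2}[M]subn0 -/(index_iota 0 M) !big_mkord.
by congr (_ + _); apply: eq_bigr => k _; rewrite NegzE.
Qed.

Lemma nneseries_pickle_le (R : realType) (I : countType) (g : I -> R) (T : R) :
  (forall i, 0 <= g i) -> (forall l : seq I, uniq l -> \sum_(i <- l) g i <= T) ->
  (\sum_(0 <= k <oo) (oapp g 0 (@pickle_inv I k))%:E <= T%:E)%E.
Proof.
move=> g0 gT; have h0 k : 0 <= oapp g 0 (@pickle_inv I k) by case: pickle_inv.
apply: lime_le; first by apply: is_cvg_nneseries => *; rewrite lee_fin.
apply: nearW => n; rewrite sumEFin lee_fin.
rewrite (_ : \sum_(_ <= _ < _) _ = \sum_(i <- pmap (@pickle_inv I) (iota 0 n)) g i).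
  by apply: gT; apply: pmap_uniq (iota_uniq _ _); exact: pickle_invK.
rewrite /index_iota subn0; elim: (iota 0 n) => [|k s IH]; first by rewrite !big_nil.
by rewrite big_cons /= IH; case: (@pickle_inv I k) => [i|] /=; rewrite ?big_cons ?add0r.
Qed.

Lemma ler_word_sum_single (R : realType) (A : seq int) v (G : seq int -> R) :
  over A v -> (forall u, 0 <= G u) ->
  G v <= word_sum A (size v) (fun u => (u == v)%:R * G u).
Proof.
elim: v G => [|a v IH] G /=; first by rewrite mul1r.
move=> /andP[aA vA] G0.
have ge0 b : 0 <= word_sum A (size v) (fun u => (b :: u == a :: v)%:R * G (b :: u)).
  by rewrite -(word_sum0 R A (size v)); apply: ler_word_sum => u _ _; rewrite mulr_ge0.
rewrite (big_rem a)//= -[leLHS]addr0 lerD ?sumr_ge0//.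
apply: (le_trans (IH (fun u => G (a :: u)) vA (fun=> G0 _))).
by apply: ler_word_sum => u _ _; rewrite eqseq_cons eqxx.
Qed.

Section upper_bound.
Variables (R : realType) (w s theta : R).
Hypotheses (w7 : 7 <= w) (s0 : 0 < s) (theta0 : 0 <= theta) (theta1 : theta < 1).
Implicit Types (x y : R) (v : seq int) (A : seq int).

Let r := 2 / w.

Hypothesis contraction : forall M x y, `|x| <= r -> `|y| <= r ->
  \sum_(a <- alphabet M) (`|w * a%:~R + x| * `|w * a%:~R + y|) `^ (- s) <= theta.

Let w4 : 4 <= w. Proof. by apply: le_trans w7; lra. Qed.
Let w0 : 0 < w. Proof. by apply: lt_le_trans w7; lra. Qed.

Let r0 : 0 <= r. Proof. by rewrite divr_ge0// ltW. Qed.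

Let r1 : r <= 1.
Proof. by rewrite ler_pdivrMr// mul1r; apply: le_trans w7; lra. Qed.

Let le1 x : `|x| <= r -> `|x| <= 1. Proof. by move=> /le_trans; apply. Qed.

Lemma norm_branch_le_radius a x : a != 0 -> `|x| <= r -> `|branch w a x| <= r.
Proof.
move=> a0 xr; rewrite normrN normfV.
have h : w / 2 <= `|w * a%:~R + x|.
  have := ler_normB (w * a%:~R + x) x; rewrite addrK.
  have : w <= `|w * a%:~R|.
    by rewrite normrM (gtr0_norm w0) ler_peMr ?norm_letter_ge1// ltW.
  have := le1 xr; by move: w7; lra.
rewrite /r -[2 / w]invf_div lef_pV2 ?posrE ?divr_gt0//.
by apply: lt_le_trans h; rewrite divr_gt0.
Qed.

(** The outermost letters are summed first, by induction, at the images of [x] and [y]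
under the innermost letter; what remains is one sum over the innermost letter,
which the hypothesis bounds. *)
Lemma word_sum_diff M n x y : `|x| <= r -> `|y| <= r ->
  word_sum (alphabet M) n (fun v => `|branches w v x - branches w v y| `^ s)
  <= theta ^+ n * `|x - y| `^ s.
Proof.
elim: n x y => [|n IH] x y xr yr; first by rewrite /= expr0 mul1r.
rewrite word_sum_rcons.
apply: (@le_trans _ _ (\sum_(a <- alphabet M)
   theta ^+ n * (`|x - y| `^ s * (`|w * a%:~R + x| * `|w * a%:~R + y|) `^ (- s)))).
  rewrite big_seq [leRHS]big_seq; apply: ler_sum => a; rewrite mem_alphabet => /andP[a0 _].
  have h := IH _ _ (norm_branch_le_radius a0 xr) (norm_branch_le_radius a0 yr).
  under eq_word_sum do rewrite !branches_rcons.
  apply: (le_trans h); rewrite ler_wpM2l ?exprn_ge0//.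
  rewrite branch_diff ?(real_denom_neq0 w4)// ?le1//.
  rewrite normrM normfV normrM powRM ?invr_ge0 ?mulr_ge0//.
  by rewrite -(powR_inv1 (mulr_ge0 (normr_ge0 _) (normr_ge0 _))) -powRrM mulN1r.
rewrite -mulr_sumr -mulr_sumr.
have -> : theta ^+ n.+1 * `|x - y| `^ s = theta ^+ n * (`|x - y| `^ s * theta).
  by rewrite exprS; ring.
rewrite ler_wpM2l ?exprn_ge0// ler_wpM2l ?powR_ge0//.
exact: contraction.
Qed.

Lemma branches_mono v x y : letters v -> `|x| <= 1 -> `|y| <= 1 -> x <= y ->
  branches w v x <= branches w v y.
Proof.
move=> lv x1 y1 xy; have := branches_diff w4 lv y1 x1.
have [c [d [d1 cd E]]] := denom_affine w4 lv.
rewrite !E// -subr_ge0 => h.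
have d0 : 0 < `|d| by apply: lt_le_trans d1; rewrite exprn_gt0.
have pos : 0 < (c * y + d) * (c * x + d).
  have cx : `|c * x| <= `|d| / 2.
    by rewrite normrM; apply: le_trans cd; rewrite ler_piMr.
  have cy : `|c * y| <= `|d| / 2.
    by rewrite normrM; apply: le_trans cd; rewrite ler_piMr.
  move: cx cy d0; rewrite !ler_norml => /andP[p1 p2] /andP[p3 p4].
  have [dp|dn] := lerP 0 d.
    move: p1 p2 p3 p4; rewrite (ger0_norm dp) => p1 p2 p3 p4 d0; nra.
  move: p1 p2 p3 p4; rewrite (ltr0_norm dn) => p1 p2 p3 p4 d0; nra.
by rewrite -(pmulr_lge0 _ pos) h subr_ge0.
Qed.

(** Compositions of branches are increasing, so the ends of the interval are mapped farthest apart. *)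
Lemma branches_diff_le v x y : letters v -> `|x| <= r -> `|y| <= r ->
  `|branches w v x - branches w v y| <= `|branches w v r - branches w v (- r)|.
Proof.
move=> lv xr yr; have nr : `|r| <= 1 by rewrite ger0_norm.
have nr' : `|- r| <= 1 by rewrite normrN.
have bnd z : `|z| <= r -> branches w v (- r) <= branches w v z <= branches w v r.
  move=> zr; have z1 := le1 zr; move: zr; rewrite ler_norml => /andP[z2 z3].
  by rewrite !branches_mono.
have /andP[a1 a2] := bnd _ xr; have /andP[b1 b2] := bnd _ yr.
by rewrite [leRHS]ger0_norm ?subr_ge0 ?(le_trans a1)// ler_norml; apply/andP; split; lra.
Qed.

Let width v : R := `|branches w v r - branches w v (- r)|.

Let index : countType := option (int * seq int)%type.

Let piece (n : int -> nat) (i : index) : set (riemann_sphere R) :=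
  match i with
  | None => [set None]
  | Some (m, v) =>
      [set Some (w * m%:~R + branches w v y)%:C | y in
        [set y | [/\ `|y| <= r, letters v &
          size v = n m \/ (size v < n m)%N /\ y = 0]]]
  end.

Let mass (n : int -> nat) (i : index) : R :=
  if i is Some (m, v) then
    ((size v == n m) && letters v)%:R * (2 * width v) `^ s
  else 0.

Lemma piece_cover n : limit_set w `<=` \bigcup_i piece n i.
Proof.
move=> x Lx; have [->|/eqP xN] := eqVneq x None; first by exists None.
have [m [v [y [lv yr -> sz]]]] := limit_set_words w7 n Lx xN.
by exists (Some (m, v)) => //; exists y.
Qed.

Lemma chordal_translate (t x y : R) :
  chordal_dist (Some (t + x)%:C) (Some (t + y)%:C) <= 2 * `|x - y|.
Proof.
apply: (le_trans (chordal_le _ _)).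
rewrite (_ : (t + x)%:C - (t + y)%:C = (x - y)%:C) ?modulus_real//.
by rewrite -rmorphB; congr (_%:C); ring.
Qed.

(** Pieces of words shorter than the prescribed depth are single points, of
diameter 0. *)
Lemma diam_piece n i : (diam (piece n i) <=
  (if i is Some (m, v) then ((size v == n m) && letters v)%:R * (2 * width v) else 0)%:E)%E.
Proof.
case: i => [[m v]|] /=; last first.
  by apply: diam_le => // _ _ -> ->; exact: lexx.
have W0 : 0 <= width v by exact: normr_ge0.
have [/andP[/eqP sz lv]|nsz] := boolP (_ && _); rewrite ?mul1r ?mul0r.
  apply: diam_le; first by rewrite mulr_ge0.
  move=> _ _ [x [xr _ _] <-] [y [yr _ _] <-].
  apply: (le_trans (chordal_translate _ _ _)).
  by rewrite ler_wpM2l// branches_diff_le.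
apply: diam_le => // _ _ [x [_ lv1 hx] <-] [y [_ lv2 hy] <-].
have bad : size v <> n m by move=> h; move: nsz; rewrite h eqxx lv1.
case: hx => [//|[_ ->]]; case: hy => [//|[_ ->]].
by apply: (le_trans (chordal_translate _ _ _)); rewrite subrr normr0 mulr0.
Qed.

Lemma diam_piece_powR n i : (diam (piece n i) `^ s <= (mass n i)%:E)%E.
Proof.
have h := diam_piece n i.
apply: (le_trans (gt0_ler_poweR (ltW s0) _ _ h)).
- by rewrite in_itv /= diam_ge0 leey.
- rewrite in_itv /= leey andbT lee_fin; case: i {h} => [[m v]|] //.
  by rewrite !mulr_ge0// normr_ge0.
rewrite poweR_EFin lee_fin; case: i {h} => [[m v]|] /=; last by rewrite powR0// gt_eqF.
case: (_ && _); rewrite ?mul1r ?mul0r// powR0// gt_eqF//.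
Qed.

Lemma mass_ge0 n i : 0 <= mass n i.
Proof. by case: i => [[m v]|] //=; rewrite mulr_ge0// powR_ge0. Qed.

(** The depth [N + |m|] grows with the translation, so that the infinitely many
translates contribute a convergent geometric series. *)
Lemma sum_mass N (l : seq index) : uniq l ->
  \sum_(i <- l) mass (fun m => N + absz m)%N i <=
  theta ^+ N * ((4 * r) `^ s * (2 / (1 - theta))).
Proof.
move=> ul; set n := (fun m : int => _).
pose size_of (i : index) : nat :=
  if i is Some (m, v) then (absz m + \sum_(a <- v) absz a)%N else 0.
(* [M] bounds the translations and letters that occur in [l], so that finitely
many letters suffice. *)
pose M := \max_(i <- l) size_of i.
pose A := alphabet M.
pose F v := (2 * width v) `^ s.
have F0 v : 0 <= F v by exact: powR_ge0.
apply: (@le_trans _ _ (\sum_(m <- 0 :: A) word_sum A (n m) F)).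
  apply: (@le_trans _ _ (\sum_(i <- l) \sum_(m <- 0 :: A)
      word_sum A (n m) (fun u => (Some (m, u) == i)%:R * F u))).
    rewrite big_seq [leRHS]big_seq; apply: ler_sum => i il.
    have ge0 m : 0 <= word_sum A (n m) (fun u => (Some (m, u) == i)%:R * F u).
      by rewrite -(word_sum0 R A (n m)); apply: ler_word_sum => u _ _; rewrite mulr_ge0.
    have si : (size_of i <= M)%N by exact: leq_bigmax_seq.
    case: i il si ge0 => [[m v]|] il si ge0; last by rewrite sumr_ge0.
    rewrite /mass; have [/andP[/eqP sz lv]|_] := boolP (_ && _); last first.
      by rewrite mul0r sumr_ge0.
    rewrite mul1r.
    have mA : m \in 0 :: A.
      rewrite inE mem_alphabet; case: eqP => //= _.
      by apply: leq_trans si; rewrite leq_addr.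
    have vA : over A v.
      apply/allP => a av; rewrite /= mem_alphabet (allP lv)//=.
      apply: leq_trans si; rewrite /size_of (big_rem a)//=.
      by rewrite addnCA leq_addr.
    rewrite (big_rem m)//= -[leLHS]addr0 lerD ?sumr_ge0//.
    rewrite -sz; apply: (le_trans (ler_word_sum_single vA F0)).
    apply: ler_word_sum => u _ _; rewrite ler_wpM2r// ler_nat.
    by case: eqP => // ->; rewrite eqxx.
  rewrite exchange_big /=; apply: ler_sum => m _.
  rewrite -word_sum_sum; apply: ler_word_sum => u _ _.
  rewrite -mulr_suml ler_piMl// -natr_sum lern1.
  rewrite (eq_bigr (fun i => if i == Some (m, u) then 1 else 0)%N); last first.
    by move=> i _; rewrite eq_sym; case: eqP.
  by rewrite -big_mkcond sum1_count count_uniq_mem// leq_b1.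
have WF m : word_sum A (n m) F <= theta ^+ N * (4 * r) `^ s * theta ^+ absz m.
  rewrite (eq_word_sum (H := fun v => 2 `^ s * width v `^ s)); last first.
    by move=> u _ _; rewrite /F powRM ?normr_ge0.
  rewrite word_sumZ.
  have rr : `|r| <= r by rewrite ger0_norm.
  have rr' : `|- r| <= r by rewrite normrN.
  have := word_sum_diff M (n m) rr rr'.
  rewrite opprK [`|r + r|]ger0_norm ?addr_ge0// => h.
  apply: (@le_trans _ _ (2 `^ s * (theta ^+ n m * (r + r) `^ s))).
    by rewrite ler_wpM2l ?powR_ge0.
  rewrite /n exprD (_ : 4 * r = 2 * (r + r)); last by ring.
  by rewrite powRM ?addr_ge0// le_eqVlt; apply/orP; left; apply/eqP; ring.
apply: (@le_trans _ _ (\sum_(m <- 0 :: A) theta ^+ N * (4 * r) `^ s * theta ^+ absz m)).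
  by apply: ler_sum => m _; exact: WF.
rewrite -mulr_sumr -mulrA ler_wpM2l ?exprn_ge0// ler_wpM2l ?powR_ge0//.
rewrite big_cons big_alphabet expr0.
have geo K : \sum_(k < K) theta ^+ k <= 1 / (1 - theta).
  have t1 : 1 - theta != 0 by rewrite subr_eq0 gt_eqF.
  have -> : \sum_(k < K) theta ^+ k = (1 - theta ^+ K) / (1 - theta).
    elim: K => [|K IH]; first by rewrite big_ord0 subrr mul0r.
    by rewrite big_ord_recr /= IH exprS; field.
  by rewrite ler_wpM2r ?invr_ge0 ?subr_ge0 ?(ltW theta1)// gerBl exprn_ge0.
have g1 : 1 + \sum_(k < M) theta ^+ k.+1 <= 1 / (1 - theta).
  by have := geo M.+1; rewrite big_ord_recl expr0.
have g2 : \sum_(k < M) theta ^+ k.+1 <= 1 / (1 - theta).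
  by apply: le_trans g1; rewrite lerDr.
rewrite big_split /= (_ : 2 / (1 - theta) = 1 / (1 - theta) + 1 / (1 - theta)); last by ring.
by rewrite addrA lerD.
Qed.

(** The pieces of depth [N + |m|] form a cover of the limit set whose sum tends to 0
with [N]. *)
Lemma hausdorff_measure_eq0 : hausdorff_measure s (limit_set w) = 0%E.
Proof.
have pre0 e : 0 < e -> hausdorff_premeasure e s (limit_set w) = 0%E.
  move=> e0; apply/eqP; rewrite eq_le; apply/andP; split; last first.
    apply: le_ereal_inf_tmp => _ [U _ <-].
    by apply: nneseries_ge0 => *; exact: poweR_ge0.
  apply/lee_addgt0Pr => t t0; rewrite add0e.
  pose B := (4 * r) `^ s * (2 / (1 - theta)).
  have [N [N1 N2]] : exists N, theta ^+ N * B <= t /\ 4 * (1 / 2) ^+ N <= e.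
    have [N1 H1] := @geometric_small R (1 / 2) 4 e ltac:(lra) ltac:(lra) e0.
    have [N2 H2] := geometric_small B theta0 theta1 t0.
    exists (maxn N1 N2); split; last exact/ltW/H1/leq_maxl.
    by rewrite mulrC; exact/ltW/H2/leq_maxr.
  pose n (m : int) := (N + absz m)%N.
  pose U k := oapp (piece n) set0 (@pickle_inv index k).
  apply: (@le_trans _ _ (\sum_(0 <= k <oo) diam (U k) `^ s)%E).
    apply: ereal_inf_lbound; exists U => //; split.
      move=> x /(piece_cover n)[i _ pi]; exists (pickle i) => //.
      by rewrite /U pickleK_inv.
    move=> k; rewrite /U; case: (@pickle_inv index k) => [i|] /=; last first.
      by apply: diam_le; [exact: ltW|].
    apply: (le_trans (diam_piece n i)); rewrite lee_fin.
    case: i => [[m v]|]; last exact: ltW.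
    have [/andP[/eqP sz lv]|_] := boolP (_ && _); rewrite ?mul1r ?mul0r ?(ltW e0)//.
    apply: le_trans N2.
    have nr : `|r| <= 1 by rewrite ger0_norm.
    have nr' : `|- r| <= 1 by rewrite normrN.
    have := real_branches_contract w4 lv nr nr'.
    rewrite sz opprK [`|r + r|]ger0_norm ?addr_ge0// => h.
    have h2 : (1 / 2 : R) ^+ n m <= (1 / 2) ^+ N.
      by rewrite /n exprD ler_piMr ?exprn_ge0//; rewrite exprn_ile1//; lra.
    have h3 : 0 <= (1 / 2 : R) ^+ n m by rewrite exprn_ge0//; lra.
    by rewrite /width; move: h h2 h3 r1 r0; nra.
  apply: (@le_trans _ _ (\sum_(0 <= k <oo) (oapp (mass n) 0 (@pickle_inv index k))%:E)%E).
    apply: lee_nneseries => [k *|k *]; first exact: poweR_ge0.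
    rewrite /U; case: (@pickle_inv index k) => [i|] /=; first exact: diam_piece_powR.
    have -> : diam (set0 : set (riemann_sphere R)) = 0%E.
      by apply/eqP; rewrite eq_le diam_ge0 andbT; apply: diam_le.
    by rewrite poweR0r// gt_eqF.
  apply: (nneseries_pickle_le (mass_ge0 n)) => l ul.
  by apply: le_trans N1; exact: sum_mass.
apply/eqP; rewrite eq_le; apply/andP; split.
  by apply: ge_ereal_sup => _ [e e0 <-]; rewrite pre0.
by rewrite -(pre0 1 ltr01); apply: ereal_sup_ubound; exists 1 => //=.
Qed.

End upper_bound.

(** * Estimating the sums over letters by the zeta function *)

Section letter_sum_estimates.
Variables (R : realType) (w : R).
Implicit Types (s x y t e : R) (M : nat).

Lemma mean_ge (p q m : R) : 0 <= p -> 0 <= q -> 0 <= m -> m ^+ 2 <= p * q ->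
  2 * m <= p + q.
Proof.
move=> p0 q0 m0 h; have : (2 * m) ^+ 2 <= (p + q) ^+ 2.
  have -> : (p + q) ^+ 2 = 4 * (p * q) + (p - q) ^+ 2 by ring.
  have -> : (2 * m) ^+ 2 = 4 * m ^+ 2 by ring.
  by rewrite -[leLHS]addr0 lerD ?sqr_ge0// ler_wpM2l.
by rewrite ler_pXn2r// nnegrE ?addr_ge0// mulr_ge0.
Qed.

(** Bernoulli's inequality for an exponent between 0 and 1. *)
Lemma powR_le_affine b e : 0 < b -> 0 <= e -> e <= 1 -> b `^ e <= 1 + e * (b - 1).
Proof.
move=> b0 e0 e1; rewrite /powR gt_eqF//; set y := ln b.
have -> : b = expR y by rewrite /y lnK.
have h1 := expR_ge1Dx ((1 - e) * y).
have h2 := expR_ge1Dx (- (e * y)).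
have E : expR y = expR (e * y) * expR ((1 - e) * y).
  by rewrite -expRD; congr expR; ring.
have I : expR (e * y) * expR (- (e * y)) = 1 by rewrite expRxMexpNx_1.
have p0 := expR_gt0 (e * y).
have key : 1 <= e * expR ((1 - e) * y) + (1 - e) * expR (- (e * y)).
  have k1 : e * (1 + (1 - e) * y) <= e * expR ((1 - e) * y) by rewrite ler_wpM2l.
  have k2 : (1 - e) * (1 + - (e * y)) <= (1 - e) * expR (- (e * y)).
    by rewrite ler_wpM2l// subr_ge0.
  by apply: le_trans (lerD k1 k2); rewrite le_eqVlt; apply/orP; left; apply/eqP; ring.
rewrite E; have := ler_wpM2l (ltW p0) key; rewrite mulr1 => h; apply: (le_trans h).
rewrite le_eqVlt; apply/orP; left; apply/eqP.
transitivity (e * (expR (e * y) * expR ((1 - e) * y)) + (1 - e) * (expR (e * y) * expR (- (e * y)))).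
  by ring.
by rewrite I; ring.
Qed.

(** The letters [a] and [- a] are added together so that the terms of first order
cancel; multiplying by [1 - t ^+ 2] brings the exponents into the range of
Bernoulli's inequality. *)
Lemma powR_sym_le t e : 0 <= e -> e <= 1 -> `|t| <= 1 / 2 ->
  (1 + t) `^ (- (1 + e)) + (1 - t) `^ (- (1 + e)) <= 2 + 12 * t ^+ 2.
Proof.
move=> e0 e1; rewrite ler_norml => /andP[t1 t2].
have p0 : 0 < 1 + t by lra.
have q0 : 0 < 1 - t by lra.
have pq0 : 0 < 1 - t ^+ 2 by nra.
have pqE : (1 + t) * (1 - t) = 1 - t ^+ 2 by ring.
have split1 a b : 0 < a -> 0 < b -> a `^ (- (1 + e)) = b `^ (1 + e) * (a * b) `^ (- (1 + e)).
  move=> a0 b0; rewrite powRM ?(ltW a0) ?(ltW b0)// mulrCA -powRD; last first.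
    by apply/implyP => _; rewrite gt_eqF.
  by rewrite subrr powRr0 mulr1.
rewrite (split1 _ _ p0 q0) (split1 _ _ q0 p0) [(1 - t) * (1 + t)]mulrC pqE -mulrDl.
have bern b : 0 < b -> b `^ (1 + e) <= b * (1 + e * (b - 1)).
  move=> b0; rewrite powRD; last by apply/implyP => _; rewrite gt_eqF.
  by rewrite (powRr1 (ltW b0)) ler_wpM2l ?(ltW b0)// powR_le_affine.
have h1 := bern _ q0; have h2 := bern _ p0.
have h3 : (1 - t) `^ (1 + e) + (1 + t) `^ (1 + e) <= 2 + 2 * t ^+ 2.
  apply: (le_trans (lerD h1 h2)); have := sqr_ge0 t; nra.
have h4 : (1 - t ^+ 2) `^ (- (1 + e)) <= 1 + 4 * t ^+ 2.
  apply: (@le_trans _ _ ((1 - t ^+ 2) `^ (- 2))).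
    by apply: ger_powR; [have := sqr_ge0 t; lra|lra].
  rewrite (powR_invn 2) ?(ltW pq0)//.
  rewrite -[leLHS]mul1r ler_pdivrMr ?exprn_gt0//.
  have : t ^+ 2 <= 1 / 4 by nra.
  have := sqr_ge0 t; move: (t ^+ 2) => q; nra.
apply: (le_trans (ler_pM _ (powR_ge0 _ _) h3 h4)).
  by rewrite addr_ge0 ?powR_ge0.
have : t ^+ 2 <= 1 / 4 by nra.
have := sqr_ge0 t; move: (t ^+ 2) => q; nra.
Qed.

Lemma ler_powRN s x y : 0 <= s -> 0 < x -> x <= y -> y `^ (- s) <= x `^ (- s).
Proof.
move=> s0 x0 xy; have y0 := lt_le_trans x0 xy.
by rewrite !powRN lef_pV2 ?posrE ?powR_gt0// le_powR2r// ltW.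
Qed.

(** By the arithmetic-geometric mean inequality for the letters [a] and [- a] the sum
is smallest at [x = 0]. *)
Lemma letter_sum_lower M s x : 4 <= w -> 0 < s -> `|x| <= 1 ->
  2 * \sum_(k < M) (w * k.+1%:R) `^ (- (2 * s)) <= letter_sum w s (alphabet M) x.
Proof.
move=> w4 s0 x1; rewrite /letter_sum big_alphabet mulr_sumr; apply: ler_sum => k _.
have w0 : 0 < w by apply: lt_le_trans w4; lra.
have k0 : 4 <= w * k.+1%:R.
  by apply: (le_trans w4); rewrite ler_peMr ?ler1n// ltW.
rewrite rmorphN /= mulrN; set u := w * k.+1%:R in k0 *.
move: x1; rewrite ler_norml => /andP[x1 x2].
have -> : `|u + x| = u + x by rewrite ger0_norm//; lra.
have -> : `|- u + x| = u - x by rewrite ler0_norm; lra.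
apply: mean_ge; rewrite ?powR_ge0//.
rewrite -powRM; [|lra|lra].
rewrite -powR_mulrn ?powR_ge0// -powRrM mulrC powRrM powR_mulrn; last lra.
apply: ler_powRN; first lra.
  by rewrite mulr_gt0//; lra.
by have := sqr_ge0 x; nra.
Qed.

(** On the interval of radius [2 / w] the sum exceeds its value at 0 by a relative
error [x ^+ 2 / (w * a) ^+ 2] for each letter. Its sum over the letters converges
and leaves a total of order [w ^- 5], instead of the [w ^- 4] that the largest
relative error would give. *)
Lemma letter_sum_upper M e x : 7 <= w -> 0 <= e -> e <= 1 -> `|x| <= 2 / w ->
  letter_sum w ((1 + e) / 2) (alphabet M) x <=
  2 * \sum_(k < M) (w * k.+1%:R) `^ (- (1 + e)) + 96 / w ^+ 5.
Proof.
move=> w7 e0 e1 xr.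
have w0 : 0 < w by apply: lt_le_trans w7; lra.
have e2 : 2 * ((1 + e) / 2) = 1 + e by field.
rewrite /letter_sum big_alphabet e2.
(* [48 = 12 * 2 ^+ 2], as the relative displacement [t] is at most [2 / w ^+ 2 / k]
for the [k]-th pair of letters. *)
pose q k : R := 48 / w ^+ 5 * (k.+1%:R ^+ 2)^-1.
have term k : `|w * k.+1%:Z%:~R + x| `^ (- (1 + e)) + `|w * (- k.+1%:Z)%:~R + x| `^ (- (1 + e))
    <= 2 * (w * k.+1%:R) `^ (- (1 + e)) + q k.
  have k1 : 1 <= k.+1%:R :> R by rewrite ler1n.
  rewrite rmorphN /= mulrN -!pmulrn /q; move: k.+1%:R k1 => p p1.
  have wp : w <= w * p by rewrite ler_peMr// ltW.
  have wp0 : 0 < w * p by apply: lt_le_trans wp.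
  pose t := x / (w * p).
  have xE : x = w * p * t by rewrite /t mulrC divfK// gt_eqF.
  have w2 : `|x| * w <= 2 by rewrite -ler_pdivlMr.
  have tb : `|t| <= 2 / w ^+ 2 / p.
    rewrite /t normrM normfV (gtr0_norm wp0) ler_pdivrMr//.
    rewrite (_ : 2 / w ^+ 2 / p * (w * p) = 2 / w)//; field.
    by rewrite !gt_eqF// (lt_le_trans ltr01).
  have t2 : `|t| <= 1 / 2.
    apply: (le_trans tb); rewrite ler_pdivrMr ?(lt_le_trans ltr01 p1)//.
    rewrite ler_pdivrMr ?exprn_gt0//; nra.
  have -> : `|w * p + x| = (w * p) * (1 + t).
    rewrite ger0_norm; first by rewrite mulrDr mulr1 -xE.
    by rewrite xE -[X in X + _]mulr1 -mulrDr mulr_ge0 ?(ltW wp0)//; move: t2; rewrite ler_norml => /andP[]; lra.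
  have -> : `|- (w * p) + x| = (w * p) * (1 - t).
    rewrite ler0_norm; first by rewrite mulrBr mulr1 -xE; ring.
    rewrite addrC subr_le0 xE -[leRHS]mulr1 ler_wpM2l ?(ltW wp0)//.
    by move: t2; rewrite ler_norml => /andP[]; lra.
  have ht : -(1/2) <= t <= 1 / 2 by rewrite -ler_norml.
  have /andP[ht1 ht2] := ht.
  rewrite [(w * p * (1 + t)) `^ _]powRM ?(ltW wp0)//; last lra.
  rewrite [(w * p * (1 - t)) `^ _]powRM ?(ltW wp0)//; last lra.
  rewrite -mulrDr.
  have wpe : (w * p) `^ (- (1 + e)) <= w^-1.
    rewrite powRN lef_pV2 ?posrE ?powR_gt0//.
    apply: (le_trans wp); apply: le1r_powR; last lra.
    by apply: le_trans wp; lra.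
  have h := powR_sym_le e0 e1 t2.
  apply: (le_trans (ler_wpM2l (powR_ge0 _ _) h)).
  rewrite mulrDr [_ * 2]mulrC lerD2l.
  have tt : t ^+ 2 <= (2 / w ^+ 2 / p) ^+ 2.
    by rewrite -[t ^+ 2]real_normK ?num_real// lerXn2r ?nnegrE// (le_trans _ tb).
  apply: (@le_trans _ _ (w^-1 * (12 * (2 / w ^+ 2 / p) ^+ 2))).
    by apply: ler_pM; [exact: powR_ge0|rewrite mulr_ge0 ?sqr_ge0|exact: wpe|rewrite ler_wpM2l].
  rewrite le_eqVlt; apply/orP; left; apply/eqP; field.
  by rewrite !gt_eqF// (lt_le_trans ltr01).
apply: (@le_trans _ _ (\sum_(k < M) (2 * (w * k.+1%:R) `^ (- (1 + e)) + q k))).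
  by apply: ler_sum => k _; exact: term.
rewrite big_split /= -mulr_sumr lerD2l -mulr_sumr.
rewrite (_ : 96 / w ^+ 5 = 48 / w ^+ 5 * 2); last by ring.
rewrite ler_wpM2l ?divr_ge0 ?exprn_ge0 ?(ltW w0)//.
case: M => [|M]; first by rewrite big_ord0.
suff : \sum_(k < M.+1) (k.+1%:R ^+ 2)^-1 <= 2 - (M.+1%:R : R)^-1.
  by move=> h; apply: (le_trans h); rewrite gerBl invr_ge0.
elim: M => [|n IH]; first by rewrite big_ord1 expr1n invr1; lra.
rewrite big_ord_recr /=; apply: (le_trans (lerD IH (lexx _))).
rewrite -[n.+2%:R]natr1; have : 1 <= n.+1%:R :> R by rewrite ler1n.
move: n.+1%:R => p p1; rewrite -subr_ge0.
have -> : 2 - (p + 1)^-1 - (2 - p^-1 + ((p + 1) ^+ 2)^-1) = (p * (p + 1) ^+ 2)^-1.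
  by field; rewrite !gt_eqF//; lra.
by rewrite invr_ge0 mulr_ge0 ?sqr_ge0//; lra.
Qed.

Lemma letter_sum_mixed s M x y :
  \sum_(a <- alphabet M) (`|w * a%:~R + x| * `|w * a%:~R + y|) `^ (- s) <=
  (letter_sum w s (alphabet M) x + letter_sum w s (alphabet M) y) / 2.
Proof.
rewrite /letter_sum -big_split /= mulr_suml; apply: ler_sum => a _.
rewrite powRM//; move: `|_| `|_| (normr_ge0 (w * a%:~R + x)) (normr_ge0 (w * a%:~R + y)).
move=> p q p0 q0.
have E u : 0 <= u -> u `^ (- (2 * s)) = (u `^ (- s)) ^+ 2.
  by move=> u0; rewrite -powR_mulrn ?powR_ge0// -powRrM; congr (_ `^ _); ring.
rewrite !E//; move: (_ `^ _) (_ `^ _) => a' b'.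
by have := sqr_ge0 (a' - b'); nra.
Qed.

End letter_sum_estimates.

Section dimension_bounds.
Variables (R : realType) (w : R).
Hypothesis w7 : 7 <= w.
Implicit Types (s e : R).

Let w0 : 0 < w. Proof. by apply: lt_le_trans w7; lra. Qed.
Let w4 : 4 <= w. Proof. by apply: le_trans w7; lra. Qed.

Lemma hausdorff_dim_ge0 : (0 <= hausdorff_dim (limit_set w))%E.
Proof.
by apply: le_ereal_inf_tmp => _ [s [s0 _] <-]; rewrite lee_fin ltW.
Qed.

Let powR_w_M s M : \sum_(k < M) (w * k.+1%:R) `^ (- s) =
  w `^ (- s) * \sum_(k < M) k.+1%:R `^ (- s).
Proof.
by rewrite mulr_sumr; apply: eq_bigr => k _; rewrite powRM// ltW.
Qed.

Lemma hausdorff_dim_ge s M : 0 < s ->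
  1 <= 2 * (w `^ (- (2 * s)) * \sum_(k < M) k.+1%:R `^ (- (2 * s))) ->
  (s%:E <= hausdorff_dim (limit_set w))%E.
Proof.
move=> s0 H; apply: le_ereal_inf_tmp => _ [s' [s'0 Hs'] <-].
rewrite lee_fin leNgt; apply/negP => ss'.
apply: (hausdorff_measure_gt0 w4 s'0 (letters_alphabet M) (uniq_alphabet M) _ Hs').
move=> x x1; apply: le_trans (letter_sum_lower M w4 s'0 x1).
apply: (le_trans H); rewrite -powR_w_M ler_wpM2l//; apply: ler_sum => k _.
apply: ler_powR; last by lra.
have k1 : 1 <= k.+1%:R :> R by rewrite ler1n.
by rewrite -[leLHS]mulr1; apply: ler_pM => //; move: w7; lra.
Qed.

Lemma hausdorff_dim_le e z : 0 <= e -> e <= 1 ->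
  (forall M, \sum_(k < M) k.+1%:R `^ (- (1 + e)) <= z) ->
  2 * (w `^ (- (1 + e)) * z) + 96 / w ^+ 5 < 1 ->
  (hausdorff_dim (limit_set w) <= ((1 + e) / 2)%:E)%E.
Proof.
move=> e0 e1 Hz H; have s0 : 0 < (1 + e) / 2 by lra.
set theta := 2 * _ + _ in H.
have z0 : 0 <= z by have := Hz 0%N; rewrite big_ord0.
have t0 : 0 <= theta.
  by rewrite addr_ge0 ?mulr_ge0 ?powR_ge0// invr_ge0 exprn_ge0// ltW.
apply: ereal_inf_lbound; exists ((1 + e) / 2) => //; split=> //.
apply: (hausdorff_measure_eq0 w7 s0 t0 H) => M x y xr yr.
apply: (le_trans (letter_sum_mixed _ _ _ _ _)).
have bnd u : `|u| <= 2 / w -> letter_sum w ((1 + e) / 2) (alphabet M) u <= theta.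
  move=> ur; apply: (le_trans (letter_sum_upper M w7 e0 e1 ur)).
  by rewrite lerD2r powR_w_M ler_wpM2l// ler_wpM2l ?powR_ge0.
have := bnd _ xr; have := bnd _ yr; lra.
Qed.

(** The two tests which locate the dimension. The lower one is exact; the upper one
has the error of the previous estimate. *)
Lemma delta_bounds s e :
  0 < s -> cvgn (series (fun n => n.+1%:R `^ (- (2 * s)) : R)) ->
  1 < 2 * (w `^ (- (2 * s)) * zeta (2 * s)) ->
  0 <= e -> e <= 1 -> cvgn (series (fun n => n.+1%:R `^ (- (1 + e)) : R)) ->
  2 * (w `^ (- (1 + e)) * zeta (1 + e)) + 96 / w ^+ 5 < 1 ->
  s <= delta w <= (1 + e) / 2.
Proof.
move=> s0 cs Hs e0 e1 ce He.
have ge_s : (s%:E <= hausdorff_dim (limit_set w))%E.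
  have wp : 0 < w `^ (- (2 * s)) by rewrite powR_gt0.
  have Hz : (2 * w `^ (- (2 * s)))^-1 < zeta (2 * s).
    by rewrite -[ltLHS]mul1r ltr_pdivrMr ?mulr_gt0// mulrC -mulrA.
  have nd : nondecreasing_seq (series (fun n => n.+1%:R `^ (- (2 * s)) : R)).
    by apply: nondecreasing_series => k _ _; exact: powR_ge0.
  have [M _ HM] := lt_lim nd cs Hz.
  have := HM M (leqnn M); rewrite /series/= big_mkord => h.
  apply: (hausdorff_dim_ge (M := M)) => //.
  rewrite mulrA -ler_pdivrMl ?mulr_gt0// mulr1; exact: h.
have le_e : (hausdorff_dim (limit_set w) <= ((1 + e) / 2)%:E)%E.
  apply: (hausdorff_dim_le e0 e1 _ He) => M.
  rewrite -(big_mkord xpredT (fun k => k.+1%:R `^ (- (1 + e)))).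
  apply: (nondecreasing_cvgn_le _ ce).
  by apply: nondecreasing_series => k _ _; exact: powR_ge0.
have fin : hausdorff_dim (limit_set w) \is a fin_num.
  by rewrite ge0_fin_numE ?hausdorff_dim_ge0// (le_lt_trans le_e)// ltry.
by rewrite -!lee_fin /delta fineK// ge_s le_e.
Qed.

End dimension_bounds.

(** * Expansion of the solution of the limiting equation *)

Section expansions.
Variable R : realType.
Implicit Types (f g : R -> R -> R) (a b : nat -> R -> R) (t v : R).

Definition bounded_coef (c : R -> R) := exists M, forall t, 0 <= t <= 1 -> `|c t| <= M.

(** The expansions are in powers of [v = ln w / w], with coefficients depending on
[t = 1 / ln w]: in these variables the whole expansion is a Taylor expansion which
is uniform for [t] between 0 and 1, and [1 / w] is [t * v]. *)
Definition jet a v t := \sum_(k < 5) a k t * v ^+ k.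

Definition expands f a := (forall k, bounded_coef (a k)) /\
  exists C, 0 <= C /\ forall v t, 0 <= v <= 1 -> 0 <= t <= 1 ->
    `|f v t - jet a v t| <= C * v ^+ 5.

Definition conv a b : nat -> R -> R :=
  fun k t => \sum_(i < k.+1) a i t * b (k - i)%N t.

Definition mulv a : nat -> R -> R := fun k t => if k is j.+1 then a j t else 0.

Lemma convE a b t : [/\ conv a b 0 t = a 0 t * b 0 t,
  conv a b 1 t = a 0 t * b 1 t + a 1 t * b 0 t,
  conv a b 2 t = a 0 t * b 2 t + a 1 t * b 1 t + a 2 t * b 0 t,
  conv a b 3 t = a 0 t * b 3 t + a 1 t * b 2 t + a 2 t * b 1 t + a 3 t * b 0 t &
  conv a b 4 t = a 0 t * b 4 t + a 1 t * b 3 t + a 2 t * b 2 t + a 3 t * b 1 t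
    + a 4 t * b 0 t].
Proof. by rewrite /conv; split; rewrite !big_ord_recl big_ord0 /= addr0 ?addrA. Qed.

Lemma bounded_coefD (c d : R -> R) : bounded_coef c -> bounded_coef d ->
  bounded_coef (fun t => c t + d t).
Proof.
move=> [M HM] [N HN]; exists (M + N) => t t01.
by apply: (le_trans (ler_normD _ _)); rewrite lerD ?HM ?HN.
Qed.

Lemma bounded_coefM (c d : R -> R) : bounded_coef c -> bounded_coef d ->
  bounded_coef (fun t => c t * d t).
Proof.
move=> [M HM] [N HN]; exists (M * N) => t t01.
by rewrite normrM; apply: ler_pM; rewrite ?HM ?HN.
Qed.

Lemma bounded_coef_cst (x : R) : bounded_coef (fun=> x).
Proof. by exists `|x|. Qed.

Lemma bounded_coef_id : bounded_coef id.
Proof. by exists 1 => t /andP[t0 t1]; rewrite ger0_norm. Qed.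

Lemma bounded_coef_sum n (c : nat -> R -> R) : (forall i, bounded_coef (c i)) ->
  bounded_coef (fun t => \sum_(i < n) c i t).
Proof.
move=> Hc; elim: n => [|n IH].
  by exists 0 => t _; rewrite big_ord0 normr0.
have [M HM] := bounded_coefD IH (Hc n); exists M => t t01.
by rewrite big_ord_recr; exact: HM.
Qed.

Lemma jet_bounded a : (forall k, bounded_coef (a k)) ->
  exists M, 0 <= M /\ forall v t, 0 <= v <= 1 -> 0 <= t <= 1 -> `|jet a v t| <= M.
Proof.
move=> /choice[M HM]; exists (\sum_(k < 5) `|M k|); split.
  by rewrite sumr_ge0.
move=> v t /andP[v0 v1] t01; apply: (le_trans (ler_norm_sum _ _ _)).
apply: ler_sum => k _; rewrite normrM -[leRHS]mulr1; apply: ler_pM => //.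
  exact: (le_trans (HM k t t01) (ler_norm _)).
by rewrite normrX ger0_norm// exprn_ile1.
Qed.

Lemma jet_conv a b v t : jet a v t * jet b v t - jet (conv a b) v t =
  v ^+ 5 * (a 1 t * b 4 t + a 2 t * b 3 t + a 3 t * b 2 t + a 4 t * b 1 t
   + v * (a 2 t * b 4 t + a 3 t * b 3 t + a 4 t * b 2 t
   + v * (a 3 t * b 4 t + a 4 t * b 3 t + v * (a 4 t * b 4 t)))).
Proof.
rewrite /jet /conv !big_ord_recl !big_ord0 /= /bump /=.
rewrite !addn0 !add1n !subn0 /= !subSS !subn0.
ring.
Qed.

Lemma expands_bounded f a : expands f a ->
  exists M, 0 <= M /\ forall v t, 0 <= v <= 1 -> 0 <= t <= 1 -> `|f v t| <= M.
Proof.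
move=> [/jet_bounded[M [M0 HM]] [C [C0 HC]]]; exists (C + M); split; first exact: addr_ge0.
move=> v t v01 t01; rewrite -[f v t](subrK (jet a v t)).
apply: (le_trans (ler_normD _ _)); rewrite lerD ?HM// (le_trans (HC _ _ v01 t01))//.
by move: v01 => /andP[v0 v1]; rewrite ler_piMr// exprn_ile1.
Qed.

Lemma expandsM f g a b : expands f a -> expands g b ->
  expands (fun v t => f v t * g v t) (conv a b).
Proof.
move=> fa gb; have [F [F0 HF]] := expands_bounded fa.
case: fa => ba [C [C0 HC]]; have [G [G0 HG]] := expands_bounded gb.
case: gb => bb [D [D0 HD]]; split.
  move=> k; apply: (@bounded_coef_sum _ (fun i t => a i t * b (k - i)%N t)) => i.
  exact: bounded_coefM.
have [J [J0 HJ]] := jet_bounded ba.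
have [M HM] : bounded_coef (fun t => `|a 1 t * b 4 t + a 2 t * b 3 t + a 3 t * b 2 t + a 4 t * b 1 t|
   + (`|a 2 t * b 4 t + a 3 t * b 3 t + a 4 t * b 2 t|
   + (`|a 3 t * b 4 t + a 4 t * b 3 t| + `|a 4 t * b 4 t|))).
  have bn (c : R -> R) : bounded_coef c -> bounded_coef (fun t => `|c t|).
    by move=> [M HM]; exists M => t /HM; rewrite normr_id.
  by repeat (apply: bounded_coefD || apply: bn || apply: bounded_coefM || exact: ba || exact: bb).
exists (C * G + J * D + `|M|); split; first by rewrite !addr_ge0 ?mulr_ge0.
move=> v t v01 t01; have /andP[v0 v1] := v01.
have v50 : 0 <= v ^+ 5 by rewrite exprn_ge0.
have -> : f v t * g v t - jet (conv a b) v t =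
  (f v t - jet a v t) * g v t + jet a v t * (g v t - jet b v t) +
  (jet a v t * jet b v t - jet (conv a b) v t) by ring.
rewrite [leRHS]mulrDl [X in _ <= X + _]mulrDl.
apply: (le_trans (ler_normD _ _)); apply: lerD.
  apply: (le_trans (ler_normD _ _)); rewrite !normrM; apply: lerD.
    by rewrite mulrAC; apply: ler_pM => //; [exact: HC|exact: HG].
  by rewrite -[leRHS]mulrA; apply: ler_pM => //; [exact: HJ|exact: HD].
rewrite jet_conv normrM (ger0_norm v50) mulrC ler_wpM2r//.
apply: le_trans (ler_norm M); apply: le_trans (HM t t01).
rewrite [leRHS]ger0_norm ?addr_ge0//.
have step (p q r : R) : `|q| <= r -> `|p + v * q| <= `|p| + r.
  move=> qr; apply: (le_trans (ler_normD _ _)); rewrite lerD2l normrM (ger0_norm v0).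
  by apply: le_trans qr; rewrite ler_piMl.
do 2 apply: (step).
by rewrite -[v * _]mulr1; apply: (le_trans (ler_normD _ _)); rewrite lerD2l mulr1 normrM (ger0_norm v0) ler_piMl.
Qed.

Lemma expandsD f g a b : expands f a -> expands g b ->
  expands (fun v t => f v t + g v t) (fun k t => a k t + b k t).
Proof.
move=> [ba [C [C0 HC]]] [bb [D [D0 HD]]]; split.
  by move=> k; exact: bounded_coefD.
exists (C + D); split; first exact: addr_ge0.
move=> v t v01 t01; have -> : f v t + g v t - jet (fun k t => a k t + b k t) v t =
   (f v t - jet a v t) + (g v t - jet b v t).
  rewrite /jet; under eq_bigr do rewrite mulrDl.
  by rewrite big_split /=; ring.
by rewrite mulrDl; apply: (le_trans (ler_normD _ _)); rewrite lerD ?HC ?HD.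
Qed.

Lemma expandsZ f a (c : R -> R) : bounded_coef c -> expands f a ->
  expands (fun v t => c t * f v t) (fun k t => c t * a k t).
Proof.
move=> bc [ba [C [C0 HC]]]; split; first by move=> k; exact: bounded_coefM.
case: bc => M HM; have M0 : 0 <= M.
  by apply: le_trans (HM 0 _); rewrite ?normr_ge0// lexx ler01.
exists (M * C); split; first exact: mulr_ge0.
move=> v t v01 t01; have -> : c t * f v t - jet (fun k t => c t * a k t) v t =
   c t * (f v t - jet a v t).
  by rewrite mulrBr /jet mulr_sumr; congr (_ - _); apply: eq_bigr => k _; rewrite mulrA.
by rewrite normrM -mulrA; apply: ler_pM; rewrite ?HM ?HC.
Qed.

Lemma expands_mulv f a : expands f a -> expands (fun v t => v * f v t) (mulv a).
Proof.
move=> [ba [C [C0 HC]]]; split.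
  by case=> [|k]; [exact: (bounded_coef_cst 0)|exact: ba].
have [M HM] := ba 4%N.
have M0 : 0 <= M.
  by apply: le_trans (HM 0 _); rewrite ?normr_ge0// lexx ler01.
exists (C + M); split; first exact: addr_ge0.
move=> v t v01 t01; have -> : v * f v t - jet (mulv a) v t =
   v * (f v t - jet a v t) + a 4%N t * v ^+ 5.
  by rewrite /jet /mulv !big_ord_recl !big_ord0 /=; ring.
have /andP[v0 v1] := v01.
have v50 : 0 <= v ^+ 5 by rewrite exprn_ge0.
rewrite mulrDl; apply: (le_trans (ler_normD _ _)); apply: lerD.
  rewrite normrM (ger0_norm v0) -[leRHS]mul1r; apply: ler_pM => //; exact: HC.
by rewrite normrM (ger0_norm v50) ler_wpM2r// HM.
Qed.

Lemma expands_cst (x : R) : expands (fun _ _ => x) (fun k _ => if k is 0%N then x else 0).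
Proof.
split; first by case=> [|k]; [exact: (bounded_coef_cst x)|exact: (bounded_coef_cst 0)].
exists 0; split=> // v t _ _; rewrite mul0r normr_le0 /jet big_ord_recl expr0 mulr1.
by rewrite big1 ?addr0 ?subrr// => i _; rewrite /= mul0r.
Qed.

Lemma expands_jet a : (forall k, bounded_coef (a k)) -> expands (jet a) a.
Proof. by move=> ba; split=> //; exists 0; split=> // v t _ _; rewrite subrr normr0 mul0r. Qed.

Lemma expands_eq0 f a : expands f a -> (forall k t, (k < 5)%N -> a k t = 0) ->
  exists C, 0 <= C /\ forall v t, 0 <= v <= 1 -> 0 <= t <= 1 -> `|f v t| <= C * v ^+ 5.
Proof.
move=> [_ [C [C0 HC]]] a0; exists C; split=> // v t v01 t01.
have := HC v t v01 t01; rewrite /jet big1 ?subr0// => k _.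
by rewrite a0// mul0r.
Qed.

End expansions.

Section inversion.
Variables (R : realType) (g : nat -> R).
Implicit Types (t v : R).

(** Half of the [L]-polynomials given by Lagrange inversion of
[e = (2 / w) * h e * exp (- e * L)], where [h e = e * zeta (1 + e)] is replaced by
its Taylor polynomial: the coefficient of [w ^- j.+1] in [e] is
[2 ^ j.+1 / j.+1] times the coefficient of [x ^ j] in
[(h x * exp (- x * L)) ^ j.+1]. Coefficients are listed by increasing powers of
[L]. *)
Definition inv_coef (j : nat) : seq R :=
  match j with
  | 0 => [:: 1]
  | 1 => [:: 2 * g 0; - 2]
  | 2 => [:: 4 * g 0 ^+ 2 - 4 * g 1; - 12 * g 0; 6]
  | 3 => [:: 4 * g 2 - 24 * g 0 * g 1 + 8 * g 0 ^+ 3;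
             32 * g 1 - 48 * g 0 ^+ 2; 64 * g 0; - 64 / 3]
  | _ => [:: - 8 * g 3 / 3 + 32 * g 0 * g 2 + 32 * g 1 ^+ 2
               - 96 * g 0 ^+ 2 * g 1 + 16 * g 0 ^+ 4;
             - 40 * g 2 + 320 * g 0 * g 1 - 160 * g 0 ^+ 3;
             - 200 * g 1 + 400 * g 0 ^+ 2; - 1000 * g 0 / 3; 250 / 3]
  end.

(** Twice the polynomial [inv_coef j] at [L = 1 / t], multiplied by [t ^+ j]. *)
Definition inv_jet_coef (j : nat) t : R :=
  2 * \sum_(i < j.+1) (inv_coef j)`_i * t ^+ (j - i).

Lemma bounded_inv_jet_coef k : bounded_coef (inv_jet_coef k).
Proof.
apply: bounded_coefM; first exact: bounded_coef_cst.
apply: (@bounded_coef_sum _ _ (fun i t => (inv_coef k)`_i * t ^+ (k - i))) => i.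
apply: bounded_coefM; first exact: bounded_coef_cst.
by exists 1 => t /andP[t0 t1]; rewrite normrX ger0_norm// exprn_ile1.
Qed.

(** The Taylor polynomial of [x * zeta (1 + x)] at 0 if [g] lists the Stieltjes
constants, in the form of Horner. *)
Definition zeta_poly (x : R) : R :=
  1 + x * (g 0 - x * (g 1 - x * (g 2 / 2 - x * (g 3 / 6)))).

(** Taylor polynomial of [expR (- x)] at 0, in the form of Horner. *)
Definition exp_poly (x : R) : R := 1 - x * (1 - x / 2 * (1 - x / 3 * (1 - x / 4))).

(** The approximate solution satisfies the polynomial equation up to order 5 in [v]:
the calculus of expansions reduces this to the five identities between the
coefficients that define the inversion. *)
Lemma inversion_residual : exists C, 0 <= C /\
  forall v t, 0 <= v <= 1 -> 0 <= t <= 1 ->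
  `|jet inv_jet_coef v t
    - 2 * (zeta_poly (t * v * jet inv_jet_coef v t)
           * exp_poly (v * jet inv_jet_coef v t))| <= C * v ^+ 5.
Proof.
set Y := jet inv_jet_coef.
have eY : expands Y inv_jet_coef by apply: expands_jet bounded_inv_jet_coef.
have eZ := expands_mulv eY.
have bt := bounded_coef_id R.
have bc := @bounded_coef_cst R.
have eV := expandsZ bt eZ.
have e1 := @expands_cst R 1.
have c := @expands_cst R.
pose em (x : R) f a (ef : expands f a) := expandsZ (bc x) ef.
have p3 := expandsD (c (g 2 / 2)) (em (-1) _ _ (expandsM eV (c (g 3 / 6)))).
have p2 := expandsD (c (g 1)) (em (-1) _ _ (expandsM eV p3)).
have p1 := expandsD (c (g 0)) (em (-1) _ _ (expandsM eV p2)).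
have p0 := expandsD e1 (expandsM eV p1).
have q3 := expandsD e1 (em (- (1 / 4)) _ _ eZ).
have q2 := expandsD e1 (em (- (1 / 3)) _ _ (expandsM eZ q3)).
have q1 := expandsD e1 (em (- (1 / 2)) _ _ (expandsM eZ q2)).
have q0 := expandsD e1 (em (-1) _ _ (expandsM eZ q1)).
have res := expandsD eY (em (-2) _ _ (expandsM p0 q0)).
have [|C [C0 HC]] := expands_eq0 res; last first.
  exists C; split=> // v t v01 t01.
  apply: le_trans (HC v t v01 t01); rewrite le_eqVlt; apply/orP; left.
  apply/eqP; congr `|_|; rewrite /zeta_poly /exp_poly -/(Y v t).
  by move: (Y v t) => y; field.
move=> {res} k t k5.
have y0 : inv_jet_coef 0 t = 2.
  by rewrite /inv_jet_coef big_ord1 expr0 /=; ring.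
have y1 : inv_jet_coef 1 t = 4 * g 0 * t - 4.
  by rewrite /inv_jet_coef !big_ord_recl big_ord0 /= /bump /= ?subnn ?expr0 ?expr1; ring.
have y2 : inv_jet_coef 2 t = (8 * g 0 ^+ 2 - 8 * g 1) * t ^+ 2 - 24 * g 0 * t + 12.
  by rewrite /inv_jet_coef !big_ord_recl big_ord0 /= /bump /=; ring.
have y3 : inv_jet_coef 3 t = (8 * g 2 - 48 * g 0 * g 1 + 16 * g 0 ^+ 3) * t ^+ 3
    + (64 * g 1 - 96 * g 0 ^+ 2) * t ^+ 2 + 128 * g 0 * t - 128 / 3.
  by rewrite /inv_jet_coef !big_ord_recl big_ord0 /= /bump /=; field.
have y4 : inv_jet_coef 4 t = (- 16 * g 3 / 3 + 64 * g 0 * g 2 + 64 * g 1 ^+ 2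
       - 192 * g 0 ^+ 2 * g 1 + 32 * g 0 ^+ 4) * t ^+ 4
    + (- 80 * g 2 + 640 * g 0 * g 1 - 320 * g 0 ^+ 3) * t ^+ 3
    + (- 400 * g 1 + 800 * g 0 ^+ 2) * t ^+ 2 - 2000 * g 0 / 3 * t + 500 / 3.
  by rewrite /inv_jet_coef !big_ord_recl big_ord0 /= /bump /=; field.
have c0 a b : conv a b 0 t = a 0 t * b 0 t by have [] := convE a b t.
have c1 a b : conv a b 1 t = a 0 t * b 1 t + a 1 t * b 0 t by have [] := convE a b t.
have c2 a b : conv a b 2 t = a 0 t * b 2 t + a 1 t * b 1 t + a 2 t * b 0 t.
  by have [] := convE a b t.
have c3 a b : conv a b 3 t = a 0 t * b 3 t + a 1 t * b 2 t + a 2 t * b 1 t + a 3 t * b 0 t.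
  by have [] := convE a b t.
have c4 a b : conv a b 4 t = a 0 t * b 4 t + a 1 t * b 3 t + a 2 t * b 2 t + a 3 t * b 1 t
    + a 4 t * b 0 t.
  by have [] := convE a b t.
pose simp := (mul0r, mulr0, add0r, addr0).
case: k k5 => [_|k k5].
  by rewrite !c0 /= !simp y0; field.
case: k k5 => [_|k k5].
  by rewrite !(c0, c1) /= !simp y0 y1; field.
case: k k5 => [_|k k5].
  by rewrite !(c0, c1, c2) /= !simp y0 y1 y2; field.
case: k k5 => [_|k k5].
  by rewrite !(c0, c1, c2, c3) /= !simp y0 y1 y2 y3; field.
case: k k5 => [_|k k5].
  by rewrite !(c0, c1, c2, c3, c4) /= !simp y0 y1 y2 y3 y4; field.
by [].
Qed.

End inversion.

(** * The limiting equation near its approximate solution *)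

Section approximation.
Variable R : realType.
Local Notation ga := (@stieltjes R).
Implicit Types (x y t v : R).

Lemma zeta_poly_approx : exists C x0, [/\ 0 <= C, 0 < x0 & forall x, 0 < x -> x <= x0 ->
  `|x * zeta (1 + x) - zeta_poly ga x| <= C * x ^+ 5].
Proof.
have [C [C0 [r /= r0 H]]] := zeta_expansion R 4.
exists C, (r / 2); split => //; first by rewrite divr_gt0.
move=> x x_gt0 xr.
have := H x; rewrite /= sub0r normrN gtr0_norm// => /(_ ltac:(lra) x_gt0).
rewrite !big_ord_recl big_ord0 /= /bump /= !addn0 => h.
have -> : x * zeta (1 + x) - zeta_poly ga x =
   x * (zeta (1 + x) - x^-1 - ((-1) ^+ 0 * ga 0 / 0`!%:R * x ^+ 0 +
      ((-1) ^+ 1 * ga 1 / 1`!%:R * x ^+ 1 +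
       ((-1) ^+ 2 * ga 2 / 2`!%:R * x ^+ 2 +
        ((-1) ^+ 3 * ga 3 / 3`!%:R * x ^+ 3 + 0))))).
  rewrite /zeta_poly !factS fact0 !mulr1n.
  by field; rewrite gt_eqF.
rewrite normrM (gtr0_norm x_gt0) (_ : C * x ^+ 5 = x * (C * x ^+ 4)); last by ring.
by rewrite ler_wpM2l ?(ltW x_gt0).
Qed.

Lemma exp_poly_approx : exists C x0, [/\ 0 <= C, 0 < x0 & forall x, 0 < x -> x <= x0 ->
  `|expR (- x) - exp_poly x| <= C * x ^+ 5].
Proof.
have H : \forall x \near (0 : R)^'+,
    series (fun n => (-1) ^+ n / n`!%:R * x ^+ n) @ \oo --> expR (- x).
  near=> x; have := @is_cvg_series_exp_coeff R (- x).
  rewrite /expR (_ : exp_coeff (- x) = fun n => (-1) ^+ n / n`!%:R * x ^+ n)//.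
  by apply/funext => n; rewrite /exp_coeff /= -[- x]mulN1r exprMn mulrAC.
have [C [C0 [r /= r0 {}H]]] := pseries_remainder 5 H.
exists C, (r / 2); split => //; first by rewrite divr_gt0.
move=> x x_gt0 xr.
have := H x; rewrite /= sub0r normrN gtr0_norm// => /(_ ltac:(lra) x_gt0).
apply: le_trans; rewrite le_eqVlt; apply/orP; left; apply/eqP; congr `|_ - _|.
rewrite !big_ord_recl big_ord0 /= /bump /= !addn0 /exp_poly.
by rewrite !factS fact0; field.
Unshelve. all: by end_near. Qed.

Lemma zeta_poly_lipschitz (g : nat -> R) : exists M, 0 <= M /\
  forall x y, 0 <= x <= 1 -> 0 <= y <= 1 ->
    `|zeta_poly g x - zeta_poly g y| <= M * `|x - y| /\ `|zeta_poly g x| <= M.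
Proof.
exists (1 + `|g 0%N| + 2 * `|g 1%N| + 3 * `|g 2%N / 2| + 4 * `|g 3%N / 6|); split.
  by rewrite !addr_ge0 ?mulr_ge0.
move=> x y /andP[x0 x1] /andP[y0 y1].
have s1 : `|x + y| <= 2 by rewrite ger0_norm ?addr_ge0//; lra.
have s2 : `|x ^+ 2 + x * y + y ^+ 2| <= 3.
  by rewrite ger0_norm ?addr_ge0 ?mulr_ge0 ?exprn_ge0//; nra.
have s3 : `|(x + y) * (x ^+ 2 + y ^+ 2)| <= 4.
  rewrite ger0_norm ?mulr_ge0 ?addr_ge0 ?mulr_ge0 ?exprn_ge0//.
  have : x ^+ 2 <= 1 by nra.
  have : y ^+ 2 <= 1 by nra.
  have := sqr_ge0 x; have := sqr_ge0 y.
  by move: (x ^+ 2) (y ^+ 2) => p q; nra.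
split.
  have -> : zeta_poly g x - zeta_poly g y = (g 0%N - g 1%N * (x + y)
      + g 2%N / 2 * (x ^+ 2 + x * y + y ^+ 2)
      - g 3%N / 6 * ((x + y) * (x ^+ 2 + y ^+ 2))) * (x - y).
    by rewrite /zeta_poly; field.
  rewrite normrM ler_wpM2r//.
  apply: (le_trans (ler_normB _ _)); apply: lerD; last first.
    by rewrite normrM mulrC ler_wpM2r.
  apply: (le_trans (ler_normD _ _)); apply: lerD; last first.
    by rewrite normrM mulrC ler_wpM2r.
  apply: (le_trans (ler_normB _ _)); apply: lerD.
    by rewrite lerDr.
  by rewrite normrM mulrC ler_wpM2r.
rewrite (_ : zeta_poly g x = 1 + g 0%N * x - g 1%N * x ^+ 2 + g 2%N / 2 * x ^+ 3
   - g 3%N / 6 * x ^+ 4); last by rewrite /zeta_poly; field.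
have px n : `|x ^+ n| <= 1 by rewrite ger0_norm ?exprn_ge0// exprn_ile1.
have m1 (c p : R) : `|p| <= 1 -> `|c * p| <= `|c|.
  by move=> p1; rewrite normrM ler_piMr.
apply: (le_trans (ler_normB _ _)); apply: lerD; last first.
  by apply: (le_trans (m1 _ _ (px 4%N))); rewrite ler_peMl//; lra.
apply: (le_trans (ler_normD _ _)); apply: lerD; last first.
  by apply: (le_trans (m1 _ _ (px 3%N))); rewrite ler_peMl//; lra.
apply: (le_trans (ler_normB _ _)); apply: lerD; last first.
  by apply: (le_trans (m1 _ _ (px 2%N))); rewrite ler_peMl//; lra.
apply: (le_trans (ler_normD _ _)); apply: lerD; first by rewrite normr1.
by apply: m1; rewrite ger0_norm.
Qed.

Lemma expR_opp_lipschitz x y : 0 <= x -> 0 <= y ->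
  `|expR (- x) - expR (- y)| <= `|x - y|.
Proof.
wlog xy : x y / x <= y => [H x0 y0|x0 y0].
  have [xy|yx] := leP x y; first exact: H.
  by rewrite distrC [leRHS]distrC; apply: H => //; exact: ltW.
rewrite ger0_norm ?subr_ge0 ?ler_expR ?lerN2// ler0_norm ?subr_le0//.
have -> : expR (- y) = expR (- x) * expR (- (y - x)).
  by rewrite -expRD; congr expR; ring.
have h1 := expR_ge1Dx (- (y - x)).
have h2 : expR (- x) <= 1 by rewrite expR_le1 oppr_le0.
have h3 := expR_gt0 (- x).
have : expR (- x) * (1 + - (y - x)) <= expR (- x) * expR (- (y - x)).
  by rewrite ler_wpM2l// ltW.
nra.
Qed.

Local Notation Y := (jet (inv_jet_coef ga)).

(** The right-hand side of the equation depends on [X] only through [t * v * X] and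
[v * X], so that an error in [X] enters with a factor [v]. Hence moving [X] away
from the approximate solution by a large multiple of [v ^+ 5] decides which side
of the equation is larger. *)
Lemma inversion_approx : exists C v0, [/\ 0 <= C, 0 < v0, v0 <= 1 &
  forall v t X, 0 < v -> v <= v0 -> 0 < t -> t <= 1 -> `|X - Y v t| <= 1 / 2 ->
  [/\ 0 < X, X <= 4 &
  `|2 * ((t * v * X) * zeta (1 + t * v * X) * expR (- (v * X))) - Y v t|
  <= C * (v ^+ 5 + v * `|X - Y v t|)]].
Proof.
have [C1 [x1 [C10 x10 H1]]] := zeta_poly_approx.
have [C2 [x2 [C20 x20 H2]]] := exp_poly_approx.
have [M [M0 HM]] := zeta_poly_lipschitz ga.
have [C3 [C30 H3]] := inversion_residual ga.
have [B [B0 HB]] : exists B, 0 <= B /\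
    forall v t, 0 <= v <= 1 -> 0 <= t <= 1 -> `|Y v t - 2| <= B * v.
  pose A k : R -> R := if (k < 4)%N then inv_jet_coef ga k.+1 else fun=> 0.
  have bA k : bounded_coef (A k).
    by rewrite /A; case: ifP => _; [exact: bounded_inv_jet_coef|exact: (bounded_coef_cst (0 : R))].
  have [B [B0 HB]] := jet_bounded bA.
  exists B; split=> // v t v01 t01.
  have -> : Y v t - 2 = jet A v t * v.
    rewrite /jet /A !big_ord_recl !big_ord0 /= /bump /=.
    have -> : inv_jet_coef ga 0 t = 2.
      by rewrite /inv_jet_coef big_ord1 expr0 /=; ring.
    ring.
  by have /andP[v0 _] := v01; rewrite normrM (ger0_norm v0) ler_wpM2r// HB.
pose v0 := Num.min (1 / 4) (Num.min (x1 / 4) (Num.min (x2 / 4) (1 / (2 * (B + 1))))).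
exists (2 * C1 * 4 ^+ 5 + 2 * M * C2 * 4 ^+ 5 + C3 + 4 * M), v0; split.
- by rewrite !addr_ge0 ?mulr_ge0 ?exprn_ge0.
- by rewrite !lt_min !divr_gt0//; lra.
- by rewrite ge_min; apply/orP; left; lra.
move=> v t X vgt0; rewrite !le_min => /and4P[v4 vx1 vx2 vB] tgt0 t1 XY.
have v01 : 0 <= v <= 1 by apply/andP; split; lra.
have t01 : 0 <= t <= 1 by apply/andP; split; lra.
have hY := HB v t v01 t01.
have hB : B * v <= 1 / 2.
  have B1 : 0 < 2 * (B + 1) by lra.
  by move: vB; rewrite ler_pdivlMr//; nra.
move: (H3 v t v01 t01) hY XY; move: (Y v t) => y res hY XY.
have {hY}/andP[hY1 hY2] : - (1 / 2) <= y - 2 <= 1 / 2.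
  by rewrite -ler_norml; apply: le_trans hY hB.
have {XY}[XY1 /andP[hX1 hX2]] : `|X - y| <= 1 / 2 /\ - (1 / 2) <= X - y <= 1 / 2.
  by rewrite -ler_norml.
have X0 : 0 < X by lra.
have X4 : X <= 4 by lra.
split=> //.
set x := t * v * X.
have tv : 0 < t * v by rewrite mulr_gt0.
have tvv : t * v <= v by rewrite ler_piMl// ltW.
have xp : 0 < x by rewrite /x mulr_gt0.
have x4v : x <= v * 4 by rewrite /x; apply: ler_pM => //; exact: ltW.
have vXp : 0 < v * X by rewrite mulr_gt0.
have vX4 : v * X <= v * 4 by rewrite ler_wpM2l// ltW.
have yp : 0 < y by lra.
have y4 : y <= 4 by lra.
have vyp : 0 < v * y by rewrite mulr_gt0.
have vy4 : v * y <= v * 4 by rewrite ler_wpM2l// ltW.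
have xy4 : t * v * y <= v * 4 by apply: ler_pM => //; exact: ltW.
have p1 := H1 x xp ltac:(lra).
have p2 := H2 (v * y) vyp ltac:(lra).
have x01 : 0 <= x <= 1 by apply/andP; split; lra.
have y01 : 0 <= t * v * y <= 1.
  by apply/andP; split; [rewrite mulr_ge0 ?ltW|lra].
have [l1 l2] := HM _ _ x01 y01.
have [_ l3] := HM _ _ y01 x01.
have l4 := expR_opp_lipschitz (ltW vXp) (ltW vyp).
have dx : `|x - t * v * y| <= v * `|X - y|.
  by rewrite /x -mulrBr normrM (gtr0_norm tv) ler_wpM2r.
have dv : `|v * X - v * y| = v * `|X - y| by rewrite -mulrBr normrM gtr0_norm.
have x5 : x ^+ 5 <= 4 ^+ 5 * v ^+ 5.
  rewrite -exprMn [4 * v]mulrC; apply: lerXn2r => //; rewrite nnegrE; first exact: ltW.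
  by rewrite mulr_ge0// ltW.
have y5 : (v * y) ^+ 5 <= 4 ^+ 5 * v ^+ 5.
  rewrite -exprMn [4 * v]mulrC; apply: lerXn2r => //; rewrite nnegrE; first exact: ltW.
  by rewrite mulr_ge0// ltW.
have eX0 := expR_gt0 (- (v * X)).
have eX1 : expR (- (v * X)) <= 1 by rewrite expR_le1 oppr_le0 ltW.
(* One summand for each replacement: of zeta by its polynomial, of [X] by [y] in the
polynomial and in the exponential, and of the exponential by its polynomial. *)
have -> : 2 * (x * zeta (1 + x) * expR (- (v * X))) - y =
   2 * ((x * zeta (1 + x) - zeta_poly ga x) * expR (- (v * X)))
   + 2 * ((zeta_poly ga x - zeta_poly ga (t * v * y)) * expR (- (v * X)))
   + 2 * (zeta_poly ga (t * v * y) * (expR (- (v * X)) - expR (- (v * y))))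
   + 2 * (zeta_poly ga (t * v * y) * (expR (- (v * y)) - exp_poly (v * y)))
   - (y - 2 * (zeta_poly ga (t * v * y) * exp_poly (v * y))) by ring.
have v5 : 0 <= v ^+ 5 by rewrite exprn_ge0// ltW.
have vX0 : 0 <= v * `|X - y| by rewrite mulr_ge0// ltW.
apply: (@le_trans _ _ (2 * (C1 * (4 ^+ 5 * v ^+ 5)) + 2 * (M * (v * `|X - y|))
   + 2 * (M * (v * `|X - y|)) + 2 * (M * (C2 * (4 ^+ 5 * v ^+ 5))) + C3 * v ^+ 5)).
  have n2 (z b : R) : `|z| <= b -> `|2 * z| <= 2 * b.
    by move=> zb; rewrite normrM (ger0_norm (ler0n _ _)) ler_wpM2l.
  apply: (le_trans (ler_normB _ _)); apply: lerD => //.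
  apply: (le_trans (ler_normD _ _)); apply: lerD; last first.
    apply: n2; rewrite normrM; apply: ler_pM => //.
    by apply: (le_trans p2); rewrite ler_wpM2l.
  apply: (le_trans (ler_normD _ _)); apply: lerD; last first.
    by apply: n2; rewrite normrM; apply: ler_pM => //; rewrite -dv.
  apply: (le_trans (ler_normD _ _)); apply: lerD; apply: n2; rewrite normrM.
    rewrite -[leRHS]mulr1; apply: ler_pM => //; last by rewrite gtr0_norm.
    by apply: (le_trans p1); rewrite ler_wpM2l.
  rewrite -[leRHS]mulr1; apply: ler_pM => //; last by rewrite gtr0_norm.
  by apply: (le_trans l1); rewrite ler_wpM2l.
have k0 : 0 <= 4 ^+ 5 :> R by rewrite exprn_ge0.
move: (v ^+ 5) (v * `|X - y|) v5 vX0 (4 ^+ 5 : R) k0 => p q p0 q0 k k0.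
rewrite -subr_ge0 (_ : _ - _ =
  (2 * C1 * k + 2 * M * C2 * k + C3) * q + 4 * M * p); last by ring.
by rewrite addr_ge0 ?mulr_ge0 ?addr_ge0 ?mulr_ge0.
Qed.

End approximation.

(** * The asymptotic expansion of the dimension *)

Section rational_coefficients.
Variable R : realType.
Implicit Types (x y : R).

Lemma rat_stieltjes_nat n : rat_stieltjes (n%:R : R).
Proof. by rewrite -(ratr_nat R n); exact: rat_stieltjes_rat. Qed.

Lemma rat_stieltjesN x : rat_stieltjes x -> rat_stieltjes (- x).
Proof.
move=> hx; rewrite -mulN1r; apply: rat_stieltjesM => //.
by have := rat_stieltjes_rat R (-1); rewrite rmorphN rmorph1.
Qed.

Lemma rat_stieltjesX x n : rat_stieltjes x -> rat_stieltjes (x ^+ n).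
Proof.
move=> hx; elim: n => [|n IH]; first exact: (rat_stieltjes_nat 1).
by rewrite exprS; exact: rat_stieltjesM.
Qed.

Lemma rat_stieltjesV n : rat_stieltjes ((n%:R : R)^-1).
Proof. by rewrite -(ratr_nat R n) -fmorphV; exact: rat_stieltjes_rat. Qed.

Lemma rat_stieltjes_inv_coef j i : rat_stieltjes (inv_coef (@stieltjes R) j)`_i.
Proof.
have G n := rat_stieltjes_gamma R n.
case: j => [|[|[|[|j]]]]; case: i => [|[|[|[|[|i]]]]] /=; rewrite ?nth_nil;
repeat lazymatch goal with
| |- rat_stieltjes (_ + _) => apply: rat_stieltjesD
| |- rat_stieltjes (- _) => apply: rat_stieltjesN
| |- rat_stieltjes (_ * _) => apply: rat_stieltjesM
| |- rat_stieltjes (_ ^+ _) => apply: rat_stieltjesX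
| |- rat_stieltjes (_^-1) => exact: rat_stieltjesV
| |- rat_stieltjes (stieltjes _ _) => exact: G
| |- rat_stieltjes 0 => exact: (rat_stieltjes_nat 0)
| |- rat_stieltjes 1 => exact: (rat_stieltjes_nat 1)
| |- _ => exact: rat_stieltjes_nat
end.
Qed.

Lemma size_inv_coef j : (2 <= j <= 4)%N -> size (Poly (inv_coef (@stieltjes R) j)) = j.+1.
Proof.
have n0 n : n.+1%:R != 0 :> R by rewrite pnatr_eq0.
have sz (q : seq R) : last 1 q != 0 -> size (Poly q) = size q by move=> /PolyK->.
move=> j24; have jE : size (inv_coef (@stieltjes R) j) = j.+1.
  by case: j j24 => [|[|[|[|[|j]]]]].
rewrite -jE; apply: sz; case: j j24 {jE} => [|[|[|[|[|j]]]]] // _; rewrite [last _ _]/=.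
- exact: n0.
- by apply: mulf_neq0; rewrite ?oppr_eq0 ?invr_eq0 n0.
- by apply: mulf_neq0; rewrite ?invr_eq0 n0.
Qed.

End rational_coefficients.

Section main.
Variable R : realType.
Local Notation ga := (@stieltjes R).
Local Notation Y := (jet (inv_jet_coef ga)).

Lemma horner_inv_coef j (w L : R) : (j <= 4)%N -> 0 < w -> 0 < L ->
  (Poly (inv_coef ga j)).[L] / w ^+ j.+1 =
  w^-1 * (inv_jet_coef ga j L^-1 * (L / w) ^+ j) / 2.
Proof.
move=> j4 w0 L0; have jE : size (inv_coef ga j) = j.+1.
  by case: j j4 => [|[|[|[|[|j]]]]].
rewrite (@horner_coef_wide _ j.+1); last by rewrite -jE; exact: size_Poly.
rewrite /inv_jet_coef [in RHS]mulrAC !mulr_suml mulr_sumr mulr_suml mulr_sumr.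
apply: eq_bigr => i _; have ij : (i <= j)%N by rewrite -ltnS.
rewrite coef_Poly expr_div_n exprVn exprS -[in L ^+ j](subnK ij) exprD.
have Ln n : L ^+ n != 0 by rewrite expf_neq0// gt_eqF.
have wn : w ^+ j != 0 by rewrite expf_neq0// gt_eqF.
move: (Ln (j - i)%N) (Ln i) wn.
move: (_ `_ i) (L ^+ _) (L ^+ _) (w ^+ j) => c p q W p0 q0 W0.
by field; rewrite p0 W0 gt_eqF.
Qed.

Lemma expansion_jet (w L : R) : 0 < w -> 0 < L ->
  1 / 2 + 1 / w - 2 * L / w ^+ 2 + 2 * ga 0 / w ^+ 2 +
    \sum_(2 <= j < 5) (Poly (inv_coef ga j)).[L] / w ^+ j.+1 =
  (1 + w^-1 * Y (L / w) L^-1) / 2.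
Proof.
move=> w0 L0; rewrite [in RHS]mulrDl /jet [in RHS]mulr_sumr [in RHS]mulr_suml.
rewrite (eq_bigr (fun j : 'I_5 => (Poly (inv_coef ga j)).[L] / w ^+ j.+1)); last first.
  by move=> j _; rewrite horner_inv_coef// -ltnS.
rewrite -(big_mkord xpredT (fun j => (Poly (inv_coef ga j)).[L] / w ^+ j.+1)).
rewrite [in RHS]big_ltn// [in RHS]big_ltn// !addrA; congr (_ + _).
rewrite !horner_Poly /= !mul0r !add0r expr1.
by field; rewrite gt_eqF.
Qed.

(** The approximate solution moved down and up by [K * v ^+ 5] passes the lower and the
upper test. The term [96 / w ^+ 5] of the upper test is absorbed by the same
margin, as [1 / w <= v]. *)
Lemma delta_expansion : exists C : R, \forall w \near +oo,
  `|delta w - (1 + w^-1 * Y (ln w / w) (ln w)^-1) / 2| <= C * (ln w ^+ 5 / w ^+ 6).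
Proof.
have [C [v0 [C0 v00 v01 H]]] := inversion_approx R.
(* [2 * C] pays for the error of the approximation, whose two terms are equal for
[K * v = 1], and 400 for the summand [96 * X <= 384] of the upper test. *)
pose K := 2 * C + 400.
have K0 : 0 < K by rewrite /K; lra.
pose v1 := Num.min v0 (1 / (2 * K)).
have v10 : 0 < v1 by rewrite lt_min v00 divr_gt0// mulr_gt0.
exists (K / 2).
(* The bound 32 keeps [X / w] below [1 / 8]; the last one gives [v <= v1], because
[ln w <= 2 * Num.sqrt w]. *)
exists (Num.max 32 (Num.max (expR 1) ((2 / v1) ^+ 2))); split; first exact: num_real.
move=> w; rewrite !gt_max => /and3P[w32 we wv].
have w0 : 0 < w by apply: lt_trans w32.
have L1 : 1 <= ln w by rewrite -[1](@expRK R) ler_ln ?posrE ?expR_gt0// ltW.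
have L0 : 0 < ln w by apply: lt_le_trans L1.
set L := ln w in L1 L0 *.
pose v := L / w; pose t := L^-1.
have vp : 0 < v by rewrite divr_gt0.
have tp : 0 < t by rewrite invr_gt0.
have t1 : t <= 1 by rewrite invf_le1.
have vv1 : v <= v1.
  have s0 : 0 < Num.sqrt w by rewrite sqrtr_gt0.
  have s2 : w = Num.sqrt w ^+ 2 by rewrite sqr_sqrtr// ltW.
  have hs : 2 / v1 < Num.sqrt w.
    by rewrite -(@ltr_pXn2r _ 2) ?nnegrE ?(ltW s0) ?divr_ge0 ?(ltW v10)// -s2.
  have hL : L <= 2 * Num.sqrt w.
    by rewrite /L {1}s2 lnXn// mulr_natl ler_wMn2r// ltW// ln_sublinear.
  rewrite /v ler_pdivrMr//; apply: (le_trans hL).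
  rewrite {2}s2 expr2 mulrA ler_wpM2r ?(ltW s0)//.
  by move: hs; rewrite ltr_pdivrMr// mulrC => /ltW.
have vv0 : v <= v0 by apply: (le_trans vv1); rewrite ge_min lexx.
have vK : K * v <= 1 / 2.
  have : v <= 1 / (2 * K) by apply: (le_trans vv1); rewrite ge_min lexx orbT.
  by rewrite ler_pdivlMr ?mulr_gt0//; nra.
have v1' : v <= 1 by lra.
have u0 : 0 < w^-1 by rewrite invr_gt0.
have uE : t * v = w^-1 by rewrite /t /v; field; rewrite !gt_eqF.
have uv : w^-1 <= v by rewrite -uE ler_piMl// ltW.
have v5 : 0 < v ^+ 5 by rewrite exprn_gt0.
have v5v : K * v ^+ 5 <= K * v.
  rewrite ler_wpM2l ?(ltW K0)// exprS ler_piMr ?(ltW vp)// exprn_ile1// ltW//.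
set y := Y v t.
have main (X : R) : `|X - y| = K * v ^+ 5 ->
   [/\ 0 < X, X <= 4, 0 < w^-1 * X, w^-1 * X <= 1 / 8 &
    `|2 * ((w^-1 * X) * zeta (1 + w^-1 * X) * expR (- (v * X))) - y| <= 2 * C * v ^+ 5].
  move=> hX; have hX2 : `|X - y| <= 1 / 2 by rewrite hX; lra.
  have [X0 X4 hz] := H v t X vp vv0 tp t1 hX2.
  split=> //; first by rewrite mulr_gt0.
    by rewrite mulrC ler_pdivrMr//; lra.
  rewrite -uE; apply: (le_trans hz); rewrite -/y hX.
  rewrite mulrDr (_ : 2 * C * v ^+ 5 = C * v ^+ 5 + C * v ^+ 5); last by ring.
  rewrite lerD2l ler_wpM2l// mulrA [v * K]mulrC ler_piMl ?(ltW v5)//.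
  by lra.
have powE (X : R) : w `^ (- (1 + w^-1 * X)) = w^-1 * expR (- (v * X)).
  rewrite opprD powRD; last by apply/implyP => _; rewrite gt_eqF.
  rewrite powR_inv1 ?(ltW w0)//; congr (_ * _).
  by rewrite /powR gt_eqF//; congr expR; rewrite /v -/L; field; rewrite gt_eqF.
pose X1 := y - K * v ^+ 5; pose X2 := y + K * v ^+ 5.
have d1 : `|X1 - y| = K * v ^+ 5.
  by rewrite /X1 addrAC subrr add0r normrN ger0_norm// mulr_ge0 ?(ltW K0) ?(ltW v5).
have d2 : `|X2 - y| = K * v ^+ 5.
  by rewrite /X2 addrAC subrr add0r ger0_norm// mulr_ge0 ?(ltW K0) ?(ltW v5).
have [X10 X14 x10 x18 h1] := main X1 d1.
have [X20 X24 x20 x28 h2] := main X2 d2.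
have K2 : 2 * C * v ^+ 5 + 400 * v ^+ 5 = K * v ^+ 5 by rewrite /K; ring.
have s2 : 2 * ((1 + w^-1 * X1) / 2) = 1 + w^-1 * X1 by rewrite mulrC divfK.
have w7 : 7 <= w by lra.
have /andP[b1 b2] : (1 + w^-1 * X1) / 2 <= delta w <= (1 + w^-1 * X2) / 2.
  apply: delta_bounds => //.
  - by rewrite divr_gt0// addr_gt0.
  - by rewrite s2; exact: (cvg_zeta_laurent x10 x18).1.
  - rewrite s2 powE -(ltr_pM2r X10) mul1r.
    have -> : 2 * (w^-1 * expR (- (v * X1)) * zeta (1 + w^-1 * X1)) * X1 =
       2 * (w^-1 * X1 * zeta (1 + w^-1 * X1) * expR (- (v * X1))) by ring.
    move: h1; rewrite ler_norml => /andP[h1 _].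
    rewrite lerBrDl in h1; apply: lt_le_trans h1.
    by rewrite ltrD2l ltrN2 -K2 ltrDl mulr_gt0.
  - exact: ltW.
  - by lra.
  - exact: (cvg_zeta_laurent x20 x28).1.
  - rewrite powE -(ltr_pM2r X20) mul1r.
    have -> : (2 * (w^-1 * expR (- (v * X2)) * zeta (1 + w^-1 * X2)) + 96 / w ^+ 5) * X2 =
       2 * (w^-1 * X2 * zeta (1 + w^-1 * X2) * expR (- (v * X2))) + 96 * X2 * w^-1 ^+ 5.
      by rewrite exprVn; ring.
    move: h2; rewrite ler_norml => /andP[_ h2].
    rewrite lerBlDl in h2.
    have u5 : w^-1 ^+ 5 <= v ^+ 5 by apply: lerXn2r; rewrite ?nnegrE ?(ltW u0) ?(ltW vp).
    have h3 : 96 * X2 * w^-1 ^+ 5 <= 384 * v ^+ 5.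
      apply: ler_pM => //; last by lra.
        by rewrite mulr_ge0// ltW.
      by rewrite exprn_ge0// ltW.
    apply: (le_lt_trans (lerD h2 h3)).
    by rewrite -addrA ltrD2l -K2 ltrD2l ltr_pM2r// ltr_nat.
have E5 : K / 2 * (L ^+ 5 / w ^+ 6) = w^-1 * (K * v ^+ 5) / 2.
  by rewrite /v; field; rewrite gt_eqF.
rewrite E5 ler_norml; move: b1 b2; rewrite /X1 /X2 mulrBr mulrDr -/v -/t -/y.
by move=> b1 b2; apply/andP; split; lra.
Qed.

End main.

Theorem theorem1p9 (R : realType) :
  (fun n => series (@harmonic R) n - ln n%:R) @ \oo --> stieltjes R 0 /\
  exists P : nat -> {poly R},
    (forall j, (2 <= j <= 4)%N ->
       size (P j) = j.+1 /\ forall i, rat_stieltjes (P j)`_i) /\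
    exists C : R, \forall w \near +oo,
      `| delta w -
         (1 / 2 + 1 / w - 2 * ln w / w ^+ 2 + 2 * stieltjes R 0 / w ^+ 2 +
          \sum_(2 <= j < 5) (P j).[ln w] / w ^+ j.+1) |
        <= C * (ln w ^+ 5 / w ^+ 6).
Proof.
split; first exact: cvg_harmonic_sub_ln.
exists (fun j => Poly (inv_coef (@stieltjes R) j)); split.
  move=> j j24; split; first exact: size_inv_coef.
  by move=> i; rewrite coef_Poly; exact: rat_stieltjes_inv_coef.
have [C HC] := delta_expansion R; exists C.
near=> w.
have w1 : 1 < w by near: w; exact: nbhs_pinfty_gt.
rewrite expansion_jet; [|exact: lt_trans ltr01 w1|exact: ln_gt0].
by near: w.
Unshelve. all: by end_near. Qed.
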